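(* Let $K$ be a finitely generated field of positive transcendence degree over $\mathbb{F}_p$. If $\phi:A\to K\{\tau\}$ is a Drinfeld module defined over a finite subfield of $K$, then $\phi(\mathbb{F}_p^{\mathrm{alg}}K)$ is the direct sum of an infinite torsion submodule, namely $\mathbb{F}_p^{\mathrm{alg}}$ (which is the entire torsion submodule of $\phi$), and a free $A$-submodule of rank $\aleph_0$.
   Context: Setting: $p$ prime, $q$ a power of $p$, $A$ the ring of functions on a nonsingular projective curve over $\mathbb{F}_q$ regular away from a fixed closed point; $K\supseteq\mathbb{F}_q$. $K\{\tau\}$ twisted polynomials with $\tau(x)=x^q$. A Drinfeld module $\phi:A\to K\{\tau\}$ is a ring morphism with $\tau^0$-coefficient of $\phi_a$ equal to $i(a)$ (fixed morphism $i:A\to K$), not all $\phi_a$ of degree $0$ in $\tau$. ''Defined over a subfield $k$'' means all coefficients of all $\phi_a$ lie in $k$. $\mathbb{F}_p^{\mathrm{alg}}$ is the algebraic closure of $\mathbb{F}_p$ inside $K^{\mathrm{alg}}$ and $\mathbb{F}_p^{\mathrm{alg}}K$ the compositum. $\phi(L)$ is $L$ with $A$-action $a\cdot x=\phi_a(x)$; torsion of $\phi$ means points $x\in K^{\mathrm{alg}}$ with $\phi_a(x)=0$ for some nonzero $a$. *)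

(* Defs.v *)
From HB Require Import structures.
From mathcomp Require Import all_boot all_order all_algebra all_fingroup.
From mathcomp Require Import pgroup abelian finfield.
From mathcomp Require Import boolp classical_sets functions cardinality.
From mathcomp Require Import (canonicals) mpoly.

Set Implicit Arguments.
Unset Strict Implicit.
Unset Printing Implicit Defensive.

Import GRing.Theory.
Local Open Scope ring_scope.
Local Open Scope classical_set_scope.

Definition is_subfield (L : fieldType) (S : set L) : Prop :=
  divring_closed (mem S).

Definition subfield_gen (L : fieldType) (X : set L) : set L :=
  [set x | forall S : set L, is_subfield S -> X `<=` S -> S x].

Definition fin_gen_field (k L : fieldType) (u : {rmorphism k -> L}) : Prop :=
  exists s : seq L, subfield_gen (range u `|` [set` s]) = setT.

Definition alg_independent (k L : fieldType) (u : {rmorphism k -> L})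
    (n : nat) (t : n.-tuple L) : Prop :=
  forall P : mpoly.mpoly n k, mpoly.mmap u (tnth t) P = 0 -> P = 0.

Definition algebraic_over_set (L : fieldType) (S : set L) (x : L) : Prop :=
  exists2 P : {poly L}, P != 0 /\ (forall j, S P`_j) & root P x.

Definition has_trdeg (k L : fieldType) (u : {rmorphism k -> L}) (n : nat) :
    Prop :=
  exists2 t : n.-tuple L, alg_independent u t &
    forall x, algebraic_over_set (subfield_gen (range u `|` [set` t])) x.

(* A nonsingular projective curve over Fq is given by its function field F;
  its closed points are the valuation rings of F / Fq other than F; the one
  attached to a closed point is the local ring at that point, so that a
  function f is regular at V iff f lies in V. The constant field of F may be
  larger than Fq. *)

Definition is_function_field (Fq : finFieldType) (F : fieldType)
    (iF : {rmorphism Fq -> F}) : Prop :=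
  fin_gen_field iF /\ has_trdeg iF 1.

Definition is_closed_point (Fq : finFieldType) (F : fieldType)
    (iF : {rmorphism Fq -> F}) (V : set F) : Prop :=
  [/\ subring_closed (mem V), range iF `<=` V, V <> setT
    & forall f, V f \/ V f^-1].

Definition regular_away (Fq : finFieldType) (F : fieldType)
    (iF : {rmorphism Fq -> F}) (oo : set F) : set F :=
  [set f | forall V, is_closed_point iF V -> V <> oo -> V f].

Definition regular_pred (Fq : finFieldType) (F : fieldType)
    (iF : {rmorphism Fq -> F}) (oo : set F) : {pred F} :=
  fun f => `[< regular_away iF oo f >].

Record regular_fun (Fq : finFieldType) (F : fieldType)
    (iF : {rmorphism Fq -> F}) (oo : set F) := RegularFun {
  regular_val :> F;
  regular_valP : regular_val \in regular_pred iF oo }.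

Section RegularFunRing.
Variables (Fq : finFieldType) (F : fieldType) (iF : {rmorphism Fq -> F}).
Variable oo : set F.

Lemma regular_subring : subring_closed (regular_pred iF oo).
Proof.
split=> [|f g /asboolP fr /asboolP gr|f g /asboolP fr /asboolP gr];
  apply/asboolP => V hV ne; have [[h1 hB hM] _ _ _] := hV.
- by apply: set_mem.
- by apply: set_mem; apply: hB; apply: mem_set; [apply: fr | apply: gr].
- by apply: set_mem; apply: hM; apply: mem_set; [apply: fr | apply: gr].
Qed.

HB.instance Definition _ :=
  GRing.isSubringClosed.Build F (regular_pred iF oo) regular_subring.
HB.instance Definition _ := [isSub for @regular_val Fq F iF oo].
HB.instance Definition _ := [Choice of regular_fun iF oo by <:].
HB.instance Definition _ :=
  [SubChoice_isSubComNzRing of regular_fun iF oo by <:].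

End RegularFunRing.

Lemma finField_pnat_card (Fq : finFieldType) (K : fieldType)
  (iK : {rmorphism Fq -> K}) : [pchar K].-nat #|Fq|.
Proof.
have [p p_pr pFq] := finPcharP Fq.
have pK : p \in [pchar K] by rewrite (fmorph_pchar iK).
rewrite (eq_pnat _ (pcharf_eq pK)) -cardsT.
exact: abelem_pgroup (fin_ring_pchar_abelem pFq).
Qed.

Lemma qpowD (Fq : finFieldType) (K : fieldType) (iK : {rmorphism Fq -> K})
  (n : nat) : {morph (fun x : K => x ^+ (#|Fq| ^ n)) : x y / x + y}.
Proof.
by move=> x y; rewrite exprDn_pchar // pnatX (finField_pnat_card iK).
Qed.

(* A twisted polynomial is stored as its list of coefficients, the power of
   'X standing for the power of tau; only the product differs from that of
   {poly K}. *)
Definition twisted_poly (Fq : finFieldType) (K : fieldType)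
  (iK : {rmorphism Fq -> K}) : Type := {poly K}.

Section TwistedPoly.
Variables (Fq : finFieldType) (K : fieldType) (iK : {rmorphism Fq -> K}).
Local Notation q := #|Fq|.

HB.instance Definition _ := GRing.Zmodule.on (twisted_poly iK).

Definition tw_coef (P : twisted_poly iK) (n : nat) : K := (P : {poly K})`_n.
Definition tw_degree (P : twisted_poly iK) : nat := (size (P : {poly K})).-1.

Definition tw_one : twisted_poly iK := 1 : {poly K}.
Definition tw_mul (P Q : twisted_poly iK) : twisted_poly iK :=
  \sum_(i < size (P : {poly K})) \sum_(j < size (Q : {poly K}))
     (tw_coef P i * tw_coef Q j ^+ (q ^ i)) *: 'X^(i + j) : {poly K}.

Let q_gt0 n : (0 < q ^ n)%N.
Proof. by rewrite expn_gt0 (ltnW (finNzRing_gt1 _)). Qed.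

Let tw_mulE (P Q : {poly K}) m n : (size P <= m)%N -> (size Q <= n)%N ->
  tw_mul P Q = \sum_(i < m) \sum_(j < n)
     (P`_i * Q`_j ^+ (q ^ i)) *: 'X^(i + j) :> {poly K}.
Proof.
move=> lem len; rewrite /tw_mul /tw_coef.
rewrite (big_ord_widen m (fun i => \sum_(j < size Q)
   (P`_i * Q`_j ^+ (q ^ i)) *: 'X^(i + j) : {poly K})) // big_mkcond.
apply: eq_bigr => i _; case: ltnP => hi; last first.
  by rewrite big1 // => j _; rewrite (nth_default 0 hi) mul0r scale0r.
rewrite (big_ord_widen n (fun j =>
   (P`_i * Q`_j ^+ (q ^ i)) *: 'X^(i + j) : {poly K})) // big_mkcond.
apply: eq_bigr => j _; case: ltnP => hj //.
by rewrite (nth_default 0 hj) expr0n gtn_eqF ?q_gt0 // mulr0 scale0r.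
Qed.

Let tw_ind (Pr : {poly K} -> Prop) : Pr 0 ->
  (forall P Q, Pr P -> Pr Q -> Pr (P + Q)) ->
  (forall c n, Pr (c *: 'X^n)) -> forall P, Pr P.
Proof.
by move=> P0 PD PX P; rewrite -[P]coefK poly_def; apply: big_ind.
Qed.

Let tw_mulDl : left_distributive tw_mul +%R.
Proof.
move=> P Q R; pose m := maxn (size (P : {poly K})) (size (Q : {poly K})).
have hm : (size ((P : {poly K}) + Q)%R <= m)%N by exact: size_polyD.
rewrite (tw_mulE (m := m) hm (leqnn _)).
rewrite (tw_mulE (m := m) (leq_maxl _ _) (leqnn _)).
rewrite (tw_mulE (m := m) (leq_maxr _ _) (leqnn _)).
rewrite -big_split; apply: eq_bigr => i _ /=.
rewrite -big_split; apply: eq_bigr => j _ /=.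
by rewrite coefD mulrDl scalerDl.
Qed.

Let tw_mulDr : right_distributive tw_mul +%R.
Proof.
move=> R P Q; pose m := maxn (size (P : {poly K})) (size (Q : {poly K})).
have hm : (size ((P : {poly K}) + Q)%R <= m)%N by exact: size_polyD.
rewrite (tw_mulE (n := m) (leqnn _) hm).
rewrite (tw_mulE (n := m) (leqnn _) (leq_maxl _ _)).
rewrite (tw_mulE (n := m) (leqnn _) (leq_maxr _ _)).
rewrite -big_split; apply: eq_bigr => i _ /=.
rewrite -big_split; apply: eq_bigr => j _ /=.
by rewrite coefD (qpowD iK) mulrDr scalerDl.
Qed.

Let tw_mul0l P : tw_mul 0 P = 0.
Proof. by apply: (addIr (tw_mul 0 P)); rewrite -tw_mulDl !add0r. Qed.

Let tw_mul0r P : tw_mul P 0 = 0.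
Proof. by apply: (addIr (tw_mul P 0)); rewrite -tw_mulDr !add0r. Qed.

Let tw_mulX (a b : K) i j :
  tw_mul (a *: 'X^i : {poly K}) (b *: 'X^j : {poly K}) =
  (a * b ^+ (q ^ i)) *: 'X^(i + j) :> {poly K}.
Proof.
have hX (c : K) n : (size (c *: 'X^n) <= n.+1)%N.
  by rewrite (leq_trans (size_scale_leq _ _)) // size_polyXn.
rewrite (tw_mulE (hX a i) (hX b j)) (bigD1 ord_max) //=.
rewrite [X in _ + X]big1 => [|k nk]; last first.
  have {}nk : (k == i :> nat) = false by apply: negbTE.
  by rewrite big1 // => l _; rewrite coefZ coefXn nk mulr0 mul0r scale0r.
rewrite addr0 (bigD1 ord_max) //= big1 => [|l nl]; last first.
  have {}nl : (l == j :> nat) = false by apply: negbTE.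
  rewrite [X in _ * X ^+ _]coefZ [X in _ * (_ * X) ^+ _]coefXn nl mulr0.
  by rewrite expr0n gtn_eqF // mulr0 scale0r.
rewrite addr0.
by rewrite !coefZ !coefXn !eqxx !mulr1.
Qed.

Let tw_mulA : associative tw_mul.
Proof.
move=> P; elim/tw_ind: P => [|P P' IH IH'|a i] Q R; first by rewrite !tw_mul0l.
  by rewrite !tw_mulDl IH IH'.
elim/tw_ind: Q => [|Q Q' IH IH'|b j]; first by rewrite !(tw_mul0l, tw_mul0r).
  by rewrite !(tw_mulDl, tw_mulDr) IH IH'.
elim/tw_ind: R => [|R R' IH IH'|c k]; first by rewrite !tw_mul0r.
  by rewrite !tw_mulDr IH IH'.
rewrite !tw_mulX addnA; congr (_ *: _).
by rewrite exprMn mulrA -exprM -expnD addnC.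
Qed.

Let tw_mul1 : left_id tw_one tw_mul.
Proof.
elim/tw_ind => [|P P' IH IH'|a i]; first by rewrite tw_mul0r.
  by rewrite tw_mulDr IH IH'.
have -> : tw_one = (1 *: 'X^0 : {poly K}) by rewrite expr0 scale1r.
by rewrite tw_mulX expn0 expr1 mul1r add0n.
Qed.

Let tw_mulr1 : right_id tw_one tw_mul.
Proof.
elim/tw_ind => [|P P' IH IH'|a i]; first by rewrite tw_mul0l.
  by rewrite tw_mulDl IH IH'.
have -> : tw_one = (1 *: 'X^0 : {poly K}) by rewrite expr0 scale1r.
by rewrite tw_mulX expr1n mulr1 addn0.
Qed.

Let tw_one_neq0 : tw_one != 0.
Proof. exact: (oner_neq0 {poly K}). Qed.

HB.instance Definition _ := GRing.Zmodule_isNzRing.Build (twisted_poly iK)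
  tw_mulA tw_mul1 tw_mulr1 tw_mulDl tw_mulDr tw_one_neq0.

Section Eval.
Variables (E : fieldType) (eta : {rmorphism K -> E}).

Definition tw_eval (P : twisted_poly iK) (x : E) : E :=
  \sum_(k < size (P : {poly K})) eta (tw_coef P k) * x ^+ (q ^ k).

Let tw_evalE (P : {poly K}) m x : (size P <= m)%N ->
  tw_eval P x = \sum_(k < m) eta P`_k * x ^+ (q ^ k).
Proof.
move=> lem; rewrite /tw_eval /tw_coef.
rewrite (big_ord_widen m (fun k => eta P`_k * x ^+ (q ^ k))) // big_mkcond.
apply: eq_bigr => i _; case: ltnP => // hi.
by rewrite (nth_default 0 hi) rmorph0 mul0r.
Qed.

Lemma tw_evalDr P : {morph tw_eval P : x y / x + y}.
Proof.
move=> x y; rewrite /tw_eval -big_split; apply: eq_bigr => k _ /=.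
by rewrite (qpowD (eta \o iK)) mulrDr.
Qed.

Lemma tw_evalDl x : {morph tw_eval^~ x : P Q / P + Q}.
Proof.
move=> P Q; pose m := maxn (size (P : {poly K})) (size (Q : {poly K})).
have hm : (size ((P : {poly K}) + Q)%R <= m)%N by exact: size_polyD.
rewrite (tw_evalE _ hm) (tw_evalE (m := m) _ (leq_maxl _ _)).
rewrite (tw_evalE (m := m) _ (leq_maxr _ _)) -big_split.
by apply: eq_bigr => k _; rewrite coefD rmorphD mulrDl.
Qed.

Let tw_evalX (a : K) i x :
  tw_eval (a *: 'X^i : {poly K}) x = eta a * x ^+ (q ^ i).
Proof.
have hX : (size (a *: 'X^i) <= i.+1)%N.
  by rewrite (leq_trans (size_scale_leq _ _)) // size_polyXn.
rewrite (tw_evalE _ hX) (bigD1 ord_max) //= big1 => [|k nk]; last first.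
  have {}nk : (k == i :> nat) = false by apply: negbTE.
  by rewrite coefZ coefXn nk mulr0 rmorph0 mul0r.
rewrite addr0.
by rewrite coefZ coefXn eqxx mulr1.
Qed.

Let tw_eval0r P : tw_eval P 0 = 0.
Proof. by apply: (addIr (tw_eval P 0)); rewrite -tw_evalDr !add0r. Qed.

Let tw_eval0l x : tw_eval 0 x = 0.
Proof. by apply: (addIr (tw_eval 0 x)); rewrite -tw_evalDl !add0r. Qed.

Lemma tw_eval1 x : tw_eval 1 x = x.
Proof.
have -> : 1 = (1 *: 'X^0 : {poly K}) :> twisted_poly iK.
  by rewrite expr0 scale1r.
by rewrite tw_evalX rmorph1 mul1r expn0 expr1.
Qed.

Lemma tw_evalM (P Q : twisted_poly iK) x :
  tw_eval (P * Q) x = tw_eval P (tw_eval Q x).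
Proof.
rewrite -[P * Q]/(tw_mul P Q).
elim/tw_ind: P => [|P P' IH IH'|a i].
- by rewrite tw_mul0l !tw_eval0l.
- by rewrite tw_mulDl !tw_evalDl IH IH'.
elim/tw_ind: Q => [|Q Q' IH IH'|b j].
- by rewrite tw_mul0r !tw_eval0l tw_eval0r.
- by rewrite tw_mulDr !tw_evalDl tw_evalDr IH IH'.
rewrite tw_mulX !tw_evalX rmorphM rmorphXn exprMn mulrA.
by rewrite -exprM -expnD addnC.
Qed.

End Eval.
End TwistedPoly.

Definition is_drinfeld_module (Fq : finFieldType) (A : nzRingType)
    (K : fieldType) (iK : {rmorphism Fq -> K}) (i : {rmorphism A -> K})
    (phi : {rmorphism A -> twisted_poly iK}) : Prop :=
  (forall a, tw_coef (phi a) 0 = i a) /\ ~ (forall a, tw_degree (phi a) = 0%N).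

Definition defined_over (Fq : finFieldType) (A : nzRingType)
    (K : fieldType) (iK : {rmorphism Fq -> K})
    (phi : {rmorphism A -> twisted_poly iK}) (k : set K) : Prop :=
  forall a n, k (tw_coef (phi a) n).

(* phi(E), for an extension eta : K -> E: the additive group of E with the
   action a *: x := phi_a(x). *)
Definition drinfeld_points (Fq : finFieldType) (A : nzRingType)
    (K : fieldType) (iK : {rmorphism Fq -> K})
    (phi : {rmorphism A -> twisted_poly iK})
    (E : fieldType) (eta : {rmorphism K -> E}) : Type := E.

Section DrinfeldPoints.
Variables (Fq : finFieldType) (A : nzRingType) (K : fieldType).
Variables (iK : {rmorphism Fq -> K}) (phi : {rmorphism A -> twisted_poly iK}).
Variables (E : fieldType) (eta : {rmorphism K -> E}).
Local Notation V := (drinfeld_points phi eta).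

HB.instance Definition _ := GRing.Zmodule.on V.

Definition drinfeld_act (a : A) (x : V) : V := tw_eval eta (phi a) x.

Let actA a b x : drinfeld_act a (drinfeld_act b x) = drinfeld_act (a * b) x.
Proof. by rewrite /drinfeld_act rmorphM tw_evalM. Qed.

Let act1 : left_id 1 drinfeld_act.
Proof. by move=> x; rewrite /drinfeld_act rmorph1 tw_eval1. Qed.

Let actDr : right_distributive drinfeld_act +%R.
Proof. by move=> a x y; apply: tw_evalDr. Qed.

Let actDl x : {morph drinfeld_act^~ x : a b / a + b}.
Proof. by move=> a b; rewrite /drinfeld_act rmorphD; apply: tw_evalDl. Qed.

HB.instance Definition _ :=
  GRing.Zmodule_isLmodule.Build A V actA act1 actDr actDl.

End DrinfeldPoints.

Definition is_submodule (A : nzRingType) (V : lmodType A) (M : set V) : Prop :=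
  submod_closed (mem M).

Definition torsion_set (A : nzRingType) (V : lmodType A) : set V :=
  [set x | exists2 a : A, a != 0 & a *: x = 0].
Arguments torsion_set {A} V.

Definition is_basis (A : nzRingType) (V : lmodType A) (M : set V)
    (b : nat -> V) : Prop :=
  (forall x, M x <-> exists n (c : 'I_n -> A), x = \sum_(j < n) c j *: b j) /\
  (forall n (c : 'I_n -> A), \sum_(j < n) c j *: b j = 0 -> forall j, c j = 0).

Definition free_of_rank_aleph0 (A : nzRingType) (V : lmodType A) (M : set V) :
    Prop :=
  exists b : nat -> V, is_basis M b.

Definition direct_sum (A : nzRingType) (V : lmodType A) (L T M : set V) :
    Prop :=
  (forall x, L x <-> exists2 t, T t & exists2 m, M m & x = t + m) /\
  (forall x, T x -> M x -> x = 0).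

Definition is_algebraic_closure (K : fieldType) (Kalg : closedFieldType)
    (eta : {rmorphism K -> Kalg}) : Prop :=
  forall x, algebraicOver eta x.

Definition Fp_alg (p : nat) (K : fieldType) (u : {rmorphism 'F_p -> K})
    (E : fieldType) (eta : {rmorphism K -> E}) : set E :=
  [set x | algebraicOver (eta \o u) x].

Definition Fp_alg_compositum (p : nat) (K : fieldType)
    (u : {rmorphism 'F_p -> K}) (E : fieldType) (eta : {rmorphism K -> E}) :
    set E :=
  subfield_gen (Fp_alg u eta `|` range eta).

(* Main.v *)
Require Import Defs.
From HB Require Import structures.
From mathcomp Require Import all_boot all_order all_algebra finfield.
From mathcomp Require Import boolp classical_sets functions cardinality.
From mathcomp Require Import ring zify.

Set Implicit Arguments.
Unset Strict Implicit.
Unset Printing Implicit Defensive.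

Import GRing.Theory.
Local Open Scope ring_scope.
Local Open Scope classical_set_scope.

(* Let kbar be the algebraic closure of F_p, L = kbar K and R = k{tau}, on which A acts
   through phi. A point of kbar has a finite A-orbit, hence is torsion; a torsion point
   is a root of a nonzero polynomial over k.

   L has a height: choose a transcendence basis t_1, ..., t_d and let h(x) be the largest
   pole order of x at the valuations trivial on some algebraic closure kappa_i of
   F_p(t_j : j != i). Pole orders become integers after multiplication by a fixed n,
   because L is contained in a finite extension of kappa_i(t_i), so h takes values in
   nat. It is ultrametric, h(x^q) = q h(x), and it vanishes exactly on kbar, since the
   kappa_i meet in kbar. Choosing, level by level, k-bases of a complement of the q-th
   powers in the graded pieces of L shows L = kbar + R^(N) (direct sum) as R-modules.

   R embeds A, and division by a nonconstant phi_a shows that it is finitely generated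
   over A. Since A is an intersection of valuation rings of an algebraic extension of
   Fq(a), its finitely generated ideals are invertible, so R is projective and A is a
   direct summand of a power of R. Eilenberg's swindle then gives R^(N) = A^(N). *)

(** * Subfields and algebraic closure *)

(** The ring A need not be principal and phi_a mixes several powers of tau, so a direct choice of
    A-generators offers no leading terms to compare. Since phi has coefficients in k, L is a module
    over all of R, and there tau alone multiplies the height by q: Frobenius degrees can be peeled
    off one at a time, and what remains is linear algebra over k.

    Finiteness of k acts in two ways. It makes k perfect, so that roots of coefficients exist, both
    for independence and for division by phi_a; and it makes finite-dimensional k-spaces finite,
    which bounds the orbits of constants and forces infinitely many basis elements to occur.

    A height built from one index i would also vanish on the other t_j, which is why the whole
    family kappa_1, ..., kappa_d appears. Over each kappa_i the situation is that of a curve, whose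
    places have explicit uniformizers on the projective line below.

    R is only shown to be projective over A. In countably infinite rank this suffices, so no ideal
    class has to be computed. *)

Section SubfieldClosed.
Variables (E : fieldType) (S : set E) (hS : is_subfield S).

Lemma is_subfieldP : [/\ S 1, forall x y, S x -> S y -> S (x - y)
  & forall x y, S x -> S y -> S (x / y)].
Proof.
case: hS => h1 hB hd; split; first exact: set_mem.
- by move=> x y hx hy; apply: set_mem; apply: hB; apply: mem_set.
- by move=> x y hx hy; apply: set_mem; apply: hd; apply: mem_set.
Qed.
Lemma subfield1 : S 1. Proof. by case: is_subfieldP. Qed.
Lemma subfieldB x y : S x -> S y -> S (x - y).
Proof. by case: is_subfieldP => _ + _; apply. Qed.
Lemma subfielddiv x y : S x -> S y -> S (x / y).
Proof. by case: is_subfieldP => _ _; apply. Qed.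
Lemma subfield0 : S 0. Proof. by rewrite -(subrr 1); apply: subfieldB; exact: subfield1. Qed.
Lemma subfieldN x : S x -> S (- x).
Proof. by rewrite -sub0r; apply: subfieldB; exact: subfield0. Qed.
Lemma subfieldD x y : S x -> S y -> S (x + y).
Proof. by move=> hx hy; rewrite -[y]opprK; apply: subfieldB => //; apply: subfieldN. Qed.
Lemma subfieldV x : S x -> S x^-1.
Proof. by rewrite -div1r; apply: subfielddiv; exact: subfield1. Qed.
Lemma subfieldM x y : S x -> S y -> S (x * y).
Proof. by move=> hx hy; rewrite -[y]invrK; apply: subfielddiv => //; apply: subfieldV. Qed.
Lemma subfieldX x n : S x -> S (x ^+ n).
Proof.
by move=> hx; elim: n => [|n IH]; rewrite ?expr0 ?exprS; [exact: subfield1 | apply: subfieldM].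
Qed.
Lemma subfield_sum I (r : seq I) (P : pred I) (f : I -> E) :
  (forall i, P i -> S (f i)) -> S (\sum_(i <- r | P i) f i).
Proof. by move=> h; apply: big_ind => //; [exact: subfield0 | exact: subfieldD]. Qed.

(** The proof [hS] is part of the term so that the division ring structure can be inferred from
    [sfpred hS] itself. *)
Definition sfpred of is_subfield S : {pred E} := fun x => `[< S x >].
Lemma sfpred_divring : divring_closed (sfpred hS).
Proof.
split=> [|x y /asboolP hx /asboolP hy|x y /asboolP hx /asboolP hy]; apply/asboolP.
- exact: subfield1.
- exact: subfieldB.
- exact: subfielddiv.
Qed.
HB.instance Definition _ := GRing.isDivringClosed.Build E (sfpred hS) sfpred_divring.

Record subfieldT := SubfieldT { sfval :> E; _ : sfval \in sfpred hS }.
HB.instance Definition _ := [isSub for sfval].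
HB.instance Definition _ := [Choice of subfieldT by <:].
HB.instance Definition _ := [SubChoice_isSubIntegralDomain of subfieldT by <:].
HB.instance Definition _ := [SubIntegralDomain_isSubField of subfieldT by <:].

Definition sfincl : subfieldT -> E := \val.
HB.instance Definition _ := GRing.RMorphism.copy sfincl \val.
Lemma sfinclP a : S (sfincl a). Proof. by case: a => /= a h; apply/asboolP. Qed.
Lemma sfincl_lift x : S x -> exists a, x = sfincl a.
Proof.
move=> Sx; have h : x \in sfpred hS by apply/asboolP.
by exists (SubfieldT h).
Qed.

End SubfieldClosed.
Arguments sfincl {E S} hS.

Section AlgebraicClosure.
Variable E : fieldType.
Implicit Types S X : set E.

Lemma is_subfieldI S : S 1 -> (forall x y, S x -> S y -> S (x - y)) ->
  (forall x y, S x -> S y -> S (x / y)) -> is_subfield S.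
Proof.
move=> h1 hB hd; split; first exact: mem_set.
- by move=> x y /set_mem hx /set_mem hy; apply: mem_set; apply: hB.
- by move=> x y /set_mem hx /set_mem hy; apply: mem_set; apply: hd.
Qed.

Lemma subfield_gen_subfield X : is_subfield (subfield_gen X).
Proof.
apply: is_subfieldI => [S hS _|x y hx hy S hS hX|x y hx hy S hS hX].
- exact: subfield1.
- by apply: (subfieldB hS); [apply: hx | apply: hy].
- by apply: (subfielddiv hS); [apply: hx | apply: hy].
Qed.

Lemma sub_subfield_gen X : X `<=` subfield_gen X.
Proof. by move=> x Xx S _; apply. Qed.

Lemma subfield_gen_min X S : is_subfield S -> X `<=` S -> subfield_gen X `<=` S.
Proof. by move=> hS hX x; apply. Qed.

Lemma subfield_genS X Y : X `<=` Y -> subfield_gen X `<=` subfield_gen Y.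
Proof.
move=> h; apply: subfield_gen_min (subfield_gen_subfield _) _.
exact: subset_trans h (@sub_subfield_gen _).
Qed.

Lemma range_subfield (k : fieldType) (f : {rmorphism k -> E}) : is_subfield (range f).
Proof.
apply: is_subfieldI => [|_ _ [x _ <-] [y _ <-]|_ _ [x _ <-] [y _ <-]].
- by exists 1; rewrite ?rmorph1.
- by exists (x - y); rewrite ?rmorphB.
- by exists (x / y); rewrite ?fmorph_div.
Qed.

Definition acl S : set E := [set x | algebraic_over_set S x].

Lemma aclS S S' : S `<=` S' -> acl S `<=` acl S'.
Proof. by move=> h x [P [P0 hP] r]; exists P => //; split=> // j; apply: h. Qed.

Lemma lift_poly S (hS : is_subfield S) (P : {poly E}) : (forall j, S P`_j) ->
  exists Q : {poly subfieldT hS}, map_poly (sfincl hS) Q = P.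
Proof.
move=> hP.
have hP' j : P`_j \in sfpred hS by apply/asboolP.
exists (\poly_(j < size P) (SubfieldT (hP' j))).
apply/polyP => j; rewrite coef_map coef_poly; case: ltnP => //= h.
by rewrite nth_default.
Qed.

Lemma acl_sfincl S (hS : is_subfield S) x :
  acl S x <-> algebraicOver (sfincl hS) x.
Proof.
split=> [[P [P0 hP] r]|[Q Q0 r]].
  have [Q hQ] := lift_poly hS hP; exists Q; last by rewrite hQ.
  by apply: contraNneq P0 => Q0; rewrite -hQ Q0 rmorph0.
exists (map_poly (sfincl hS) Q) => //; split.
  by rewrite map_poly_eq0.
by move=> j; rewrite coef_map; exact: sfinclP.
Qed.

Lemma acl_range (k : fieldType) (f : {rmorphism k -> E}) x :
  acl (range f) x <-> algebraicOver f x.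
Proof.
split=> [[P [P0 hP] r]|[Q Q0 r]]; last first.
  by exists (map_poly f Q) => //; split; rewrite ?map_poly_eq0 // => j;
    rewrite coef_map; exists Q`_j.
pose g y := xget 0 [set c | f c = y].
have hg j : f (g P`_j) = P`_j.
  by rewrite /g; case: xgetP => //= h; case: (hP j) => c _ /h.
pose Q := \poly_(j < size P) g P`_j.
have hQ : map_poly f Q = P.
  apply/polyP => j; rewrite coef_map coef_poly /=; case: ltnP => h; first exact: hg.
  by rewrite rmorph0 nth_default.
exists Q; last by rewrite hQ.
by apply: contraNneq P0 => Q0; rewrite -hQ Q0 rmorph0.
Qed.

Lemma sub_acl S : is_subfield S -> S `<=` acl S.
Proof.
move=> hS x Sx; exists ('X - x%:P); last by rewrite root_XsubC.
split; first by rewrite polyXsubC_eq0.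
by move=> j; rewrite coefB coefX coefC; apply: (subfieldB hS);
  [case: (j == 1)%N | case: (j == 0)%N] => //; [exact: subfield1|exact: subfield0|exact: subfield0].
Qed.

Lemma acl_subfield S : is_subfield S -> is_subfield (acl S).
Proof.
move=> hS; apply: is_subfieldI.
- by apply: (sub_acl hS); exact: subfield1.
- by move=> x y /(acl_sfincl hS) hx /(acl_sfincl hS) hy; apply/(acl_sfincl hS); exact: algebraic_sub.
- by move=> x y /(acl_sfincl hS) hx /(acl_sfincl hS) hy; apply/(acl_sfincl hS); exact: algebraic_div.
Qed.

(** Over a field, algebraic and integral agree, and integrality passes from the coefficients of [P]
    to its roots. *)
Lemma acl_idem S : is_subfield S -> acl (acl S) `<=` acl S.
Proof.
move=> hS x [P [P0 hP] r]; apply/(acl_sfincl hS)/integral_algebraic.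
apply: (integral_root P0 r); apply/integral_poly => i.
by apply/integral_algebraic/(acl_sfincl hS).
Qed.

Lemma acl_minr S X : is_subfield S -> X `<=` acl S -> acl (subfield_gen X) `<=` acl S.
Proof.
move=> hS hX; apply: subset_trans (acl_idem hS); apply: aclS.
exact: subfield_gen_min (acl_subfield hS) hX.
Qed.

End AlgebraicClosure.

(** * Exchange property of algebraic dependence *)

Definition eval2 (k E : fieldType) (f : {rmorphism k -> E}) (y : E)
  (P : {poly {poly k}}) : {poly E} := map_poly (horner_eval y \o map_poly f) P.

Section Exchange.
Variables (k E : fieldType) (f : {rmorphism k -> E}).

Lemma subfield_gen1 y : subfield_gen (range f `|` [set y]) `<=`
  [set z | exists p q : {poly k}, (map_poly f q).[y] != 0 /\
     z = (map_poly f p).[y] / (map_poly f q).[y]].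
Proof.
apply: subfield_gen_min.
  apply: is_subfieldI.
  - by exists 1, 1; rewrite rmorph1 hornerC oner_neq0 divr1.
  - move=> _ _ [p [q [q0 ->]]] [p' [q' [q'0 ->]]].
    exists (p * q' - p' * q), (q * q').
    rewrite !(rmorphM, rmorphB) !hornerE mulf_neq0 //; split=> //.
    by rewrite -mulNr addf_div // mulNr.
  - move=> _ _ [p [q [q0 ->]]] [p' [q' [q'0 ->]]].
    have [p'0|p'0] := eqVneq (map_poly f p').[y] 0.
      by exists 0, 1; rewrite p'0 mul0r invr0 mulr0 !rmorph0 horner0 mul0r rmorph1 hornerC oner_neq0.
    exists (p * q'), (q * p'); rewrite !rmorphM !hornerE mulf_neq0 //; split=> //.
    by rewrite !invfM invrK [_^-1 * (map_poly f q').[y]]mulrC mulrACA.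
move=> z [[c _ <-]|->].
  by exists c%:P, 1; rewrite rmorph1 map_polyC !hornerC oner_neq0 divr1.
by exists 'X, 1; rewrite rmorph1 map_polyX !hornerE oner_neq0 divr1.
Qed.

Lemma eval2_horner y P x :
  (eval2 f y P).[x] = (map_poly (map_poly f) P).[x, y].
Proof.
by rewrite -horner2_swapXY horner_swapXY -map_poly_comp.
Qed.

Lemma acl_gen1P x y : acl (subfield_gen (range f `|` [set y])) x ->
  exists P, eval2 f y P != 0 /\ root (eval2 f y P) x.
Proof.
case=> Q [Q0 hQ] r.
have {}hQ j : exists pq : {poly k} * {poly k}, (map_poly f pq.2).[y] != 0 /\
    Q`_j = (map_poly f pq.1).[y] / (map_poly f pq.2).[y].
  by have [p [q h]] := subfield_gen1 (hQ j); exists (p, q).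
have [pq hpq] := choice hQ.
pose D := \prod_(j < size Q) (pq j).2.
have D0 : (map_poly f D).[y] != 0.
  by rewrite /D rmorph_prod horner_prod; apply/prodf_neq0 => j _; case: (hpq j).
pose P := \poly_(j < size Q) ((pq j).1 * \prod_(l < size Q | (l != j :> nat)) (pq l).2).
have hP : eval2 f y P = (map_poly f D).[y] *: Q.
  apply/polyP => j; rewrite coefZ coef_map coef_poly /=.
  case: ltnP => hj; last by rewrite rmorph0 /horner_eval horner0 nth_default ?mulr0.
  have [q0 ->] := hpq j.
  have -> : D = (pq j).2 * \prod_(l < size Q | (l != j :> nat)) (pq l).2.
    by rewrite /D (bigD1 (Ordinal hj)).
  by rewrite /horner_eval !rmorphM !hornerM; field.
exists P; rewrite hP; split; first by rewrite scaler_eq0 negb_or D0.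
by rewrite rootZ.
Qed.

Lemma gen1_acl x y P : eval2 f y P != 0 -> root (eval2 f y P) x ->
  acl (subfield_gen (range f `|` [set y])) x.
Proof.
move=> P0 r; exists (eval2 f y P) => //; split=> // j.
rewrite coef_map /= /horner_eval horner_coef.
apply: (subfield_sum (subfield_gen_subfield _)) => i _.
apply: (subfieldM (subfield_gen_subfield _)).
  by apply: sub_subfield_gen; left; rewrite coef_map; exists P`_j`_i.
by apply: (subfieldX (subfield_gen_subfield _)); apply: sub_subfield_gen; right.
Qed.

(** A bivariate relation between [x] and [y] is read with its variables swapped. It does not vanish
    identically once [x] is substituted: otherwise its leading coefficient would be a nonzero
    polynomial over [k] that kills [x]. *)
Lemma exchange_morph x y : acl (subfield_gen (range f `|` [set y])) x ->
  ~ algebraicOver f x -> acl (subfield_gen (range f `|` [set x])) y.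
Proof.
move=> /acl_gen1P[P [P0 r]] nx; apply: (@gen1_acl _ _ (swapXY P)).
  have {}P0 : swapXY P != 0.
    by rewrite swapXY_eq0; apply: contraNneq P0 => ->; rewrite /eval2 rmorph0.
  apply/eqP => h; apply: nx; exists (lead_coef (swapXY P)); first by rewrite lead_coef_eq0.
  by apply/rootP; move/polyP: h => /(_ (size (swapXY P)).-1); rewrite coef_map coef0.
rewrite /root eval2_horner -swapXY_map horner2_swapXY -eval2_horner.
exact: r.
Qed.

End Exchange.

Lemma range_sfincl (E : fieldType) (S : set E) (hS : is_subfield S) :
  range (sfincl hS) = S.
Proof.
apply/seteqP; split=> [_ [a _ <-]|x /(sfincl_lift hS)[a ->]]; [exact: sfinclP|by exists a].
Qed.

Lemma exchange (E : fieldType) (S : set E) (hS : is_subfield S) x y :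
  acl (subfield_gen (S `|` [set y])) x -> ~ acl S x ->
  acl (subfield_gen (S `|` [set x])) y.
Proof.
rewrite -{1 3}(range_sfincl hS) => h1 h2; apply: exchange_morph h1 _.
by move/(acl_sfincl hS).
Qed.

(** * Valuation rings *)

Definition srpred (E : nzRingType) (V : set E) of subring_closed (mem V) : {pred E} :=
  fun x => `[< V x >].
Lemma srpredP (E : nzRingType) (V : set E) (hV : subring_closed (mem V)) x :
  reflect (V x) (x \in srpred hV).
Proof. exact: asboolP. Qed.
Lemma srpred_subring (E : nzRingType) (V : set E) (hV : subring_closed (mem V)) :
  subring_closed (srpred hV).
Proof.
have [h1 hB hM] := hV.
split=> [|x y /srpredP hx /srpredP hy|x y /srpredP hx /srpredP hy]; apply/srpredP;
  apply: set_mem => //; [apply: hB | apply: hM]; exact: mem_set.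
Qed.
HB.instance Definition _ (E : nzRingType) (V : set E) (hV : subring_closed (mem V)) :=
  GRing.isSubringClosed.Build E (srpred hV) (srpred_subring hV).

Lemma subring_closedI (E : nzRingType) (S : set E) : S 1 ->
  (forall x y, S x -> S y -> S (x - y)) ->
  (forall x y, S x -> S y -> S (x * y)) -> subring_closed (mem S).
Proof.
move=> h1 hB hd; split; first exact: mem_set.
- by move=> x y /set_mem hx /set_mem hy; apply: mem_set; apply: hB.
- by move=> x y /set_mem hx /set_mem hy; apply: mem_set; apply: hd.
Qed.

Definition is_valring (E : fieldType) (V : set E) : Prop :=
  subring_closed (mem V) /\ forall f, V f \/ V f^-1.

(** * Chevalley's construction of valuation rings *)

Section Chevalley.
Variable E : fieldType.

(** With y = x^-1 and b the constant term of p', the second relation says that 1 - y b is y times a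
    combination of negative powers of f. Hence the top term a f^(n-1) of p(f), multiplied by 1 - y
    b, has lower degree in f. Now x = b + (1 - y b) x, and x is replaced by p(f) on the right. The
    factor 1 - y b is never inverted. *)
Lemma chevalley_reduce (A : set E) (hA : subring_closed (mem A)) (x f : E)
  (p p' : {poly E}) : x != 0 -> A x^-1 -> f != 0 -> (1 < size p)%N ->
  (size p' <= size p)%N ->
  p \is a polyOver (srpred hA) -> p' \is a polyOver (srpred hA) ->
  p.[f] = x -> p'.[f^-1] = x ->
  exists p2, [/\ p2 \is a polyOver (srpred hA), p2.[f] = x & (size p2 < size p)%N].
Proof.
move=> x0 /(srpredP hA) Ay f0 n1 le_mn hp hp' px p'x.
pose y := x^-1; pose n := size p; pose m := size p'.
pose b := p'`_0; pose a := lead_coef p.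
pose p0 := \poly_(i < n.-1) p`_i.
pose r := \sum_(1 <= j < m) (a * y * p'`_j) *: 'X^(n.-1 - j).
have m0 : (0 < m)%N.
  rewrite lt0n; apply: contra_neq x0 => /eqP; rewrite size_poly_eq0 => /eqP h.
  by rewrite -p'x h horner0.
have pE : x = p0.[f] + a * f ^+ n.-1.
  rewrite -px (@horner_coef_wide _ n.-1.+1) ?leqSpred // horner_poly.
  by rewrite big_ord_recr.
have p'E : x = b + \sum_(1 <= j < m) p'`_j * f ^- j.
  rewrite -{1}p'x horner_coef -/m -(big_mkord predT (fun j => p'`_j * f^-1 ^+ j)).
  rewrite big_ltn // expr0 mulr1; congr (_ + _).
  by apply: eq_bigr => j _; rewrite exprVn.
exists (b%:P + (1 - y * b) *: p0 + r).
have hb : b \in srpred hA by apply/polyOverP.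
have hr : r.[f] = a * f ^+ n.-1 * (1 - y * b).
  have -> : 1 - y * b = y * \sum_(1 <= j < m) p'`_j * f ^- j.
    by rewrite -[1](mulVf x0) -mulrBr {2}p'E [b + _]addrC addrK.
  rewrite /r horner_sum !mulr_sumr big_nat [RHS]big_nat.
  apply: eq_bigr => j /andP[j1 jm].
  rewrite hornerZ hornerXn expfB_cond; last first.
    by rewrite (negPf f0) add0n -ltnS (prednK (ltnW n1)) (leq_trans jm).
  by rewrite /y; field; rewrite ?f0 ?expf_neq0.
split.
- rewrite !(rpredD, polyOverC) // ?rpredB ?rpredM //.
    rewrite polyOverZ ?rpredB ?rpredM ?rpred1 //.
    by apply/polyOverP => i; rewrite coef_poly; case: ifP => // _; [apply/polyOverP | exact: rpred0].
  apply: rpred_sum => j _; rewrite polyOverZ ?rpredX ?polyOverX // !rpredM //.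
    by apply/polyOverP.
  by apply/polyOverP.
- rewrite !hornerD hornerC hornerZ hr [p0.[f]](_ : _ = x - a * f ^+ n.-1); last first.
    by rewrite pE addrK.
  by rewrite /y; field.
- have nE : n.-1.+1 = n by rewrite prednK // ltnW.
  rewrite -/n -nE ltnS; apply: (leq_trans (size_polyD _ _)); rewrite geq_max; apply/andP; split.
    apply: (leq_trans (size_polyD _ _)); rewrite geq_max; apply/andP; split.
      by rewrite (leq_trans (size_polyC_leq1 _)) // -ltnS nE.
    by rewrite (leq_trans (size_scale_leq _ _)) // size_poly.
  apply: (leq_trans (size_sum _ _ _)); apply/bigmax_leqP_seq => j.
  rewrite mem_index_iota => /andP[j1 jm] _.
  rewrite (leq_trans (size_scale_leq _ _)) // size_polyXn.
  by have : (m <= n)%N by []; move: n1; rewrite -/n; lia.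
Qed.

(** Descent on the total size: the longer of the two polynomials is shortened, with f and f^-1
    exchanging roles when it is p'. It is never constant, because its value x would then lie in
    [A]. *)
Lemma chevalley_contra (A : set E) (hA : subring_closed (mem A)) (x : E) :
  x != 0 -> A x^-1 -> ~ A x -> forall n f (p p' : {poly E}), f != 0 ->
  (size p + size p' < n)%N ->
  p \is a polyOver (srpred hA) -> p' \is a polyOver (srpred hA) ->
  p.[f] = x -> p'.[f^-1] = x -> False.
Proof.
move=> x0 Ay nAx; elim=> // n IH f p p' f0 lt hp hp' px p'x.
have big (g : E) (P : {poly E}) : P \is a polyOver (srpred hA) -> P.[g] = x -> (1 < size P)%N.
  move=> hP Px; rewrite ltnNge; apply/negP => /size1_polyC h.
  by apply: nAx; apply/(srpredP hA); rewrite -Px h hornerC; apply/polyOverP.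
have [le|/ltnW le] := leqP (size p') (size p).
  have [p2 [hp2 p2x lt2]] := chevalley_reduce x0 Ay f0 (big _ _ hp px) le hp hp' px p'x.
  by apply: (IH f p2 p' f0 _ hp2 hp' p2x p'x); rewrite -ltnS (leq_trans _ lt) // ltnS ltn_add2r.
rewrite -[f in p.[f]]invrK in px.
have f0' : f^-1 != 0 by rewrite invr_eq0.
have [p2 [hp2 p2x lt2]] := chevalley_reduce x0 Ay f0' (big _ _ hp' p'x) le hp' hp p'x px.
apply: (IH f^-1 p2 p f0' _ hp2 hp p2x px).
by rewrite -ltnS (leq_trans _ lt) // ltnS addnC ltn_add2l.
Qed.

Definition adjoin (A : set E) (hA : subring_closed (mem A)) (f : E) : set E :=
  [set z | exists2 p, p \is a polyOver (srpred hA) & z = p.[f]].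

Lemma adjoin_subring A hA f : subring_closed (mem (@adjoin A hA f)).
Proof.
apply: subring_closedI.
- by exists 1; rewrite ?rpred1 ?hornerC.
- move=> _ _ [p hp ->] [p' hp' ->]; exists (p - p'); first exact: rpredB.
  by rewrite hornerD hornerN.
- by move=> _ _ [p hp ->] [p' hp' ->]; exists (p * p'); rewrite ?hornerM // rpredM.
Qed.

Lemma adjoin_sub A hA f : A `<=` @adjoin A hA f.
Proof.
by move=> a /(srpredP hA) Aa; exists a%:P; rewrite ?hornerC // polyOverC.
Qed.

Lemma adjoin_gen A hA f : @adjoin A hA f f.
Proof. by exists 'X; rewrite ?hornerX // polyOverX. Qed.

(** Since x is transcendental, it is not in k0[x^-1]. A subring maximal among those that contain
    k0[x^-1] and omit x is a valuation ring: if f and f^-1 were both outside, adjoining either one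
    would produce x, against [chevalley_contra]. *)
Theorem exists_valring (k0 : set E) (hk : is_subfield k0) x : ~ acl k0 x ->
  exists V, [/\ is_valring V, k0 `<=` V & ~ V x].
Proof.
move=> nx.
have x0 : x != 0.
  by apply/eqP => x0; apply: nx; rewrite x0; apply: (sub_acl hk); exact: subfield0.
have hk' : subring_closed (mem k0).
  by apply: subring_closedI; [exact: subfield1 | exact: subfieldB | exact: subfieldM].
pose C0 := adjoin hk' x^-1.
have hC0 : subring_closed (mem C0) := @adjoin_subring _ hk' x^-1.
have nC0 : ~ C0 x.
  case=> p hp xp; apply: nx; rewrite -[x]invrK; apply: (subfieldV (acl_subfield hk)).
  exists ('X * p - 1); last by rewrite /root !hornerE -xp mulVf ?subrr.
  have h : 'X * p - 1 \is a polyOver (srpred hk') by rewrite rpredB ?rpred1 // rpredM // polyOverX.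
  split; last by move=> j; apply/(srpredP hk')/polyOverP.
  rewrite subr_eq0; apply/eqP => h1; move/(congr1 (fun P : {poly E} => P.[0])): h1.
  by rewrite !hornerE => /eqP; rewrite eq_sym oner_eq0.
pose P S := S = set0 \/ [/\ subring_closed (mem S), C0 `<=` S & ~ S x].
have [|A [PA maxA]] := @Zorn_bigcup _ P.
  move=> F FP tot; have [[S FS Sx0]|h0] := pselect (exists2 S, F S & S <> set0); last first.
    left; apply/seteqP; split=> // z [S FS Sz]; case: h0; exists S => // S0.
    by rewrite S0 in Sz.
  have [S0|[hS CS nS]] := FP _ FS; first by rewrite S0 in Sx0.
  have bigger a b : (\bigcup_(X in F) X) a -> (\bigcup_(X in F) X) b ->
      exists S, [/\ F S, subring_closed (mem S), S a & S b].
    move=> [S1 F1 S1a] [S2 F2 S2b].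
    have [S1e|[h1 _ _]] := FP _ F1; first by rewrite S1e in S1a.
    have [S2e|[h2 _ _]] := FP _ F2; first by rewrite S2e in S2b.
    by have [h|h] := tot _ _ F1 F2; [exists S2 | exists S1]; split=> //; apply: h.
  right; split.
  - apply: subring_closedI.
    + by exists S => //; apply: CS; apply/(srpredP hC0); exact: rpred1.
    + move=> a b ha hb; have [S' [FS' h a' b']] := bigger _ _ ha hb; exists S' => //.
      by apply/(srpredP h); apply: rpredB; apply/srpredP.
    + move=> a b ha hb; have [S' [FS' h a' b']] := bigger _ _ ha hb; exists S' => //.
      by apply/(srpredP h); apply: rpredM; apply/srpredP.
  - by move=> z Cz; exists S => //; apply: CS.
  - move=> [S' FS' S'x]; have [S0|[_ _]] := FP _ FS'; first by rewrite S0 in S'x.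
    exact.
have C1 : C0 1 by apply/(srpredP hC0); exact: rpred1.
case: PA => [A0|[hA CA nA]].
  have : A `<` C0 by rewrite A0; split; [exact: sub0set | by move=> h; exact: (h _ C1)].
  by move=> /maxA; case; right; split=> // ?.
have Ay : A x^-1 by apply: CA; exact: adjoin_gen.
exists A; split=> //; last by move=> z hz; apply/CA/adjoin_sub.
split=> // f; have [Af|nAf] := pselect (A f); [by left|right].
apply: contrapT => nAf'.
have f0 : f != 0.
  by apply: contra_notN nAf => /eqP ->; apply/(srpredP hA); exact: rpred0.
have key g : ~ A g -> exists2 p, p \is a polyOver (srpred hA) & p.[g] = x.
  move=> nAg; apply: contrapT => h; apply: (maxA (adjoin hA g)).
    split; first exact: adjoin_sub.
    by move=> h'; apply: nAg; apply: h'; exact: adjoin_gen.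
  right; split; [exact: adjoin_subring | |].
    by apply: subset_trans CA _; exact: adjoin_sub.
  by move=> [p hp xp]; apply: h; exists p.
have [p hp px] := key _ nAf; have [p' hp' p'x] := key _ nAf'.
exact: (chevalley_contra x0 Ay nA f0 (ltnSn _) hp hp' px p'x).
Qed.

End Chevalley.

(** * Finite extensions of a subfield *)

Section FiniteExtension.
Variables (E : fieldType) (S : set E) (hS : is_subfield S).
Local Notation sT := (subfieldT hS).
Local Notation lift := (map_poly (sfincl hS)).

(** An annihilating polynomial of w, divided by its power of X, becomes q with q(w) = 0 and q(0)
    nonzero; hence w^-1 is a polynomial in w. *)
Lemma ring_in_acl_subfield (D : set E) : subring_closed (mem D) ->
  S `<=` D -> D `<=` acl S -> is_subfield D.
Proof.
move=> hD SD Da.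
have D1 : D 1 by apply: SD; exact: subfield1.
apply: is_subfieldI => // [x y /(srpredP hD) hx /(srpredP hD) hy|x w].
  by apply/(srpredP hD); exact: rpredB.
move=> /(srpredP hD) hx Dw; have [->|w0] := eqVneq w 0.
  by rewrite invr0 mulr0; apply/(srpredP hD); exact: rpred0.
apply/(srpredP hD)/rpredM => //.
have [P P0 r] := (acl_sfincl hS w).1 (Da _ Dw).
have [m [q]] := multiplicity_XsubC P 0.
rewrite P0 /= => nq PE.
have rq : (lift q).[w] = 0.
  move: r; rewrite PE /root rmorphM rmorphXn /= map_polyXsubC rmorph0 subr0.
  by rewrite hornerM hornerXn mulf_eq0 expf_eq0 (negPf w0) andbF orbF => /eqP.
have [q' q'E] : exists q', q - q.[0]%:P = q' * ('X - 0%:P).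
  by apply/factor_theorem; rewrite /root !hornerE subrr.
have q0 : sfincl hS q.[0] != 0 by rewrite fmorph_eq0.
have -> : w^-1 = - (lift q').[w] / sfincl hS q.[0].
  move/(congr1 (fun R => (lift R).[w])): q'E.
  rewrite rmorphB rmorphM /= map_polyXsubC map_polyC rmorph0 subr0 !hornerE rq.
  move=> h; apply: (mulIf w0); rewrite mulVf //.
  by rewrite mulrAC mulNr -h sub0r opprK divff.
have hS' a : sfincl hS a \in srpred hD by apply/(srpredP hD); apply: SD; exact: sfinclP.
rewrite -fmorphV rpredM //; last exact: hS'.
rewrite rpredN horner_coef rpred_sum // => i _; rewrite rpredM ?rpredX //.
  by rewrite coef_map hS'.
exact/srpredP.
Qed.

Definition in_span (ys : seq E) (x : E) : Prop :=
  exists c : nat -> sT, x = \sum_(j < size ys) sfincl hS (c j) * ys`_j.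

Lemma in_span0 ys : in_span ys 0.
Proof. by exists (fun=> 0); rewrite big1 // => j _; rewrite mul0r. Qed.

Lemma in_spanD ys x y : in_span ys x -> in_span ys y -> in_span ys (x + y).
Proof.
move=> [c ->] [c' ->]; exists (fun j => c j + c' j); rewrite -big_split.
by apply: eq_bigr => j _ /=; rewrite mulrDl.
Qed.

Lemma in_spanZ ys (a : sT) y : y \in ys -> in_span ys (sfincl hS a * y).
Proof.
move=> hy; exists (fun j => if j == index y ys then a else 0).
have hi : (index y ys < size ys)%N by rewrite index_mem.
rewrite (bigD1 (Ordinal hi)) //= eqxx nth_index // big1 ?addr0 // => j nj.
by rewrite (negPf (_ : j != index y ys :> nat)) ?mul0r.
Qed.

Lemma in_span_sum ys I (r : seq I) (P : pred I) (F : I -> E) :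
  (forall i, P i -> in_span ys (F i)) -> in_span ys (\sum_(i <- r | P i) F i).
Proof. by move=> h; apply: big_ind => //; [exact: in_span0|exact: in_spanD]. Qed.

Lemma finite_span (gens : seq E) : (forall g, g \in gens -> acl S g) ->
  exists Z, [/\ is_subfield Z, S `<=` Z, [set` gens] `<=` Z, Z `<=` acl S &
    exists ys, forall x, Z x -> in_span ys x].
Proof.
elim: gens => [_|g gs IH hg].
  exists S; split=> //; first exact: sub_acl.
  exists [:: 1] => x /(sfincl_lift hS)[a ->].
  by rewrite -[sfincl hS a]mulr1; apply: in_spanZ; exact: mem_head.
have [Z [hZ SZ gsZ Za [ys hys]]] := IH (fun g' h => hg g' (@mem_behead _ (g :: gs) g' h)).
have ag : acl S g by apply: hg; rewrite mem_head.
pose Z' := [set z | exists p : {poly subfieldT hZ}, z = (map_poly (sfincl hZ) p).[g]].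
have hZ' : subring_closed (mem Z').
  apply: subring_closedI.
  - by exists 1; rewrite rmorph1 hornerC.
  - by move=> _ _ [p ->] [p' ->]; exists (p - p'); rewrite rmorphB !hornerE.
  - by move=> _ _ [p ->] [p' ->]; exists (p * p'); rewrite rmorphM !hornerE.
have ZZ' : Z `<=` Z'.
  move=> z Zz; have h : z \in sfpred hZ by apply/asboolP.
  by exists (SubfieldT h)%:P; rewrite map_polyC hornerC.
have Z'a : Z' `<=` acl S.
  move=> _ [p ->]; rewrite horner_coef; apply: (subfield_sum (acl_subfield hS)) => i _.
  apply: (subfieldM (acl_subfield hS)); last exact: (subfieldX (acl_subfield hS)).
  by apply: Za; rewrite coef_map; exact: sfinclP.
have SZ' : S `<=` Z' by exact: subset_trans ZZ'.
exists Z'; split=> //.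
- exact: ring_in_acl_subfield.
- move=> x /=; rewrite inE => /orP[/eqP ->|xg]; last by apply/ZZ'/gsZ.
  by exists 'X; rewrite map_polyX hornerX.
have [m m0 rm] : algebraicOver (sfincl hZ) g.
  by apply/acl_sfincl; apply: aclS ag.
pose ys' := [seq y * g ^+ i | y <- ys, i <- iota 0 (size m)].
exists ys' => _ [p ->].
have -> : (map_poly (sfincl hZ) p).[g] = (map_poly (sfincl hZ) (p %% m)).[g].
  by rewrite {1}(divp_eq p m) rmorphD rmorphM hornerD hornerM (rootP rm) mulr0 add0r.
rewrite horner_coef; apply: in_span_sum => i _.
have [|c ->] := hys (map_poly (sfincl hZ) (p %% m))`_i.
  by rewrite coef_map; exact: sfinclP.
rewrite mulr_suml; apply: in_span_sum => j _; rewrite -mulrA.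
apply/in_spanZ/allpairsP; exists (ys`_j, i : nat); rewrite mem_nth // mem_iota /= add0n.
split=> //; apply: leq_trans (ltn_ord i) _.
by rewrite size_map_poly ltnW // ltn_modp.
Qed.

(** The n + 1 powers 1, x, ..., x^n lie in a space spanned by n elements, and a kernel vector of
    their coordinate matrix is the polynomial. What matters later is that [n] does not depend on
    [x]. *)
Lemma finite_ext_degree (gens : seq E) : (forall g, g \in gens -> acl S g) ->
  exists n, forall x, subfield_gen (S `|` [set` gens]) x ->
    exists P : {poly E}, [/\ P != 0, forall j, S P`_j, (size P <= n.+1)%N & root P x].
Proof.
move=> /finite_span[Z [hZ SZ gZ _ [ys hys]]]; exists (size ys) => x xZ.
have {xZ} Zx : Z x by apply: (subfield_gen_min hZ _ xZ); rewrite subUset.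
pose n := size ys.
have [c hc] := choice (fun i => hys _ (subfieldX hZ i Zx)).
pose M : 'M[sT]_(n.+1, n) := \matrix_(i, j) c i j.
have K0 : kermx M != 0.
  rewrite kermx_eq0 /row_free; apply/eqP => h; have := rank_leq_col M.
  by rewrite h ltnn.
pose v := nz_row (kermx M).
have v0 : v != 0 by rewrite nz_row_eq0.
have vM : v *m M = 0 by apply/sub_kermxP; exact: nz_row_sub.
pose P := \poly_(i < n.+1) sfincl hS (v 0 (inord i)).
exists P; split.
- apply: contraNneq v0 => P0; apply/eqP/rowP => i; rewrite mxE; apply: (fmorph_inj (sfincl hS)).
  have := congr1 (fun p : {poly E} => p`_i) P0.
  by rewrite coef_poly ltn_ord inord_val coef0 => h.
- move=> j; rewrite coef_poly; case: ifP => _; last exact: subfield0.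
  by exact: sfinclP.
- exact: size_poly.
- rewrite /root horner_poly; apply/eqP.
  under eq_bigr => i _ do rewrite hc mulr_sumr inord_val.
  rewrite exchange_big big1 // => j _ /=.
  have := congr1 (fun A : 'rV_n => sfincl hS (A 0 j)) vM; rewrite !mxE rmorph_sum rmorph0 => h.
  transitivity ((\sum_(i < n.+1) sfincl hS (v 0 i * M i j)) * ys`_j); last by rewrite h mul0r.
  by rewrite mulr_suml; apply: eq_bigr => i _; rewrite rmorphM mxE mulrA.
Qed.

End FiniteExtension.

(** * Units, maximal ideal and dominant terms of a valuation ring *)

Section ValuationRing.
Variables (E : fieldType) (V : set E) (hV : is_valring V).
Let hR : subring_closed (mem V) := hV.1.

Lemma valring1 : V 1. Proof. by apply/(srpredP hR); exact: rpred1. Qed.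
Lemma valring0 : V 0. Proof. by apply/(srpredP hR); exact: rpred0. Qed.
Lemma valringN x : V x -> V (- x).
Proof. by move=> /(srpredP hR) h; apply/(srpredP hR); rewrite rpredN. Qed.
Lemma valringD x y : V x -> V y -> V (x + y).
Proof. by move=> /(srpredP hR) h /(srpredP hR) h'; apply/(srpredP hR); rewrite rpredD. Qed.
Lemma valringM x y : V x -> V y -> V (x * y).
Proof. by move=> /(srpredP hR) h /(srpredP hR) h'; apply/(srpredP hR); rewrite rpredM. Qed.
Lemma valringX x n : V x -> V (x ^+ n).
Proof. by move=> /(srpredP hR) h; apply/(srpredP hR); rewrite rpredX. Qed.
Lemma valring_sum I (r : seq I) (P : pred I) (f : I -> E) :
  (forall i, P i -> V (f i)) -> V (\sum_(i <- r | P i) f i).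
Proof. by move=> h; apply: big_ind => //; [exact: valring0 | exact: valringD]. Qed.
Lemma valring_inv x : ~ V x -> V x^-1.
Proof. by case: (hV.2 x). Qed.

Lemma valring_integral (p : {poly E}) x :
  p \is monic -> (forall i, V p`_i) -> root p x -> V x.
Proof.
move=> mp hp r; apply: contrapT => nVx; apply: (nVx).
have x0 : x != 0 by apply: contra_notN nVx => /eqP ->; exact: valring0.
have sp : (1 < size p)%N by rewrite (root_size_gt1 (monic_neq0 mp) r).
pose n := (size p).-2.
have spE : size p = n.+2 by rewrite /n; case: (size p) sp => [|[]].
have : x ^+ n.+1 = - \sum_(i < n.+1) p`_i * x ^+ i.
  move/rootP: r; rewrite horner_coef spE big_ord_recr /= addrC => /eqP.
  rewrite -[n.+1]/(n.+2.-1) -spE; move/monicP: (mp); rewrite /lead_coef => ->.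
  by rewrite mul1r addr_eq0 => /eqP.
move=> h; have -> : x = - \sum_(i < n.+1) p`_i * x^-1 ^+ (n - i).
  apply: (mulIf (expf_neq0 n x0)); rewrite -exprS h mulNr mulr_suml; congr (- _).
  apply: eq_bigr => i _; rewrite -mulrA; congr (_ * _).
  by rewrite exprVn mulrC -exprB ?subKn ?unitfE // -ltnS ?leq_subr // ltnS leq_subr.
apply/valringN/valring_sum => i _; apply: valringM => //.
by apply: valringX; exact: valring_inv.
Qed.

Lemma valring_acl S : is_subfield S -> S `<=` V -> acl S `<=` V.
Proof.
move=> hS SV x /(acl_sfincl hS) /integral_algebraic[p mp r].
apply: (valring_integral (p := map_poly (sfincl hS) p)) r; first by rewrite monic_map.
by move=> i; rewrite coef_map; apply: SV; exact: sfinclP.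
Qed.

Definition vunit u := [/\ u != 0, V u & V u^-1].

Lemma vunitM u v : vunit u -> vunit v -> vunit (u * v).
Proof.
move=> [u0 h1 h2] [v0 h3 h4]; split; first by rewrite mulf_neq0.
  exact: valringM.
by rewrite invfM; exact: valringM.
Qed.
Lemma vunitV u : vunit u -> vunit u^-1.
Proof. by move=> [u0 h1 h2]; split; rewrite ?invr_eq0 ?invrK. Qed.
Lemma vunit1 : vunit 1.
Proof. by split; rewrite ?oner_neq0 ?invr1 //; exact: valring1. Qed.
Lemma vunitX u n : vunit u -> vunit (u ^+ n).
Proof.
by move=> h; elim: n => [|n IH]; rewrite ?expr0 ?exprS; [exact: vunit1 | exact: vunitM].
Qed.
Lemma vunit_mulr u x : vunit u -> V (u * x) <-> V x.
Proof.
move=> [u0 h1 h2]; split=> h; last exact: valringM.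
by rewrite -[x](mulKf u0); exact: valringM.
Qed.

(** The maximal ideal of [V]. Zero is listed apart because its inverse is 0 by convention, which
    lies in [V]. *)
Definition vmax z := V z /\ (z = 0 \/ ~ V z^-1).

Lemma vmaxD z w : vmax z -> vmax w -> vmax (z + w).
Proof.
move=> [Vz [->|nz]] [Vw nw]; first by rewrite add0r.
case: nw => [->|nw]; first by rewrite addr0; split => //; right.
split; first exact: valringD.
have [->|zw0] := eqVneq (z + w) 0; [by left | right => h].
have z0 : z != 0 by apply: contra_notN nz => /eqP ->; rewrite invr0; exact: valring0.
have w0 : w != 0 by apply: contra_notN nw => /eqP ->; rewrite invr0; exact: valring0.
case: (hV.2 (w / z)) => h'.
  apply: nz; have -> : z^-1 = (1 + w / z) * (z + w)^-1 by field; rewrite z0 zw0.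
  by apply: valringM => //; apply: valringD => //; exact: valring1.
apply: nw; have -> : w^-1 = (1 + (w / z)^-1) * (z + w)^-1 by field; rewrite w0 z0 zw0.
by apply: valringM => //; apply: valringD => //; exact: valring1.
Qed.

Lemma vmax_sum I (r : seq I) (P : pred I) (f : I -> E) :
  (forall i, P i -> vmax (f i)) -> vmax (\sum_(i <- r | P i) f i).
Proof.
move=> h; apply: big_ind => //; last exact: vmaxD.
by split; [exact: valring0 | left].
Qed.

Lemma exists_dominant n (f : 'I_n -> E) : (exists i, f i != 0) ->
  exists i, f i != 0 /\ forall j, V (f j / f i).
Proof.
case=> i0 hi0.
suff h (s : seq 'I_n) : exists i, f i != 0 /\ forall j, j \in s -> V (f j / f i).
  by have [i [h1 h2]] := h (enum 'I_n); exists i; split=> // j; apply: h2; rewrite mem_enum.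
elim: s => [|a s [i [h1 h2]]]; first by exists i0.
have [fa|nfa] := pselect (V (f a / f i)).
  by exists i; split=> // j; rewrite inE => /orP[/eqP ->|/h2].
have fa0 : f a != 0.
  by apply: contra_notN nfa => /eqP ->; rewrite mul0r; exact: valring0.
exists a; split=> // j; rewrite inE => /orP[/eqP ->|js]; first by rewrite divff //; exact: valring1.
have -> : f j / f a = (f j / f i) * (f a / f i)^-1 by field; rewrite h1 fa0.
by apply: valringM; [exact: h2 | exact: valring_inv].
Qed.

(** Divide by a dominant term f_j. The remaining quotients lie in [V] and add up to -1, so they
    cannot all belong to the maximal ideal. *)
Lemma dependent_vunit n (f : 'I_n -> E) : (exists i, f i != 0) -> \sum_i f i = 0 ->
  exists i j, [/\ i != j, f j != 0 & vunit (f i / f j)].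
Proof.
move=> /exists_dominant[j [fj hj]] s0.
apply: contrapT => nex.
have : vmax (\sum_(i | i != j) f i / f j).
  apply: vmax_sum => i ij; split=> //; apply: contrapT => /not_orP[h1 /contrapT h2].
  by apply: nex; exists i, j; split=> //; split=> //; apply/eqP.
rewrite -mulr_suml; move: s0; rewrite (bigD1 j) //= => /eqP.
rewrite addrC addr_eq0 => /eqP ->; rewrite mulNr divff // => -[_ [/eqP|]].
  by rewrite oppr_eq0 oner_eq0.
by apply; rewrite invrN invr1; apply/valringN/valring1.
Qed.

End ValuationRing.

(** * Heights *)

Section Height.
Variables (E : closedFieldType) (k0 : set E) (hk : is_subfield k0).
Hypothesis k0_closed : acl k0 `<=` k0.
Variable s : E.
Let Es := subfield_gen (k0 `|` [set s]).
Hypothesis E_alg : forall x, acl Es x.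
Variable gens : seq E.
Let hEs : is_subfield Es := subfield_gen_subfield _.

(* [t] generates the value group of [V] on [k0(s)]: the places of the projective line
   above [s = b] and [s = oo] correspond to [t = s - b] and [t = s^-1]. *)
Definition uniformizer (V : set E) (t : E) : Prop :=
  [/\ [/\ is_valring V, k0 `<=` V, t != 0, V t & ~ V t^-1] &
    forall b, k0 b -> s - b != 0 ->
      exists2 j : int, (-1 <= j <= 1)%R & vunit V ((s - b) * t ^ j)].

Lemma Es_frac a : Es a -> exists p q : {poly subfieldT hk},
  (map_poly (sfincl hk) q).[s] != 0 /\
  a = (map_poly (sfincl hk) p).[s] / (map_poly (sfincl hk) q).[s].
Proof. by rewrite /Es -{1}(range_sfincl hk) => /subfield_gen1. Qed.

(** All roots of [p] lie in [E], hence in [k0], which is algebraically closed in [E]. A valuation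
    trivial on [k0] is therefore known on k0(s) from its values at the s - z. *)
Lemma horner_split (p : {poly subfieldT hk}) : (map_poly (sfincl hk) p).[s] != 0 ->
  exists r : seq E, (forall z, z \in r -> k0 z /\ s - z != 0) /\
  exists2 c, k0 c /\ c != 0 &
    (map_poly (sfincl hk) p).[s] = c * \prod_(z <- r) (s - z).
Proof.
move=> ps0; have [r] := closed_field_poly_normal (map_poly (sfincl hk) p).
set c := lead_coef _ => pE; exists r; split; last first.
  exists c.
    split; first by rewrite /c lead_coef_map; exact: sfinclP.
    by rewrite lead_coef_eq0; apply: contraNneq ps0 => ->; rewrite horner0.
  by rewrite pE hornerZ horner_prod; congr (_ * _); apply: eq_bigr => z _; rewrite !hornerE.
move=> z zr; have rz : root (map_poly (sfincl hk) p) z.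
  rewrite pE rootZ ?root_prod_XsubC //.
  by apply: contraNneq ps0 => c0; rewrite pE c0 scale0r horner0.
split; last by apply: contraNneq ps0 => /subr0_eq ->; rewrite (rootP rz).
apply: k0_closed; apply/(acl_sfincl hk); exists p => //.
by apply: contraNneq ps0 => ->; rewrite rmorph0 horner0.
Qed.

Lemma k0_vunit V c : is_valring V -> k0 `<=` V -> k0 c -> c != 0 -> vunit V c.
Proof. by move=> hV kV kc c0; split=> //; apply: kV => //; exact: (subfieldV hk). Qed.

(** Orders are encoded without a valuation map: that x * t^j is a unit means that [j] is the pole
    order of x measured in [t]. The order of a product is the sum of the orders of its linear
    factors. *)
Lemma uniformizer_horner V t p : uniformizer V t -> (map_poly (sfincl hk) p).[s] != 0 ->
  exists j : int, vunit V ((map_poly (sfincl hk) p).[s] * t ^ j).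
Proof.
move=> [[hV kV t0 Vt nVt] ht] /horner_split[r [hr [c [kc c0] ->]]].
elim: r hr => [|z r IH] hr.
  by exists 0; rewrite big_nil !mulr1; exact: k0_vunit.
have [|j hj] := IH; first by move=> y yr; apply: hr; rewrite inE yr orbT.
have [kz sz] := hr z (mem_head _ _).
have [j' _ hj'] := ht z kz sz.
exists (j' + j); rewrite big_cons expfzDr //; have := vunitM hV hj' hj.
by congr (vunit V _); ring.
Qed.

Lemma uniformizer_Es V t a : uniformizer V t -> Es a -> a != 0 ->
  exists j : int, vunit V (a * t ^ j).
Proof.
move=> ht /Es_frac[p [q [q0 ->]]]; rewrite mulf_eq0 invr_eq0 negb_or => /andP[p0 _].
have [[hV kV t0 Vt nVt] _] := ht.
have [j hj] := uniformizer_horner ht p0; have [j' hj'] := uniformizer_horner ht q0.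
exists (j - j'); have := vunitM hV hj (vunitV hj').
by rewrite expfzDr // -invr_expz invfM mulrACA.
Qed.

Lemma exists_uniformizer V : is_valring V -> k0 `<=` V -> V <> setT -> exists t, uniformizer V t.
Proof.
move=> hV kV nT.
have [Vs|nVs] := pselect (V s); last first.
  have s0 : s != 0 by apply: contra_notN nVs => /eqP ->; exact: valring0.
  exists s^-1; split; first by split=> //; rewrite ?invr_eq0 ?invrK //; exact: valring_inv.
  move=> b kb sb; exists 1 => //; rewrite expr1z.
  have nVsb : ~ V (s - b).
    by move=> h; apply: nVs; rewrite -[s](subrK b); apply: valringD => //; exact: kV.
  have E1 : (s - b) / s = 1 - b / s by field.
  have E2 : ((s - b) / s)^-1 = 1 + b / (s - b) by field; rewrite s0 sb.
  split; first by rewrite mulf_neq0 // invr_eq0.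
    rewrite E1; apply: valringD => //; [exact: valring1|]; apply: valringN => //.
    by apply: valringM => //; [exact: kV | exact: valring_inv].
  rewrite E2; apply: valringD => //; [exact: valring1|].
  by apply: valringM => //; [exact: kV | exact: valring_inv].
(* If all inverses of the s - a belong to [V], then so does k0(s), and integrality over it puts all
   of [E] into [V]. *)
have [[a ka nVa]|h] := pselect (exists2 a, k0 a & ~ V (s - a)^-1); last first.
  case: nT; apply/seteqP; split=> // x _.
  apply: (valring_acl hV hEs) (E_alg x) => a /Es_frac[p [q [q0 ->]]].
  apply: valringM => //.
    rewrite horner_coef; apply: valring_sum => // i _; apply: valringM => //.
      by apply: kV; rewrite coef_map; exact: sfinclP.
    exact: valringX.
  have [r [hr [c [kc c0] ->]]] := horner_split q0.
  rewrite invfM; apply: valringM => //; first by apply/kV/(subfieldV hk).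
  rewrite -prodfV big_seq; apply: big_ind => [||z zr]; [exact: valring1|exact: valringM|].
  by apply: contrapT => nz; apply: h; exists z => //; case: (hr z zr).
have Vsub b : k0 b -> V (s - b) by move=> kb; apply: valringD => //; apply: (valringN hV); exact: kV.
have sa : s - a != 0.
  by apply: contra_notN nVa => /eqP ->; rewrite invr0; exact: valring0.
exists (s - a); split; first by split=> //; exact: Vsub.
move=> b kb sb; have [<-|nab] := eqVneq a b.
  by exists (-1) => //; rewrite exprN1 divff //; exact: vunit1.
(* Here b differs from a. If s - b were also in the maximal ideal, so would be the nonzero constant
   b - a. *)
exists 0 => //; rewrite expr0z mulr1; split=> //; first exact: Vsub.
apply: contrapT => nb; have : vmax V (b - a).
  have -> : b - a = (s - a) + - (s - b) by ring.
  apply: vmaxD => //; first by split; [exact: Vsub | right].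
  split; first by apply: (valringN hV); exact: Vsub.
  by right => //; rewrite invrN => /(valringN hV); rewrite opprK.
case=> _ [/eqP|]; first by rewrite subr_eq0 eq_sym (negPf nab).
by case; apply: kV; apply: (subfieldV hk); exact: (subfieldB hk).
Qed.

(** The bound is uniform over all valuation rings at once, which makes the largest pole order exist
    although there are infinitely many places. *)
Definition poles_bounded x := exists m : nat, forall V t, uniformizer V t -> V (x * t ^+ m).

Lemma poles_boundedW x m m' : (m <= m')%N ->
  (forall V t, uniformizer V t -> V (x * t ^+ m)) -> forall V t, uniformizer V t -> V (x * t ^+ m').
Proof.
move=> le h V t ht; rewrite -(subnKC le) exprD mulrA.
have [[hV _ _ Vt _] _] := ht.
by apply: valringM => //; [exact: h | exact: valringX].
Qed.

Lemma poles_bounded_k0 x : k0 x -> poles_bounded x.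
Proof. by move=> kx; exists 0%N => V t [[hV kV _ _ _] _]; rewrite mulr1; exact: kV. Qed.

Lemma poles_boundedD x y : poles_bounded x -> poles_bounded y -> poles_bounded (x + y).
Proof.
move=> [m hm] [m' hm']; exists (maxn m m') => V t ht; have [[hV _ _ _ _] _] := ht.
rewrite mulrDl; apply: valringD => //.
  exact: (poles_boundedW (leq_maxl _ _) hm).
exact: (poles_boundedW (leq_maxr _ _) hm').
Qed.

Lemma poles_boundedM x y : poles_bounded x -> poles_bounded y -> poles_bounded (x * y).
Proof.
move=> [m hm] [m' hm']; exists (m + m')%N => V t ht; have [[hV _ _ _ _] _] := ht.
by rewrite exprD mulrACA; apply: valringM => //; [exact: hm | exact: hm'].
Qed.

Lemma poles_bounded_lin b : k0 b -> poles_bounded (s - b) /\ poles_bounded (s - b)^-1.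
Proof.
move=> kb; have [->|sb] := eqVneq (s - b) 0.
  by rewrite invr0; split; apply: poles_bounded_k0; exact: (subfield0 hk).
have h V t : uniformizer V t -> V ((s - b) * t ^+ 1) /\ V ((s - b)^-1 * t ^+ 1).
  move=> ht; have [[hV kV t0 Vt _] h] := ht; have [j] := h _ kb sb; rewrite expr1.
  case/andP=> j1 j2; have [->|[->|->]] : j = -1 \/ j = 0 \/ j = 1 by lia.
  - rewrite exprN1 => -[_ h1 h2]; split.
      have -> : (s - b) * t = ((s - b) / t) * (t * t) by field.
      by do 2!apply: valringM => //.
    by have -> : (s - b)^-1 * t = ((s - b) / t)^-1 by field; rewrite t0 sb.
  - by rewrite expr0z mulr1 => -[_ h1 h2]; split; apply: valringM.
  - rewrite expr1z => -[_ h1 h2]; split => //.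
    have -> : (s - b)^-1 * t = ((s - b) * t)^-1 * (t * t) by field; rewrite t0 sb.
    by do 2!apply: valringM => //.
by split; exists 1%N => V t ht; have [] := h V t ht.
Qed.

Lemma poles_bounded_Es x : Es x -> poles_bounded x.
Proof.
move=> /Es_frac[p [q [q0 ->]]].
have hs : poles_bounded s by have [] := poles_bounded_lin (subfield0 hk); rewrite subr0.
apply: poles_boundedM.
  rewrite horner_coef; apply: big_ind => [|x' y|i _]; first by apply: poles_bounded_k0; exact: (subfield0 hk).
    exact: poles_boundedD.
  apply: poles_boundedM; first by rewrite coef_map; apply: poles_bounded_k0; exact: sfinclP.
  by elim: (i : nat) => [|n IH]; rewrite ?expr0 ?exprS; [apply: poles_bounded_k0; exact: (subfield1 hk)|exact: poles_boundedM].
have [r [hr [c [kc c0] ->]]] := horner_split q0.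
rewrite invfM; apply: poles_boundedM; first by apply: poles_bounded_k0; exact: (subfieldV hk).
rewrite -prodfV big_seq; apply: big_ind => [||z zr]; [by apply: poles_bounded_k0; exact: (subfield1 hk)|exact: poles_boundedM|].
by have [kz _] := hr z zr; have [] := poles_bounded_lin kz.
Qed.

(** If x is a root of a monic p of degree n, then x t^M is a root of the monic polynomial with
    coefficients p_i t^(M (n - i)). For M bounding the poles of every p_i these are in [V], which is
    integrally closed. *)
Lemma poles_bounded_all x : poles_bounded x.
Proof.
have /(acl_sfincl hEs)/integral_algebraic[p mp r] := E_alg x.
have hp i : poles_bounded (sfincl hEs p`_i) by apply: poles_bounded_Es; exact: sfinclP.
have [m hm] := choice hp.
pose M := \max_(i < size p) m i.
exists M => V t ht; have [[hV kV t0 Vt _] _] := ht.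
pose P := \poly_(i < size p) (sfincl hEs p`_i * t ^+ (M * ((size p).-1 - i))).
have sp0 : (0 < size p)%N by rewrite size_poly_gt0 monic_neq0.
have lP : lead_coef P = 1.
  rewrite lead_coef_poly // ?subnn ?muln0 ?mulr1.
    by move/monicP: mp; rewrite /lead_coef => ->; rewrite rmorph1.
  by move/monicP: mp; rewrite /lead_coef => ->; rewrite rmorph1 oner_neq0.
apply: (valring_integral hV (p := P)).
- by rewrite monicE lP.
- move=> i; rewrite coef_poly; case: ltnP => ip; last exact: valring0.
  have [->|ne] := eqVneq i (size p).-1.
    rewrite subnn muln0 mulr1; move/monicP: mp; rewrite /lead_coef => ->.
    by rewrite rmorph1; exact: valring1.
  apply: (poles_boundedW _ (hm i)) ht; apply: (@leq_trans M).
    exact: (leq_bigmax (Ordinal ip)).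
  by rewrite leq_pmulr // subn_gt0; lia.
- rewrite /root horner_poly; apply/eqP.
  transitivity ((map_poly (sfincl hEs) p).[x] * t ^+ (M * (size p).-1)); last first.
    by rewrite (rootP r) mul0r.
  rewrite horner_coef size_map_poly mulr_suml; apply: eq_bigr => i _.
  rewrite coef_map exprMn -!exprM -!mulrA; congr (_ * _); rewrite mulrCA; congr (_ * _).
  rewrite -exprD; congr (_ ^+ _); rewrite -mulnDr subnK //.
  by have := ltn_ord i; lia.
Qed.

Let Z := subfield_gen (Es `|` [set` gens]).

(** In a relation of degree at most n over k0(s), two nonzero terms have the same valuation. So the
    valuation of x, multiplied by some a with 0 < a <= n, is an integral multiple of that of [t],
    and n! is divisible by each such a. *)
Lemma uniform_exponent : exists2 N : nat, (0 < N)%N & forall x, Z x -> x != 0 ->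
  forall V t, uniformizer V t -> exists j : int, vunit V (x ^+ N * t ^ j).
Proof.
have [n hn] := finite_ext_degree hEs (gens := gens) (fun g _ => E_alg g).
exists (n`!)%N; first exact: fact_gt0.
move=> x Zx x0 V t ht; have [[hV _ t0 _ _] _] := ht.
have [P [P0 hP sP r]] := hn x Zx.
pose f (i : 'I_n.+1) := P`_i * x ^+ i.
have f0 : exists i, f i != 0.
  have lt : ((size P).-1 < n.+1)%N by rewrite prednK ?size_poly_gt0.
  by exists (Ordinal lt); rewrite mulf_neq0 ?expf_neq0 // -/(lead_coef P) lead_coef_eq0.
have sf0 : \sum_i f i = 0 by rewrite -(horner_coef_wide _ sP) (rootP r).
have [i [j [ij fj [fij h1 h2]]]] := dependent_vunit hV f0 sf0.
wlog lt : i j ij fj fij h1 h2 / (j < i)%N => [hw|].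
  have [ji|ij'|/val_inj e] := ltngtP j i; first exact: (hw i j).
    have fi : f i != 0 by move: fij; rewrite mulf_eq0 negb_or => /andP[].
    have ji : f j / f i = (f i / f j)^-1 by rewrite invf_div.
    apply: (hw j i) => //; first by rewrite eq_sym.
    - by rewrite ji invr_eq0.
    - by rewrite ji.
    - by rewrite ji invrK.
  by rewrite e eqxx in ij.
have fi : f i != 0 by move: fij; rewrite mulf_eq0 negb_or => /andP[].
have Pi0 : P`_i != 0 by move: fi; rewrite mulf_eq0 negb_or => /andP[].
have Pj0 : P`_j != 0 by move: fj; rewrite mulf_eq0 negb_or => /andP[].
have [a [c h]] : exists a (c : int), [/\ (0 < a <= n)%N & vunit V (x ^+ a * t ^ c)].
  have [b hb] := uniformizer_Es ht (hP i) Pi0; have [b' hb'] := uniformizer_Es ht (hP j) Pj0.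
  exists (i - j)%N, (b' - b); split; first by have := ltn_ord i; lia.
  have -> : x ^+ (i - j) * t ^ (b' - b) =
      f i / f j * (P`_j * t ^ b') / (P`_i * t ^ b).
    have -> : f i = P`_i * (x ^+ (i - j) * x ^+ j) by rewrite -exprD subnK // ltnW.
    rewrite /f expfzDr // -invr_expz.
    by field; rewrite Pi0 Pj0 expf_neq0 ?expfz_neq0.
  by apply: vunitM => //; [apply: vunitM => //; split | exact: vunitV].
case: h => /andP[a0 an] hu.
have /dvdnP[e eE] : (a %| n`!)%N by rewrite dvdn_fact // a0.
exists (c * e%:Z).
by rewrite eE mulnC exprM -exprz_exp -exprnP -exprMn; exact: vunitX.
Qed.

Lemma uniformizer_exprz V t (j : int) : uniformizer V t -> V (t ^ j) <-> (0 <= j)%R.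
Proof.
move=> [[hV _ t0 Vt nVt] _]; case: j => [m|m]; split=> // h; first exact: valringX.
case: nVt; have -> : t^-1 = t ^ (Negz m) * t ^+ m.
  by rewrite -[t ^ _]/(t ^- m.+1) exprS invfM -mulrA mulVf ?mulr1 ?expf_neq0.
by apply: valringM => //; exact: valringX.
Qed.

(* [h x] is the largest pole order of [x ^+ N] over all valuation rings that contain [k0];
   the exponent [N] makes all pole orders integers. *)
Theorem exists_height : exists h : E -> nat,
  [/\ forall x, h x = 0%N <-> k0 x,
      forall x y, (h (x + y)%R <= maxn (h x) (h y))%N,
      forall c x, k0 c -> (h (c * x)%R <= h x)%N &
      forall x e, Z x -> (0 < e)%N -> h (x ^+ e) = (e * h x)%N].
Proof.
have [N N0 hN] := uniform_exponent.
pose G m x := forall V t, uniformizer V t -> V (x ^+ N * t ^+ m).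
have GW m m' x : (m <= m')%N -> G m x -> G m' x by exact: poles_boundedW.
have exG x : exists m, `[< G m x >].
  have [m hm] := poles_bounded_all x; exists (N * m)%N; apply/asboolP => V t ht.
  have [[hV _ _ _ _] _] := ht; rewrite mulnC exprM -exprMn; apply: valringX => //.
  exact: hm.
pose h x := ex_minn (exG x).
have hP x : G (h x) x by rewrite /h; case: ex_minnP => m /asboolP.
have hmin x m : G m x -> (h x <= m)%N.
  by move=> Gm; rewrite /h; case: ex_minnP => m' _; apply; apply/asboolP.
exists h; split.
- move=> x; split=> [hx0|kx]; last first.
    apply/eqP; rewrite -leqn0; apply: hmin => V t [[hV kV _ _ _] _].
    by rewrite mulr1; apply: valringX => //; exact: kV.
  apply: contrapT => nkx; have [V [hV kV nVx]] : exists V, [/\ is_valring V, k0 `<=` V & ~ V x].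
    by apply: (exists_valring hk) => /k0_closed.
  have [t ht] : exists t, uniformizer V t by apply: exists_uniformizer => // VT; apply: nVx; rewrite VT.
  have := hP x V t ht; rewrite hx0 mulr1 => Vx; apply: nVx.
  have x0 : x != 0 by apply: contra_notN nkx => /eqP ->; exact: subfield0.
  apply: contrapT => nVx; apply: (nVx); have -> : x = x ^+ N * x^-1 ^+ N.-1.
    by rewrite exprVn -{1}(prednK N0) exprSr mulrAC divff ?mul1r ?expf_neq0.
  by apply: valringM => //; apply: valringX => //; exact: valring_inv.
- move=> x y; apply: hmin => V t ht; have [[hV _ _ _ _] _] := ht.
  have hx := GW _ _ _ (leq_maxl (h x) (h y)) (hP x) V t ht.
  have hy := GW _ _ _ (leq_maxr (h x) (h y)) (hP y) V t ht.
  move: hx hy; set m := maxn _ _ => hx hy.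
  have [x0|x0] := eqVneq x 0; first by rewrite x0 add0r.
  have [y0|y0] := eqVneq y 0; first by rewrite y0 addr0.
  case: (hV.2 (x / y)) => xy.
    have -> : x + y = (1 + x / y) * y by field.
    rewrite exprMn -mulrA; apply: valringM => //; apply: valringX => //.
    by apply: valringD => //; exact: valring1.
  have -> : x + y = (1 + (x / y)^-1) * x by field; rewrite x0 y0.
  rewrite exprMn -mulrA; apply: valringM => //; apply: valringX => //.
  by apply: valringD => //; exact: valring1.
- move=> c x kc; apply: hmin => V t ht; have [[hV kV _ _ _] _] := ht.
  by rewrite exprMn -mulrA; apply: valringM => //; [apply: valringX => //; exact: kV | exact: hP].
- move=> x e Zx e0; apply/eqP; rewrite eqn_leq; apply/andP; split.
    apply: hmin => V t ht; have [[hV _ _ _ _] _] := ht.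
    rewrite -exprM mulnC exprM [(e * _)%N]mulnC exprM -exprMn.
    by apply: valringX => //; exact: hP.
  case hx : (h x) => [|l]; first by rewrite muln0.
  (* Minimality of [h x] supplies a valuation ring where the pole order of [x ^+ N] exceeds l;
     raising to the power e multiplies this order by e. *)
  have : ~ G l x by move=> /hmin; rewrite hx ltnn.
  move=> /existsNP[V /existsNP[t /not_implyP[ht nV]]].
  have [[hV _ t0 _ _] _] := ht.
  have x0 : x != 0.
    apply: contra_notN nV => /eqP ->; rewrite expr0n eqn0Ngt N0 mul0r; exact: valring0.
  have [j hj] := hN x Zx x0 V t ht.
  have ge_iff (a : nat) (b : int) y : y != 0 -> vunit V (y * t ^ b) ->
      V (y * t ^+ a) <-> (b <= a%:Z)%R.
    move=> y0 hu; have -> : y * t ^+ a = (y * t ^ b) * t ^ (a%:Z - b).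
      by rewrite -mulrA -expfzDr // addrC subrK.
    by rewrite vunit_mulr // uniformizer_exprz // Num.Theory.subr_ge0.
  have lj : (l.+1%:Z <= j)%R.
    have : ~~ (j <= l%:Z)%R.
      by apply/negP => /(ge_iff _ _ _ (expf_neq0 N x0) hj).
    by lia.
  have := hP (x ^+ e) V t ht; rewrite -exprM mulnC exprM.
  have hu : vunit V ((x ^+ N) ^+ e * t ^ (j * e%:Z)).
    by rewrite -exprz_exp -exprnP -exprMn; exact: vunitX.
  move/(ge_iff _ _ _ (expf_neq0 _ (expf_neq0 N x0)) hu) => le.
  have : (l.+1%:Z * e%:Z <= (h (x ^+ e))%:Z)%R by apply: Order.POrderTheory.le_trans le; nia.
  by rewrite mulnC; lia.
Qed.

End Height.

Lemma subfield_gen_id (E : fieldType) (S : set E) : is_subfield S -> subfield_gen S `<=` S.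
Proof. by move=> hS; apply: subfield_gen_min. Qed.

(** * Height attached to a transcendence basis *)

Section TranscendenceBasis.
Variables (k : fieldType) (E : closedFieldType) (f : {rmorphism k -> E}).
Variables (d : nat) (t : 'I_d -> E).
Let others i := subfield_gen (range f `|` [set t j | j in [set j | j != i]]).
Hypothesis t_indep : forall i, ~ acl (others i) (t i).
Hypothesis E_alg : forall x, acl (subfield_gen (range f `|` range t)) x.

Let others_subfield i : is_subfield (others i) := subfield_gen_subfield _.

(** The t_j are removed one at a time. If x stopped being algebraic when t_m is removed, the
    exchange property would make t_m algebraic over x and the later t_j. As x is algebraic over the
    t_j with j != m, so would be t_m. *)
Lemma bigcap_acl x : (forall i, acl (others i) x) -> acl (range f) x.
Proof.
move=> hx; pose W m := range f `|` [set t j | j in [set j : 'I_d | (m <= j)%N]].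
have h m : (m <= d)%N -> acl (subfield_gen (W m)) x.
  elim: m => [_|m IH md].
    apply: aclS (E_alg x); apply: subfield_genS => y [fy|[j _ <-]]; first by left.
    by right; exists j.
  apply: contrapT => nx; pose i := Ordinal md.
  have hS := subfield_gen_subfield (W m.+1).
  have : acl (subfield_gen (subfield_gen (W m.+1) `|` [set t i])) x.
    apply: aclS (IH (ltnW md)); apply: subfield_genS => y [fy|[j /= mj <-]].
      by left; apply: sub_subfield_gen; left.
    have [->|ji] := eqVneq j i; first by right.
    left; apply: sub_subfield_gen; right; exists j => //=.
    by move: ji; rewrite -val_eqE /= => ji; rewrite ltn_neqAle eq_sym ji.
  move=> /(exchange hS)/(_ nx) ti; apply: (@t_indep i).
  apply: (acl_minr (others_subfield i) _ ti) => y [Wy|->]; last exact: hx.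
  apply: (sub_acl (others_subfield i)); apply: subfield_genS Wy => z [fz|[j /= mj <-]].
    by left.
  by right; exists j => //=; rewrite -val_eqE /= gtn_eqF.
apply: aclS (h d (leqnn d)); apply: subset_trans (subfield_gen_id (range_subfield f)).
apply: subfield_genS => y [//|[j /=]]; by rewrite leqNgt ltn_ord.
Qed.

Theorem exists_total_height (gens : seq E) :
  let L := subfield_gen (acl (range f) `|` [set` gens]) in
  exists h : E -> nat,
  [/\ forall x, h x = 0%N <-> acl (range f) x,
      forall x y, (h (x + y)%R <= maxn (h x) (h y))%N,
      forall c x, acl (range f) c -> (h (c * x)%R <= h x)%N &
      forall x e, L x -> (0 < e)%N -> h (x ^+ e) = (e * h x)%N].
Proof.
move=> L.
have sub_oth i : acl (range f) `<=` acl (others i).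
  by apply: aclS; apply: subset_trans (@sub_subfield_gen _ _); exact: subsetUl.
have hi i : exists h : E -> nat,
  [/\ forall x, h x = 0%N <-> acl (others i) x,
      forall x y, (h (x + y)%R <= maxn (h x) (h y))%N,
      forall c x, acl (others i) c -> (h (c * x)%R <= h x)%N &
      forall x e, L x -> (0 < e)%N -> h (x ^+ e) = (e * h x)%N].
  have hk := acl_subfield (others_subfield i).
  have [|h [h1 h2 h3 h4]] := exists_height hk (acl_idem (others_subfield i)) (s := t i) _ gens.
    move=> x; apply: aclS (E_alg x); apply: subfield_genS => y [fy|[j _ <-]].
      by left; apply: sub_oth; apply: (sub_acl (range_subfield f)).
    have [->|ji] := eqVneq j i; first by right.
    by left; apply: (sub_acl (others_subfield i)); apply: sub_subfield_gen; right; exists j.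
  exists h; split=> // x e Lx e0; apply: h4 => //; apply: subfield_genS Lx => y [ay|gy].
    by left; apply: sub_subfield_gen; left; apply: sub_oth.
  by right.
have [h hh] := choice hi.
exists (fun x => \max_i h i x); split.
- move=> x; split=> [h0|ax]; last first.
    apply/eqP; rewrite -leqn0; apply/bigmax_leqP => i _; rewrite leqn0; apply/eqP.
    by have [h1 _ _ _] := hh i; apply/h1/sub_oth.
  apply: bigcap_acl => i; have [h1 _ _ _] := hh i; apply/h1/eqP; rewrite -leqn0 -h0.
  exact: (leq_bigmax i).
- move=> x y; apply/bigmax_leqP => i _; have [_ h2 _ _] := hh i.
  apply: leq_trans (h2 x y) _; rewrite geq_max; apply/andP; split.
    by apply: leq_trans (leq_maxl _ _); exact: (leq_bigmax (F := fun i => h i x)).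
  by apply: leq_trans (leq_maxr _ _); exact: (leq_bigmax (F := fun i => h i y)).
- move=> c x ac; apply/bigmax_leqP => i _; have [_ _ h3 _] := hh i.
  apply: leq_trans (h3 c x (sub_oth i _ ac)) _; exact: (leq_bigmax (F := fun i => h i x)).
- move=> x e Lx e0; rewrite (big_morph (muln e) (id1 := 0%N) (op1 := maxn)) ?muln0 //; last first.
    by move=> a b; rewrite maxnMr.
  by apply: eq_bigr => i _; have [_ _ _ h4] := hh i; exact: h4.
Qed.

End TranscendenceBasis.

(** * From polynomial independence to transcendence over the remaining elements *)

Section MpolyIndependence.
Import mpoly.
Variables (k : fieldType) (E : closedFieldType) (f : {rmorphism k -> E}).
Variables (d : nat) (t : d.-tuple E).
Hypothesis t_ind : alg_independent f t.

(** Clearing denominators turns an equation Q for t_i into a multivariate P that vanishes at t, so P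
    = 0. Putting an arbitrary z in place of t_i shows Q(z) = 0 for every z, while a nonzero
    polynomial has a nonroot in an algebraically closed field. *)
Lemma alg_independent_acl i :
  ~ acl (subfield_gen (range f `|` [set tnth t j | j in [set j | j != i]])) (tnth t i).
Proof.
set X := _ `|` _ => -[Q [Q0 hQ] r].
pose ev z : 'I_d -> E := fun j => if j == i then z else tnth t j.
(* Semantic form of not involving the i-th variable: the value does not change when t_i is moved. *)
pose free (P : mpoly d k) := forall z, mmap f (ev z) P = mmap f (tnth t) P.
have gX : subfield_gen X `<=` [set x | exists a b : mpoly d k,
    [/\ free a, free b, mmap f (tnth t) b != 0 & x = mmap f (tnth t) a / mmap f (tnth t) b]].
  apply: subfield_gen_min.
    apply: is_subfieldI.
    - exists 1, 1; split; rewrite ?rmorph1 ?oner_neq0 ?divr1 //.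
      + by move=> z; rewrite !rmorph1.
      + by move=> z; rewrite !rmorph1.
    - move=> _ _ [a [b [fa fb b0 ->]]] [a' [b' [fa' fb' b'0 ->]]].
      exists (a * b' - a' * b), (b * b'); split.
      + by move=> z; rewrite !(rmorphB, rmorphM) /= fa fb fa' fb'.
      + by move=> z; rewrite !rmorphM /= fb fb'.
      + by rewrite rmorphM mulf_neq0.
      + by rewrite rmorphB !rmorphM /=; field; rewrite b0 b'0.
    - move=> _ _ [a [b [fa fb b0 ->]]] [a' [b' [fa' fb' b'0 ->]]].
      have [a'0|a'0] := eqVneq (mmap f (tnth t) a') 0.
        exists 0, 1; split; rewrite ?a'0 ?rmorph0 ?rmorph1 ?oner_neq0 //.
        + by move=> z; rewrite !rmorph0.
        + by move=> z; rewrite !rmorph1.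
        + by rewrite !mul0r invr0 mulr0.
      exists (a * b'), (b * a'); split.
      + by move=> z; rewrite !rmorphM /= fa fb'.
      + by move=> z; rewrite !rmorphM /= fb fa'.
      + by rewrite rmorphM mulf_neq0.
      + by rewrite !rmorphM /=; field; rewrite b0 b'0 a'0.
  move=> x [[c _ <-]|[j /= ji <-]].
    exists c%:MP, 1; split; rewrite ?rmorph1 ?oner_neq0 ?divr1 //.
    - by move=> z; rewrite !mmapC.
    - by move=> z; rewrite !rmorph1.
    - by rewrite mmapC.
  exists 'X_j, 1; split; rewrite ?rmorph1 ?oner_neq0 ?divr1 //.
  - by move=> z; rewrite !mmapX !mmap1U /ev (negPf ji).
  - by move=> z; rewrite !rmorph1.
  - by rewrite mmapX mmap1U.
have /choice[ab hab] : forall j, exists ab : mpoly d k * mpoly d k,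
    [/\ free ab.1, free ab.2, mmap f (tnth t) ab.2 != 0
      & Q`_j = mmap f (tnth t) ab.1 / mmap f (tnth t) ab.2].
  by move=> j; have [a [b h]] := gX _ (hQ j); exists (a, b).
pose m := size Q.
pose c (j : 'I_m) := (ab j).1 * \prod_(l < m | l != j) (ab l).2.
pose D := \prod_(l < m) (ab l).2.
pose D0 := mmap f (tnth t) D.
have D0n : D0 != 0.
  by rewrite /D0 /D rmorph_prod; apply/prodf_neq0 => l _; case: (hab l).
have cE (j : 'I_m) : mmap f (tnth t) (c j) = D0 * Q`_j.
  have [_ _ b0 ->] := hab j.
  rewrite /D0 /D (bigD1 j) //= /c !rmorphM /=; field.
  exact: b0.
have fc (j : 'I_m) : free (c j).
  move=> z; rewrite /c !rmorphM !rmorph_prod /=; have [-> _ _ _] := hab j.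
  by congr (_ * _); apply: eq_bigr => l _; have [_ -> _ _] := hab l.
pose P := \sum_(j < m) c j * 'X_i ^+ j.
have Pz z : mmap f (ev z) P = D0 * Q.[z].
  rewrite /P raddf_sum horner_coef mulr_sumr; apply: eq_bigr => j _ /=.
  by rewrite rmorphM rmorphXn /= mmapX mmap1U /ev eqxx fc cE mulrA.
have Pt : mmap f (tnth t) P = D0 * Q.[tnth t i].
  rewrite /P raddf_sum horner_coef mulr_sumr; apply: eq_bigr => j _ /=.
  by rewrite rmorphM rmorphXn /= mmapX mmap1U cE mulrA.
have P0 : P = 0 by apply: t_ind; rewrite Pt (rootP r) mulr0.
have /closed_nonrootP[z nz] := Q0.
move: (Pz z); rewrite P0 rmorph0 => /esym/eqP.
by rewrite mulf_eq0 (negPf D0n) /= => rz; rewrite /root rz in nz.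
Qed.

End MpolyIndependence.

(** * A basis over the Frobenius *)

Lemma countable_infinite_enum (T : Type) (A : set T) : countable A -> infinite_set A ->
  exists b : nat -> T, injective b /\ range b = A.
Proof.
move=> cA iA; have /card_set_bijP[g [gf gi gs]] := eq_card_nat cA iA.
have /choice[b hb] : forall n, exists x, A x /\ g x = n.
  by move=> n; have [x Ax <-] := gs n I; exists x.
exists b; split=> [m n e|].
  by rewrite -(hb m).2 -(hb n).2 e.
apply/seteqP; split=> [_ [n _ <-]|x Ax]; first exact: (hb n).1.
exists (g x) => //; apply: gi; rewrite ?inE //; last exact: (hb _).2.
exact: (hb _).1.
Qed.

Section FrobeniusBasis.
Variables (E : fieldType) (q : nat).
Hypothesis q_gt1 : (1 < q)%N.
Hypothesis qD : {morph (fun x : E => x ^+ q) : x y / x + y}.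
Variables (k0 kbar L : set E).
Hypotheses (hk0 : is_subfield k0) (hkbar : is_subfield kbar) (hL : is_subfield L).
Hypotheses (k0_fin : finite_set k0) (kbar_inf : infinite_set kbar).
Hypotheses (k0_sub : k0 `<=` kbar) (kbar_sub : kbar `<=` L).
Hypothesis k0_perfect : forall c, k0 c -> exists2 c', k0 c' & c' ^+ q = c.
Variable h : E -> nat.
Hypothesis h0 : forall x, h x = 0%N <-> kbar x.
Hypothesis hD : forall x y, (h (x + y)%R <= maxn (h x) (h y))%N.
Hypothesis hZ : forall c x, kbar c -> (h (c * x)%R <= h x)%N.
Hypothesis hX : forall x, L x -> h (x ^+ q) = (q * h x)%N.
Hypothesis L_neq : exists2 x, L x & ~ kbar x.

Lemma qpow_expD n : {morph (fun x : E => x ^+ (q ^ n)) : x y / x + y}.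
Proof.
elim: n => [|n IH] x y; first by rewrite expn0 !expr1.
by rewrite expnS mulnC !exprM IH qD.
Qed.

Lemma qpow0 n : (0 : E) ^+ (q ^ n) = 0.
Proof. by rewrite expr0n gtn_eqF // expn_gt0 (ltnW q_gt1). Qed.

Lemma qpowN (x : E) : (- x) ^+ q = - x ^+ q.
Proof.
have q0 := qpow0 1; rewrite expn1 in q0.
by apply/eqP; rewrite -addr_eq0 -qD addNr q0.
Qed.

Lemma qpow_sum n I (r : seq I) (P : pred I) (F : I -> E) :
  (\sum_(i <- r | P i) F i) ^+ (q ^ n) = \sum_(i <- r | P i) F i ^+ (q ^ n).
Proof. exact: (big_morph _ (qpow_expD n) (qpow0 n)). Qed.

Lemma hN x : (h (- x)%R <= h x)%N.
Proof. by rewrite -[- x]mulN1r; apply: hZ; apply: (subfieldN hkbar); exact: subfield1. Qed.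

Lemma hB x y : (h (x - y)%R <= maxn (h x) (h y))%N.
Proof.
by apply: leq_trans (hD _ _) _; rewrite geq_max leq_maxl (leq_trans (hN _)) ?leq_maxr.
Qed.

Lemma hlt_sum I (r : seq I) (P : pred I) (F : I -> E) m : (0 < m)%N ->
  (forall i, P i -> (h (F i) < m)%N) -> (h (\sum_(i <- r | P i) F i)%R < m)%N.
Proof.
move=> m0 hF; apply: (big_ind (fun x => h x < m)%N) => //.
  by rewrite (_ : h 0 = 0%N) //; apply/h0; exact: subfield0.
by move=> x y hx hy; apply: leq_ltn_trans (hD x y) _; rewrite gtn_max hx.
Qed.

Definition subspace (S : set E) := [/\ S 0, forall x y, S x -> S y -> S (x + y)
  & forall c x, k0 c -> S x -> S (c * x)].

Lemma subspace_sum S I (r : seq I) (P : pred I) (F : I -> E) : subspace S ->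
  (forall i, P i -> S (F i)) -> S (\sum_(i <- r | P i) F i).
Proof. by move=> [S0 SD _] hF; apply: big_ind. Qed.

Definition kspan (X : set E) : set E :=
  [set x | forall S, subspace S -> X `<=` S -> S x].

Lemma kspan_subspace X : subspace (kspan X).
Proof.
split=> [S [] //|x y hx hy S hS XS|c x kc hx S hS XS].
  by have [_ SD _] := hS; apply: SD; [apply: hx|apply: hy].
by have [_ _ SZ] := hS; apply: SZ => //; apply: hx.
Qed.

Lemma sub_kspan X : X `<=` kspan X. Proof. by move=> x Xx S _; apply. Qed.

Lemma kspan_min X S : subspace S -> X `<=` S -> kspan X `<=` S.
Proof. by move=> hS XS x; apply. Qed.

Lemma finite_kspan (s : seq E) : exists2 S, subspace S & finite_set S /\ [set` s] `<=` S.
Proof.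
elim: s => [|a s [S [S0 SD SZ] [fS sS]]].
  exists [set 0]; last by split; [exact: finite_set1 | move=> x].
  by split=> [//|x y -> ->|c x _ ->]; rewrite ?addr0 ?mulr0.
exists [set c * a + y | c in k0 & y in S]; last split.
- split.
  + by exists 0; [exact: subfield0|exists 0; rewrite // mul0r addr0].
  + move=> _ _ [c kc [y Sy <-]] [c' kc' [y' Sy' <-]].
    exists (c + c'); first exact: subfieldD.
    by exists (y + y'); [exact: SD | rewrite mulrDl addrACA].
  + move=> b _ kb [c kc [y Sy <-]]; exists (b * c); first exact: subfieldM.
    by exists (b * y); [exact: SZ | rewrite mulrDr mulrA].
- exact: finite_image2.
- move=> x /=; rewrite inE => /orP[/eqP ->|xs].
    by exists 1; [exact: subfield1|exists 0; rewrite // mul1r addr0].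
  by exists 0; [exact: subfield0|exists x; [exact: sS|rewrite mul0r add0r]].
Qed.

(* [frob_level m] is the part of height at most [m] that the q-powers already account for. *)
Definition frob_level m : set E :=
  [set x | [/\ L x, (h x <= m)%N & exists2 z, L z & (h (x - z ^+ q)%R < m)%N]].

(** The height of z drops because q h(z) = h(z^q) <= m with q > 1 and m > 0. This makes induction on
    the height possible. *)
Lemma h_frob_level m x : (0 < m)%N -> frob_level m x -> exists z w,
  [/\ x = z ^+ q + w, L z, L w, (h z < m)%N & (h w < m)%N].
Proof.
move=> m0 [Lx hx [z Lz hw]]; exists z, (x - z ^+ q); split=> //.
- by rewrite addrC subrK.
- by apply: subfieldB => //; exact: subfieldX.
have : (q * h z <= m)%N.
  rewrite -hX // (_ : z ^+ q = x - (x - z ^+ q)); last by rewrite opprB addrC subrK.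
  by apply: leq_trans (hB _ _) _; rewrite geq_max hx ltnW.
by move: q_gt1 m0; nia.
Qed.

Section Greedy.
Variable r : E -> nat.

Definition below x := frob_level (h x) `|` [set y | [/\ L y, h y = h x & (r y < r x)%N]].
(** When [r] is injective on [L], the members of height m represent a k0-basis of the elements of
    height at most m modulo [frob_level m], chosen greedily along the ranking [r]. *)
Definition greedy : set E := [set x | [/\ L x, (0 < h x)%N & ~ kspan (below x) x]].

Lemma greedy_span m x : (0 < m)%N -> L x -> h x = m ->
  kspan (frob_level m `|` [set b | greedy b /\ h b = m]) x.
Proof.
move=> m0; have [n] := ubnP (r x); elim: n x => // n IH x lt Lx hx.
have [Bx|nBx] := pselect (greedy x); first by apply: sub_kspan; right.
have : kspan (below x) x by apply: contrapT => nx; apply: nBx; split=> //; rewrite hx.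
apply: kspan_min; first exact: kspan_subspace.
move=> y [fy|[Ly hy ry]]; first by apply: sub_kspan; left; rewrite -hx.
by apply: IH; rewrite ?hy //; apply: leq_trans ry _.
Qed.

Lemma greedy_gen (S : set E) : subspace S -> kbar `<=` S -> greedy `<=` S ->
  (forall x, S x -> S (x ^+ q)) -> L `<=` S.
Proof.
move=> hS kS BS SX x; have [n] := ubnP (h x); elim: n x => // n IH x lt Lx.
have [hx|hx] := posnP (h x); first by apply/kS/h0.
apply: (greedy_span hx Lx erefl) => // y [/(h_frob_level hx)[z [w [-> Lz Lw hz hw]]]|[By _]].
  have [_ SD _] := hS; apply: SD; last by apply: IH => //; apply: leq_trans hw _.
  by apply: SX; apply: IH => //; apply: leq_trans hz _.
exact: BS.
Qed.

(** Take x of the least positive height m. Below m everything is constant, so if [greedy] were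
    finite, each a x with a in [kbar] would be a constant plus an element of a finite k0-space S.
    Two values of a with the same part in S would make x constant; hence the infinite [kbar] would
    inject into S. *)
Lemma greedy_infinite : infinite_set greedy.
Proof.
move=> /finite_seqP[s Bs].
have exm : exists m, `[< exists x, [/\ L x, (0 < m)%N & h x = m] >].
  have [x Lx nx] := L_neq; exists (h x); apply/asboolP; exists x; split=> //.
  by rewrite lt0n; apply/eqP => /h0.
case: (ex_minnP exm) => m /asboolP[x [Lx m0 hx]] minm.
have low y : L y -> (h y < m)%N -> kbar y.
  move=> Ly hy; apply/h0/eqP; rewrite -leqn0 leqNgt; apply/negP => hy0.
  have : (m <= h y)%N by apply: minm; apply/asboolP; exists y.
  by rewrite leqNgt hy.
have fl y : frob_level m y -> kbar y.
  move=> /(h_frob_level m0)[z [w [-> Lz Lw hz hw]]].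
  by apply: (subfieldD hkbar); [apply: (subfieldX hkbar)|]; apply: low.
have [S hS [fS sS]] := finite_kspan s.
have /choice[g hg] : forall a, exists y, kbar a -> S y /\ kbar (a * x - y).
  move=> a; have [ka|nka] := pselect (kbar a); last by exists 0.
  suff [y [t [Sy kt e]]] : exists y t, [/\ S y, kbar t & a * x = t + y].
    by exists y => _; split=> //; rewrite e addrK.
  have sub : subspace [set z | exists y t, [/\ S y, kbar t & z = t + y]].
    have [S0 SD SZ] := hS; split.
    - by exists 0, 0; rewrite addr0; split=> //; exact: subfield0.
    - move=> _ _ [y [t [Sy kt ->]]] [y' [t' [Sy' kt' ->]]].
      by exists (y + y'), (t + t'); rewrite addrACA; split; [exact: SD|exact: subfieldD|].
    - move=> c _ kc [y [t [Sy kt ->]]].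
      exists (c * y), (c * t); rewrite mulrDr; split=> //; first exact: SZ.
      by apply: subfieldM => //; exact: k0_sub.
  have Lax : L (a * x) by apply: subfieldM => //; exact: kbar_sub.
  have hax : (h (a * x)%R <= m)%N by rewrite -hx; exact: hZ.
  have S00 : S 0 by case: hS.
  have [lt|ge] := ltnP (h (a * x)%R) m.
    by exists 0, (a * x); rewrite addr0; split=> //; exact: low.
  apply: (greedy_span m0 Lax _ sub).
    by apply/eqP; rewrite eqn_leq hax.
  move=> y [/fl ky|[By _]]; first by exists 0, y; rewrite addr0.
  exists y, 0; rewrite add0r; split=> //; first by apply: sS; rewrite -Bs.
  exact: subfield0.
apply: kbar_inf.
have : finite_set [set g a | a in kbar].
  by apply: sub_finite_set fS => _ [a ka <-]; have [] := hg a ka.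
suff inj : {in kbar &, injective g} by rewrite (eq_finite_set (inj_card_eq inj)).
move=> a b /set_mem ka /set_mem kb gab; apply/eqP; rewrite -subr_eq0.
apply: contrapT => /negP ab; have [_ h1] := hg a ka; have [_ h2] := hg b kb.
have : kbar ((a - b) * x).
  have := subfieldB hkbar h1 h2; rewrite gab (_ : _ - _ = (a - b) * x) //; ring.
move=> h3; have : kbar x.
  have := subfieldM hkbar (subfieldV hkbar (subfieldB hkbar ka kb)) h3.
  by rewrite mulrA mulVf ?mul1r.
by move/h0; rewrite hx => m00; rewrite m00 in m0.
Qed.

End Greedy.

Definition expansion (b : nat -> E) N (c : nat -> nat -> E) : E :=
  \sum_(n < N) \sum_(j < N) c n j * b n ^+ (q ^ j).

Section Enumerated.
Variables (r : E -> nat) (r_inj : {in L &, injective r}).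
Variables (b : nat -> E) (b_inj : injective b) (b_range : range b = greedy r).

Let b_greedy n : greedy r (b n). Proof. by rewrite -b_range; exists n. Qed.
Let b_L n : L (b n). Proof. by case: (b_greedy n). Qed.

(** Among the terms of height m with nonzero coefficient, the one of largest rank could be solved
    for, which would place it in the span of its [below]. *)
Lemma greedy_level_indep m N (c : nat -> E) : (0 < m)%N -> (forall n, k0 (c n)) ->
  frob_level m (\sum_(n < N | h (b n) == m) c n * b n) ->
  forall n, (n < N)%N -> h (b n) = m -> c n = 0.
Proof.
move=> m0 kc hS n nN hn; apply: contrapT => /eqP cn.
pose P (i : 'I_N) := (h (b i) == m) && (c i != 0).
have Pn : P (Ordinal nN) by rewrite /P /= hn eqxx.
case: (arg_maxnP (fun i : 'I_N => r (b i)) Pn) => i /andP[/eqP hi ci] imax.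
have [_ _] := b_greedy i; apply; rewrite /below hi.
set Y := _ `|` _; have [X0 XD XZ] := kspan_subspace Y.
have e : b i = (c i)^-1 * ((\sum_(n < N | h (b n) == m) c n * b n)
    + (- 1) * \sum_(n < N | (h (b n) == m) && (n != i)) c n * b n).
  by rewrite (bigD1 i) /= ?hi // mulN1r addrK mulKf.
have k1 : k0 (- 1) by apply: (subfieldN hk0); exact: subfield1.
rewrite e; apply: (XZ); first exact: (subfieldV hk0).
apply: (XD); first by apply: sub_kspan; left.
apply: (XZ) => //; apply: subspace_sum => [|l /andP[/eqP hl li]]; first exact: kspan_subspace.
have [cl|cl] := eqVneq (c l) 0; first by rewrite cl mul0r.
apply: (XZ) => //; apply: sub_kspan; right; split=> //.
have : (r (b l) <= r (b i))%N by apply: imax; rewrite /P hl eqxx.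
rewrite leq_eqVlt => /orP[/eqP e'|//]; move: li.
have /b_inj/val_inj -> : b l = b i by apply: r_inj => //; exact: mem_set.
by rewrite eqxx.
Qed.

Lemma kbar_qroot x : L x -> kbar (x ^+ q) -> kbar x.
Proof.
move=> Lx /h0; rewrite hX // => /eqP; rewrite muln_eq0 => /orP[/eqP q0|/eqP /h0 //].
by move: q_gt1; rewrite q0.
Qed.

(* If [y + w ^+ q] is constant, the terms of [y] of top height lie in [frob_level],
   so [y = 0]; then [w] is constant and the degree in Frobenius drops. *)
Lemma expansion_indep J N (c : nat -> nat -> E) : (forall n j, k0 (c n j)) ->
  kbar (\sum_(n < N) \sum_(j < J) c n j * b n ^+ (q ^ j)) ->
  forall n j, (n < N)%N -> (j < J)%N -> c n j = 0.
Proof.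
elim: J c => // J IH c kc hS.
(* As [k0] is perfect, the terms with j > 0 add up to the q-th power of an element w of the same
   shape. *)
have /choice[c' hc'] : forall nj : nat * nat, exists c', k0 c' /\ c' ^+ q = c nj.1 nj.2.+1.
  by move=> nj; have [c' kc' h'] := k0_perfect (kc nj.1 nj.2.+1); exists c'.
pose y := \sum_(n < N) c n 0 * b n.
pose w := \sum_(n < N) \sum_(j < J) c' (n : nat, j : nat) * b n ^+ (q ^ j).
have Lk x : k0 x -> L x by move=> /k0_sub; exact: kbar_sub.
have Lw : L w.
  apply: (subfield_sum hL) => n _; apply: (subfield_sum hL) => j _; apply: subfieldM => //.
    by apply: Lk; have [] := hc' (n : nat, j : nat).
  exact: subfieldX.
have yw : kbar (y + w ^+ q).
  move: hS; congr (kbar _); rewrite -[q in w ^+ q]expn1 qpow_sum -big_split.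
  apply: eq_bigr => n _ /=; rewrite big_ord_recl expn0 expr1; congr (_ + _).
  rewrite qpow_sum; apply: eq_bigr => j _; rewrite exprMn expn1.
  by rewrite (hc' (n : nat, j : nat)).2 -exprM -expnSr.
have c0 n : (n < N)%N -> c n 0 = 0.
  move=> nN; apply: contrapT => /eqP cn.
  pose P (i : 'I_N) := c i 0 != 0.
  have Pn : P (Ordinal nN) by [].
  case: (arg_maxnP (fun i : 'I_N => h (b i)) Pn) => i Pi imax.
  set m := h (b i) in imax; have m0 : (0 < m)%N by case: (b_greedy i).
  have hkZ a x : k0 a -> (h (a * x)%R <= h x)%N by move=> /k0_sub; exact: hZ.
  have h00 : h 0 = 0%N by apply/h0; exact: subfield0.
  have low : (h (\sum_(n < N | h (b n) != m) c n 0 * b n)%R < m)%N.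
    apply: hlt_sum => // l hl; have [->|cl] := eqVneq (c l 0) 0; first by rewrite mul0r h00.
    by apply: leq_ltn_trans (hkZ _ _ (kc _ _)) _; rewrite ltn_neqAle hl; apply: imax.
  have hle : (h (\sum_(n < N | h (b n) == m) c n 0 * b n)%R <= m)%N.
    by rewrite -ltnS; apply: hlt_sum => // l /eqP <-; rewrite ltnS; exact: hkZ.
  suff : c i 0 = 0 by move=> h'; rewrite /P h' eqxx in Pi.
  apply: (@greedy_level_indep m N (fun n => c n 0) m0) => //; split=> //.
    by apply: (subfield_sum hL) => l _; apply: subfieldM => //; exact: Lk.
  (* The sum top + w^q is a constant minus the terms of y of smaller height, so its height is below
     m. *)
  exists (- w); first exact: subfieldN.
  rewrite qpowN opprK; set top := \sum_(_ < _ | _) _.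
  have -> : top + w ^+ q = (y + w ^+ q) - \sum_(n < N | h (b n) != m) c n 0 * b n.
    by rewrite /y (bigID (fun n : 'I_N => h (b n) == m)) /= -/top; ring.
  by apply: leq_ltn_trans (hB _ _) _; rewrite gtn_max low ((h0 _).2 yw) m0.
have y0 : y = 0 by rewrite /y big1 // => n _; rewrite c0 // mul0r.
rewrite y0 add0r in yw.
have := IH (fun n j => c' (n, j)) (fun n j => (hc' (n, j)).1) (kbar_qroot Lw yw).
move=> c'0 n [|j] nN jJ; first exact: c0.
by rewrite -(hc' (n, j)).2 c'0 // -(expn1 q) qpow0.
Qed.

(** The elements having such an expansion satisfy the closure conditions of [greedy_gen]. Vanishing
    of the coefficients beyond N allows two expansions to be widened to a common bound before they
    are added. *)
Lemma expansion_span x : L x -> exists t N (c : nat -> nat -> E),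
  [/\ kbar t, forall n j, k0 (c n j), forall n j, (N <= n)%N || (N <= j)%N -> c n j = 0
    & x = t + expansion b N c].
Proof.
pose good N (c : nat -> nat -> E) := (forall n j, k0 (c n j)) /\
  (forall n j, (N <= n)%N || (N <= j)%N -> c n j = 0).
have widen N N' c : good N c -> (N <= N')%N -> good N' c /\ expansion b N' c = expansion b N c.
  move=> [kc zc] le; split.
    split=> // n j /orP[h'|h']; apply: zc; rewrite (leq_trans le h') ?orbT //.
  rewrite /expansion [RHS](big_ord_widen N' (fun n => \sum_(j < N) c n j * b n ^+ (q ^ j))) //.
  rewrite [RHS]big_mkcond; apply: eq_bigr => n _; case: ltnP => hn; last first.
    by rewrite big1 // => j _; rewrite zc ?hn // mul0r.
  rewrite [RHS](big_ord_widen N' (fun j => c n j * b n ^+ (q ^ j))) // [RHS]big_mkcond.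
  by apply: eq_bigr => j _; case: ltnP => // hj; rewrite zc ?hj ?orbT // mul0r.
pose S := [set x | exists t N (c : nat -> nat -> E),
  [/\ kbar t, forall n j, k0 (c n j), forall n j, (N <= n)%N || (N <= j)%N -> c n j = 0
    & x = t + expansion b N c]].
have k00 : k0 0 by exact: subfield0.
apply: (@greedy_gen r S).
- split.
  + exists 0, 0%N, (fun _ _ => 0); split=> //; first exact: subfield0.
    by rewrite /expansion big_ord0 addr0.
  + move=> _ _ [t [N [c [kt kc zc ->]]]] [t' [N' [c' [kt' kc' zc' ->]]]].
    have [[_ zc1] e1] := widen _ (maxn N N') c (conj kc zc) (leq_maxl _ _).
    have [[_ zc2] e2] := widen _ (maxn N N') c' (conj kc' zc') (leq_maxr _ _).
    exists (t + t'), (maxn N N'), (fun n j => c n j + c' n j); split.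
    * exact: subfieldD.
    * by move=> n j; exact: subfieldD.
    * by move=> n j hnj; rewrite zc1 // zc2 // addr0.
    * rewrite -e1 -e2 addrACA; congr (_ + _); rewrite /expansion -big_split.
      apply: eq_bigr => n _; rewrite -big_split; apply: eq_bigr => j _ /=.
      by rewrite mulrDl.
  + move=> a _ ka [t [N [c [kt kc zc ->]]]].
    exists (a * t), N, (fun n j => a * c n j); split.
    * by apply: subfieldM => //; exact: k0_sub.
    * by move=> n j; exact: subfieldM.
    * by move=> n j hnj; rewrite zc // mulr0.
    * rewrite mulrDr; congr (_ + _); rewrite mulr_sumr; apply: eq_bigr => n _.
      by rewrite mulr_sumr; apply: eq_bigr => j _; rewrite mulrA.
- move=> t kt; exists t, 0%N, (fun _ _ => 0); split=> //.
  by rewrite /expansion big_ord0 addr0.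
- rewrite -b_range => _ [m _ <-].
  exists 0, m.+1, (fun n j => if (n == m) && (j == 0%N) then 1 else 0); split.
  + exact: subfield0.
  + by move=> n j; case: ifP => // _; exact: subfield1.
  + by move=> n j; case: ifP => // /andP[/eqP -> /eqP ->]; rewrite ltnn ltn0.
  + rewrite add0r /expansion (bigD1 ord_max) //= (bigD1 ord0) //= eqxx mul1r.
    rewrite expn0 expr1 big1 ?addr0 => [|j j0].
      rewrite big1 ?addr0 // => n; rewrite -val_eqE /= => nm.
      by rewrite big1 // => j _; rewrite (negPf nm) mul0r.
    by rewrite -val_eqE /= in j0; rewrite (negPf j0) mul0r.
- move=> _ [t [N [c [kt kc zc ->]]]].
  have [_ e] := widen _ N.+1 c (conj kc zc) (leqnSn _).
  (* Frobenius raises the coefficients to the power q and shifts j by one, so the bound has to grow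
     by one as well. *)
  exists (t ^+ q), N.+1, (fun n j => if j is j'.+1 then c n j' ^+ q else 0); split.
  + exact: subfieldX.
  + by move=> n [|j] //; exact: subfieldX.
  + move=> n [|j] //; rewrite ltnS => hnj; rewrite zc; last by case/orP: hnj => [/ltnW ->|->] //; rewrite orbT.
    by rewrite -(expn1 q) qpow0.
  + rewrite qD -e; congr (_ + _); rewrite /expansion.
    rewrite -[q in LHS]expn1 !qpow_sum; apply: eq_bigr => n _.
    rewrite qpow_sum big_ord_recr [RHS]big_ord_recl /= mul0r add0r.
    rewrite zc ?leqnn ?orbT // mul0r qpow0 addr0.
    by apply: eq_bigr => j _; rewrite exprMn expn1 -exprM -expnSr.
Qed.

End Enumerated.

End FrobeniusBasis.

(** * Invertible ideals of the ring of regular functions *)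

(** Among the nonzero combinations of the coefficients, [g] has least size, so by Euclidean division
    it divides them all; dividing its expression by [g] gives the Bezout relation. *)
Lemma poly_primitive (k : fieldType) (P : {poly {poly k}}) : P != 0 ->
  exists g Q (e : nat -> {poly k}), [/\ g != 0, P = g *: Q &
    \sum_(i < size P) e i * Q`_i = 1].
Proof.
move=> P0; pose n := size P.
pose I g := exists e : nat -> {poly k}, g = \sum_(i < n) e i * P`_i.
have memI i : I P`_i.
  have [ni|ni] := leqP n i.
    by exists (fun=> 0); rewrite big1 ?nth_default // => j _; rewrite mul0r.
  exists (fun j => (j == i)%:R); rewrite (bigD1 (Ordinal ni)) //= eqxx mul1r.
  rewrite big1 ?addr0 // => j; rewrite -val_eqE /= => /negPf ->; exact: mul0r.
have exm : exists m, `[< exists g, [/\ I g, g != 0 & size g = m] >].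
  exists (size (lead_coef P)); apply/asboolP; exists (lead_coef P).
  by split; [exact: memI | rewrite lead_coef_eq0 |].
case: (ex_minnP exm) => m /asboolP[g [[e ge] g0 sg]] minm.
have dvd i : P`_i = (P`_i %/ g) * g.
  rewrite {1}(divp_eq P`_i g); apply/eqP; rewrite -subr_eq0 addrC addKr.
  apply: contrapT => /negP r0.
  have : (m <= size (P`_i %% g)%R)%N.
    apply: minm; apply/asboolP; exists (P`_i %% g); split=> //.
    have [e' he'] := memI i; exists (fun j : nat => e' j - (P`_i %/ g)%R * e j).
    have -> : P`_i %% g = P`_i - (P`_i %/ g) * g by rewrite {2}(divp_eq P`_i g) addrC addKr.
    rewrite [X in X - _]he' [X in _ - _ * X]ge mulr_sumr -sumrB; apply: eq_bigr => j _.
    by rewrite mulrBl mulrA.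
  by rewrite -sg leqNgt ltn_modp g0.
exists g, (\poly_(i < n) (P`_i %/ g)), e; split=> //.
  apply/polyP => i; rewrite coefZ coef_poly; case: ltnP => h.
    by rewrite mulrC -dvd.
  by rewrite nth_default ?mulr0.
apply: (mulfI g0); rewrite mulr1 [RHS]ge mulr_sumr; apply: eq_bigr => i _.
by rewrite coef_poly ltn_ord mulrCA; congr (_ * _); rewrite mulrC -dvd.
Qed.

(** In transcendence degree 1, exchange lets any transcendental [a] replace the transcendence
    basis. *)
Lemma function_field_acl (Fq F : fieldType) (iF : {rmorphism Fq -> F}) (a : F) :
  has_trdeg iF 1 -> ~ algebraicOver iF a ->
  forall x, acl (subfield_gen (range iF `|` [set a])) x.
Proof.
move=> [t _ alg] na x; pose t0 := tnth t ord0.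
have tE : [set` t] = [set t0].
  apply/seteqP; split=> y /=; last by move=> ->; exact: mem_tnth.
  by case/tnthP => i ->; rewrite (ord1 i).
have hx y : acl (subfield_gen (range iF `|` [set t0])) y by rewrite -tE; exact: alg.
have ht := exchange_morph (hx a) na.
apply: (acl_minr (subfield_gen_subfield _) _ (hx x)) => y [fy|->] //.
by apply: (sub_acl (subfield_gen_subfield _)); apply: sub_subfield_gen; left.
Qed.

(** The content g can be cancelled, since g(a) is nonzero for a transcendental [a]. *)
Lemma alg_relation (k F : fieldType) (f : {rmorphism k -> F}) (a x : F) :
  ~ algebraicOver f a -> acl (subfield_gen (range f `|` [set a])) x ->
  exists Q n (e : nat -> {poly k}),
    [/\ Q != 0, (map_poly (map_poly f) Q).[x, a] = 0, (size Q <= n)%N &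
        \sum_(i < n) e i * Q`_i = 1].
Proof.
move=> na /acl_gen1P[P [P0 r]].
have P0' : P != 0 by apply: contraNneq P0 => ->; rewrite /eval2 rmorph0.
have [g [Q [e [g0 PE he]]]] := poly_primitive P0'.
exists Q, (size P), e; split=> //.
- by apply: contraNneq P0' => Q0; rewrite PE Q0 scaler0.
- move: r; rewrite /root eval2_horner PE.
  rewrite map_polyZ !hornerZ; rewrite hornerM mulf_eq0 => /orP[ga|/eqP //].
  by case: na; exists g.
- by rewrite PE size_scale.
Qed.

Section RegularPrufer.
Variables (Fq : finFieldType) (F : fieldType) (iF : {rmorphism Fq -> F}).
Hypothesis hF : has_trdeg iF 1.
Variables (oo : set F) (a : F).
Hypothesis ra : regular_away iF oo a.
Hypothesis na : ~ algebraicOver iF a.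

Lemma closed_point_valring V : is_closed_point iF V -> is_valring V.
Proof. by case=> hR _ _ hV. Qed.

(* [d k] below is the Horner partial sum [\sum_(i >= k) c i * x ^ (i - k)] of a
   primitive relation [\sum_i c i * x ^ i = 0]: both [d k] and [d k * x] are
   regular, and the [c k = d k - x * d k.+1] generate the unit ideal. *)
Theorem regular_prufer x : exists u w, [/\ regular_away iF oo u, regular_away iF oo w,
  regular_away iF oo (u * x), regular_away iF oo (w * x) & u + w * x = 1].
Proof.
have [Q [n [e [Q0 Qx sQ he]]]] := alg_relation na (function_field_acl hF na x).
pose ev (p : {poly Fq}) := (map_poly iF p).[a].
pose c i := ev Q`_i.
pose d k := \sum_(k <= i < n) c i * x ^+ (i - k).
have evV V : is_closed_point iF V -> V <> oo -> forall p, V (ev p).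
  move=> hV ne p; have hv := closed_point_valring hV; rewrite /ev horner_coef.
  apply: valring_sum => // i _; apply: valringM => //.
    by rewrite coef_map; case: hV => _ + _ _; apply; exists p`_i.
  by apply: valringX => //; exact: ra.
have d0 : d 0%N = 0.
  move: Qx; rewrite (@horner_coef_wide _ n (map_poly _ Q)) ?(leq_trans (size_poly _ _)) //.
  rewrite horner_sum => {}Qx; rewrite /d big_mkord -[RHS]Qx; apply: eq_bigr => i _.
  by rewrite subn0 coef_map -polyC_exp hornerM hornerC.
have dS k : (k < n)%N -> d k = c k + x * d k.+1.
  move=> kn; rewrite /d big_ltn // subnn mulr1 mulr_sumr; congr (_ + _).
  rewrite big_nat [RHS]big_nat; apply: eq_bigr => i /andP[ki _].
  by rewrite mulrCA -exprS; congr (_ * _ ^+ _); lia.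
(* Regularity is checked place by place. Where x is finite, [d k] is a sum of regular terms;
   elsewhere x^-1 is finite and the recursion climbs from d 0 = 0 through d (k + 1) x = d k - c
   k. *)
have dV V : is_closed_point iF V -> V <> oo -> forall k, (k <= n)%N ->
    V (d k) /\ V (d k * x).
  move=> hV ne; have hv := closed_point_valring hV.
  have [Vx k kn|nVx] := pselect (V x).
    have Vd : V (d k).
      by apply: valring_sum => // i _; apply: valringM; rewrite ?/c; [|exact: evV|exact: valringX].
    by split=> //; exact: valringM.
  have x0 : x != 0 by apply: contra_notN nVx => /eqP ->; exact: valring0.
  elim=> [_|k IH kn]; first by rewrite d0 mul0r; split; exact: valring0.
  have [Vd _] := IH (ltnW kn).
  have E : d k.+1 * x = d k - c k by rewrite (dS k kn); ring.
  have V1 : V (d k.+1 * x).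
    by rewrite E; apply: valringD => //; apply: valringN => //; exact: evV.
  split=> //; rewrite -[d k.+1](mulfK x0); apply: valringM => //.
  exact: valring_inv.
pose u := \sum_(k < n) ev (e k) * d k.
pose w := \sum_(k < n) - ev (e k) * d k.+1.
have reg f y : (forall V, is_closed_point iF V -> V <> oo ->
    forall k : 'I_n, V (f k * y)) -> regular_away iF oo ((\sum_(k < n) f k) * y).
  move=> h V hV ne; rewrite mulr_suml; apply: valring_sum => [|k _]; last exact: h.
  exact: closed_point_valring.
have hu V : is_closed_point iF V -> V <> oo -> forall k : 'I_n,
    [/\ V (ev (e k) * d k), V (ev (e k) * d k * x), V (- ev (e k) * d k.+1)
      & V (- ev (e k) * d k.+1 * x)].
  move=> hV ne k; have hv := closed_point_valring hV.
  have [h1 h2] := dV V hV ne k (ltnW (ltn_ord k)).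
  have [h3 h4] := dV V hV ne k.+1 (ltn_ord k).
  have h5 := evV V hV ne (e k); have h6 := valringN hv h5.
  by rewrite -!mulrA; split; apply: valringM.
exists u, w; split.
- by rewrite -[u]mulr1; apply: reg => V hV ne k; rewrite mulr1; case: (hu V hV ne k).
- by rewrite -[w]mulr1; apply: reg => V hV ne k; rewrite mulr1; case: (hu V hV ne k).
- by apply: reg => V hV ne k; case: (hu V hV ne k).
- by apply: reg => V hV ne k; case: (hu V hV ne k).
- transitivity (ev 1); last by rewrite /ev rmorph1 hornerC.
  rewrite -he /ev rmorph_sum horner_sum /u /w mulr_suml -big_split.
  apply: eq_bigr => k _ /=; rewrite rmorphM hornerM -/(ev _) -/(ev _) -/(c _).
  by rewrite (dS k (ltn_ord k)); ring.
Qed.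

End RegularPrufer.

(** * Invertibility of finitely generated fractional ideals *)

Section PruferIdeals.
Variables (A : comNzRingType) (F : fieldType) (v : {rmorphism A -> F}).
(** The fractional ideals (1, x) and (u, w) are inverse to each other: all products lie in [A] and 1
    is among their sums. For every x, this is the case of two generators in the definition of a
    Prufer domain. *)
Definition prufer := forall x : F, exists u w,
  [/\ range v u, range v w, range v (u * x), range v (w * x) & u + w * x = 1].
Hypothesis prf : prufer.

Let vR : subring_closed (mem (range v)).
Proof.
apply: subring_closedI; first by exists 1; rewrite ?rmorph1.
- by move=> _ _ [x _ <-] [y _ <-]; exists (x - y); rewrite ?rmorphB.
- by move=> _ _ [x _ <-] [y _ <-]; exists (x * y); rewrite ?rmorphM.
Qed.

(** Induction from the case of two generators. Let y invert the first n generators, z be the new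
    one, and u_i + w_i (z / x_i) = 1. Inserting this factor into the sum of the x_i y_i shows that
    the y_i u_i, together with the sum of the y_i w_i, invert the enlarged ideal. *)
Theorem prufer_invertible n (x : nat -> F) : (exists2 i, (i < n)%N & x i != 0) ->
  exists y : nat -> F, \sum_(i < n) x i * y i = 1 /\
    forall i j, (i < n)%N -> (j < n)%N -> range v (x i * y j).
Proof.
elim: n => [[]//|n IH] [i0 i0n xi0].
(* If the first n generators vanish, the ideal is principal, generated by x_n. *)
have [hx|hx] := pselect (exists2 i, (i < n)%N & x i != 0); last first.
  have x0 i : (i < n)%N -> x i = 0.
    by move=> hi; apply/eqP; apply: contrapT => /negP h; apply: hx; exists i.
  have i0E : i0 = n.
    by apply/eqP; rewrite eqn_leq -ltnS i0n leqNgt; apply: contra xi0 => /x0 ->.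
  rewrite i0E in xi0; exists (fun j => if j == n then (x n)^-1 else 0); split.
    rewrite big_ord_recr /= eqxx divff // big1 ?add0r // => i _.
    by rewrite x0 ?mul0r.
  move=> i j; rewrite !ltnS => hi hj; apply/(srpredP vR).
  case: eqP => _; last by rewrite mulr0 rpred0.
  move: hi; rewrite leq_eqVlt => /orP[/eqP ->|/x0 ->]; last by rewrite mul0r rpred0.
  by rewrite divff // rpred1.
have [y [sy hy]] := IH hx; pose z := x n.
(* A zero generator contributes nothing to the sum, so (0, 0) is a harmless default where z / x_i
   has no meaning. *)
have /choice[uw huw] : forall i, exists uw : F * F, if x i == 0 then uw = (0, 0) else
    [/\ range v uw.1, range v uw.2, range v (uw.1 * (z / x i)), range v (uw.2 * (z / x i))
      & uw.1 + uw.2 * (z / x i) = 1].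
  move=> i; case: (x i == 0); first by exists (0, 0).
  by case: (prf (z / x i)) => u [w h]; exists (u, w).
have r0 : range v 0 by apply/(srpredP vR); exact: rpred0.
have ru i : range v (uw i).1 /\ range v (uw i).2.
  by have := huw i; case: ifP => _; [move=> -> | case].
have rz i : (i < n)%N -> range v (y i * (uw i).1 * z) /\ range v (y i * (uw i).2 * z).
  move=> hi; have := huw i; case: eqP => [_ ->|/eqP xi [_ _ h1 h2 _]].
    by rewrite /= mulr0 mul0r.
  have hxy := hy i i hi hi; split.
    have -> : y i * (uw i).1 * z = (x i * y i) * ((uw i).1 * (z / x i)) by field.
    by apply/(srpredP vR); apply: rpredM; apply/srpredP.
  have -> : y i * (uw i).2 * z = (x i * y i) * ((uw i).2 * (z / x i)) by field.
  by apply/(srpredP vR); apply: rpredM; apply/srpredP.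
pose yn := \sum_(i < n) y i * (uw i).2.
exists (fun j => if j == n then yn else y j * (uw j).1); split.
  rewrite big_ord_recr /= eqxx -sy -/z /yn mulr_sumr -big_split; apply: eq_bigr => i _ /=.
  rewrite (ltn_eqF (ltn_ord i)); have := huw i; case: eqP => [xi ->|/eqP xi [_ _ _ _ h1]].
    by rewrite xi /= !mulr0 mul0r addr0.
  rewrite -[RHS]mulr1 -h1; field; exact: xi.
move=> i j; rewrite !ltnS => hi hj; case: eqP => [_|/eqP jn].
  rewrite /yn mulr_sumr; apply/(srpredP vR); apply: rpred_sum => l _.
  move: hi; rewrite leq_eqVlt => /orP[/eqP ->|hi].
    by rewrite mulrC; apply/srpredP; case: (rz l (ltn_ord l)).
  by rewrite mulrA rpredM //; apply/srpredP; [exact: hy | case: (ru l)].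
have {hj jn} hj : (j < n)%N by rewrite ltn_neqAle jn.
move: hi; rewrite leq_eqVlt => /orP[/eqP ->|hi].
  by rewrite mulrC; case: (rz j hj).
by rewrite mulrA; apply/(srpredP vR); apply: rpredM; apply/srpredP; [exact: hy | case: (ru j)].
Qed.

End PruferIdeals.

(** * Free modules of countable rank *)

Section FiniteSupport.
Variables (A : nzRingType) (V : lmodType A).

(** Cuts out the countable direct sum V^(N) inside the sequences. *)
Definition fin_supp : {pred nat -> V} :=
  fun f => `[< exists n, forall i, (n <= i)%N -> f i = 0 >].
Lemma fin_supp_submod : submod_closed fin_supp.
Proof.
split; first by apply/asboolP; exists 0%N.
move=> a f g /asboolP[m hm] /asboolP[n hn]; apply/asboolP; exists (maxn m n) => i.
rewrite geq_max => /andP[mi ni]; rewrite fctE /= .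
by rewrite -[LHS]/(a *: f i + g i) hm // hn // scaler0 addr0.
Qed.
HB.instance Definition _ := GRing.isSubmodClosed.Build A (nat -> V) fin_supp fin_supp_submod.
Record fs := Fs { fsval : nat -> V; fsvalP : fsval \in fin_supp }.
HB.instance Definition _ := [isSub for fsval].
HB.instance Definition _ := [Choice of fs by <:].
HB.instance Definition _ := [SubChoice_isSubLmodule of fs by <:].

Lemma fs_ext (x y : fs) : fsval x =1 fsval y -> x = y.
Proof. by move=> h; apply/val_inj/funext. Qed.
Lemma fs_bound (x : fs) : exists n, forall i, (n <= i)%N -> fsval x i = 0.
Proof. by case: x => f /= /asboolP. Qed.
Definition mkfs (f : nat -> V) (h : exists n, forall i, (n <= i)%N -> f i = 0) : fs :=
  Fs (introT (asboolP _) h : f \in fin_supp).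
End FiniteSupport.
Arguments fs {A} V.

Section Isomorphism.
Variable A : nzRingType.
Implicit Types U V W P Q : lmodType A.

Definition lin U V (f : U -> V) := forall a x y, f (a *: x + y) = a *: f x + f y.

Lemma lin0 U V (f : U -> V) : lin f -> f 0 = 0.
Proof.
by move=> hf; have := hf (-1) 0 0; rewrite scaler0 addr0 scaleN1r addNr.
Qed.
Lemma linD U V (f : U -> V) x y : lin f -> f (x + y) = f x + f y.
Proof. by move=> hf; rewrite -[x]scale1r hf !scale1r. Qed.
Lemma linZ U V (f : U -> V) a x : lin f -> f (a *: x) = a *: f x.
Proof. by move=> hf; rewrite -[a *: x]addr0 hf lin0 ?addr0. Qed.
Lemma linB U V (f : U -> V) x y : lin f -> f (x - y) = f x - f y.
Proof. by move=> hf; rewrite -scaleN1r addrC hf scaleN1r addrC. Qed.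
Lemma lin_sum U V (f : U -> V) I (r : seq I) (p : pred I) (F : I -> U) : lin f ->
  f (\sum_(i <- r | p i) F i) = \sum_(i <- r | p i) f (F i).
Proof. by move=> hf; apply: (big_morph f) => [x y|]; [exact: linD | exact: lin0]. Qed.

Definition iso U V := exists (f : U -> V) (g : V -> U), [/\ lin f, cancel f g & cancel g f].
Definition retract P V := exists (i : P -> V) (r : V -> P), [/\ lin i, lin r & cancel i r].

Lemma cancel_lin U V (f : U -> V) (g : V -> U) : lin f -> cancel f g -> cancel g f -> lin g.
Proof. by move=> hf fg gf a x y; apply: (can_inj fg); rewrite gf hf !gf. Qed.

Lemma iso_refl U : iso U U. Proof. by exists id, id. Qed.
Lemma iso_sym U V : iso U V -> iso V U.
Proof. by move=> [f [g [hf fg gf]]]; exists g, f; split=> //; exact: cancel_lin hf fg gf. Qed.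
Lemma iso_trans V U W : iso U V -> iso V W -> iso U W.
Proof.
move=> [f [g [hf fg gf]]] [f' [g' [hf' fg' gf']]]; exists (f' \o f), (g \o g'); split.
- by move=> a x y /=; rewrite hf hf'.
- exact: can_comp.
- exact: can_comp.
Qed.
Lemma iso_prod U U' V V' : iso U U' -> iso V V' -> iso (U * V)%type (U' * V')%type.
Proof.
move=> [f [g [hf fg gf]]] [f' [g' [hf' fg' gf']]].
exists (fun x => (f x.1, f' x.2)), (fun y => (g y.1, g' y.2)); split.
- by move=> a x y /=; rewrite hf hf'.
- by case=> x y /=; rewrite fg fg'.
- by case=> x y /=; rewrite gf gf'.
Qed.
Lemma iso_prodC U V : iso (U * V)%type (V * U)%type.
Proof.
by exists (fun x => (x.2, x.1)), (fun x => (x.2, x.1)); split=> [//||]; case.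
Qed.
Lemma iso_prodA U V W : iso (U * (V * W))%type ((U * V) * W)%type.
Proof.
exists (fun x => ((x.1, x.2.1), x.2.2)), (fun x => (x.1.1, (x.1.2, x.2))); split=> //.
  by case=> x [y z].
by case=> [[x y] z].
Qed.

Definition fs_map U V (f : U -> V) (hf : lin f) (x : fs U) : fs V.
Proof.
exists (f \o fsval x); apply/asboolP; have [n hn] := fs_bound x.
by exists n => i /hn /= ->; exact: lin0.
Defined.
Lemma fs_map_lin U V (f : U -> V) (hf : lin f) : lin (fs_map hf).
Proof. by move=> a x y; apply: fs_ext => n; exact: hf. Qed.
Lemma iso_fs U V : iso U V -> iso (fs U) (fs V).
Proof.
move=> [f [g [hf fg gf]]]; have hg := cancel_lin hf fg gf.
exists (fs_map hf), (fs_map hg); split; first exact: fs_map_lin.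
  by move=> x; apply: fs_ext => n /=; rewrite fg.
by move=> x; apply: fs_ext => n /=; rewrite gf.
Qed.

Lemma fst_lin U V : lin (fun x : U * V => x.1). Proof. by []. Qed.
Lemma snd_lin U V : lin (fun x : U * V => x.2). Proof. by []. Qed.

Lemma iso_fs_prod U V : iso (fs (U * V)%type) (fs U * fs V)%type.
Proof.
have hpair (y : fs U * fs V) : exists n, forall i, (n <= i)%N ->
    (fsval y.1 i, fsval y.2 i) = 0 :> (U * V)%type.
  have [m hm] := fs_bound y.1; have [n hn] := fs_bound y.2.
  by exists (maxn m n) => i; rewrite geq_max => /andP[/hm -> /hn ->].
exists (fun x => (fs_map (@fst_lin U V) x, fs_map (@snd_lin U V) x)).
exists (fun y => mkfs (hpair y)); split.
- by move=> a x y; congr pair; apply: fs_ext.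
- by move=> x; apply: fs_ext => n /=; case: (fsval x n).
- by case=> x y; congr pair; apply: fs_ext.
Qed.

Lemma iso_fs_cons U : iso (U * fs U)%type (fs U).
Proof.
have hc (y : U * fs U) : exists n, forall i, (n <= i)%N ->
    (if i is j.+1 then fsval y.2 j else y.1) = 0.
  by have [n hn] := fs_bound y.2; exists n.+1 => -[//|i] /hn.
have ht (x : fs U) : exists n, forall i, (n <= i)%N -> fsval x i.+1 = 0.
  by have [n hn] := fs_bound x; exists n => i h; apply: hn; exact: leqW.
exists (fun y => mkfs (hc y)), (fun x => (fsval x 0, mkfs (ht x))); split.
- by move=> a x y; apply: fs_ext => -[|n].
- by case=> x y; congr pair; apply: fs_ext.
- by move=> x; apply: fs_ext => -[|n].
Qed.

Lemma nat2_bijection : exists (f : nat -> nat * nat) (g : nat * nat -> nat),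
  cancel f g /\ cancel g f.
Proof.
have [|f [fi fr]] := @countable_infinite_enum _ [set: nat * nat] (countableP _).
  by rewrite -setXTT; exact: infinite_setX infinite_nat infinite_nat.
have /choice[g hg] : forall y, exists n, f n = y.
  by move=> y; have [n _ <-] : range f y by [rewrite fr]; exists n.
by exists f, g; split=> // n; apply: fi; rewrite hg.
Qed.

Lemma iso_fs_fs U : iso (fs (fs U)) (fs U).
Proof.
have [p [g [pg gp]]] := nat2_bijection.
have max_le (F : nat -> nat) n i : (i < n)%N -> (F i <= \max_(j < n) F j)%N.
  by move=> h; exact: (leq_bigmax (F := fun j : 'I_n => F j) (Ordinal h)).
(* Supports stay bounded under the reindexing: finitely many occupied pairs have finitely many
   codes. *)
have h1 (x : fs (fs U)) : exists n, forall i, (n <= i)%N ->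
    fsval (fsval x (p i).1) (p i).2 = 0.
  have [m hm] := fs_bound x.
  have /choice[b hb] : forall i, exists n, forall j, (n <= j)%N -> fsval (fsval x i) j = 0.
    by move=> i; exact: fs_bound.
  exists (\max_(i < m) \max_(j < b i) g (nat_of_ord i, nat_of_ord j)).+1 => i hi.
  have [le|lt] := leqP m (p i).1; first by rewrite hm.
  have [le|lt2] := leqP (b (p i).1) (p i).2; first by rewrite hb.
  move: hi; rewrite ltnNge => /negP[].
  rewrite -{1}[i]pg; case: (p i) lt lt2 => a c /= lt lt2.
  apply: leq_trans (max_le (fun a => \max_(j < b a) g (a, nat_of_ord j)) _ _ lt).
  exact: (max_le (fun c => g (a, c))).
have h2 (y : fs U) a : exists n, forall i, (n <= i)%N -> fsval y (g (a, i)) = 0.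
  have [n hn] := fs_bound y; exists (\max_(j < n) (p j).2).+1 => i hi; apply: hn.
  rewrite leqNgt; apply/negP => lt; move: hi; rewrite ltnNge => /negP[].
  have := max_le (fun j => (p j).2) _ _ lt; by rewrite gp.
have h3 (y : fs U) : exists n, forall a, (n <= a)%N -> mkfs (h2 y a) = 0.
  have [n hn] := fs_bound y; exists (\max_(j < n) (p j).1).+1 => a ha.
  apply: fs_ext => i /=; apply: hn.
  rewrite leqNgt; apply/negP => lt; move: ha; rewrite ltnNge => /negP[].
  have := max_le (fun j => (p j).1) _ _ lt; by rewrite gp.
exists (fun x => mkfs (h1 x)), (fun y => mkfs (h3 y)); split.
- by move=> a x y; apply: fs_ext.
- by move=> x; apply: fs_ext => a; apply: fs_ext => i /=; rewrite gp.
- by move=> y; apply: fs_ext => n /=; rewrite -surjective_pairing pg.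
Qed.

Lemma iso_fs_double U : iso (fs U) (fs U * fs U)%type.
Proof.
apply: iso_trans (iso_sym (iso_fs_fs U)) _.
apply: iso_trans (iso_fs (iso_sym (iso_fs_cons U))) _.
apply: iso_trans (iso_fs_prod _ _) _.
exact: iso_prod (iso_refl _) (iso_fs_fs _).
Qed.

Section Kernel.
Variables (X P : lmodType A) (r : X -> P) (hr : lin r).
Definition in_ker of lin r : {pred X} := fun x => r x == 0.
Lemma in_ker_submod : submod_closed (in_ker hr).
Proof.
split; first by rewrite unfold_in /in_ker lin0.
move=> a x y; rewrite !unfold_in /in_ker => /eqP hx /eqP hy.
by rewrite hr hx hy scaler0 addr0.
Qed.
HB.instance Definition _ := GRing.isSubmodClosed.Build A X (in_ker hr) in_ker_submod.
Record kerT := KerT { kerval : X; _ : kerval \in in_ker hr }.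
HB.instance Definition _ := [isSub for kerval].
HB.instance Definition _ := [Choice of kerT by <:].
HB.instance Definition _ := [SubChoice_isSubLmodule of kerT by <:].
End Kernel.

Lemma retract_iso P X : retract P X -> exists Q, iso X (P * Q)%type.
Proof.
move=> [i [r [hi hr ir]]]; exists (kerT hr : lmodType A).
have hk x : x - i (r x) \in in_ker hr.
  by rewrite unfold_in /in_ker (linB _ _ hr) ir subrr.
exists (fun x => (r x, KerT (hk x))), (fun y => i y.1 + kerval y.2); split.
- move=> a x y; congr pair; first exact: hr.
  by apply: val_inj => /=; rewrite hr hi scalerBr opprD addrACA.
- by move=> x /=; rewrite addrC subrK.
- case=> p [k hk'] /=; have rk : r k = 0 by move: (hk'); rewrite unfold_in => /eqP.
  have e : r (i p + k) = p by rewrite (linD _ _ hr) ir rk addr0.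
  congr pair; first exact: e.
  by apply: val_inj => /=; rewrite e addrC addKr.
Qed.

(* Eilenberg swindle. *)
Lemma fs_absorb P Q : retract Q (fs P) -> iso (fs P) (fs Q * fs P)%type.
Proof.
move=> /retract_iso[S hS].
have h : iso (fs P) (fs Q * fs S)%type.
  apply: iso_trans (iso_sym (iso_fs_fs P)) _.
  exact: iso_trans (iso_fs hS) (iso_fs_prod _ _).
refine (iso_trans h _); apply: iso_trans (iso_prod (iso_fs_double Q) (iso_refl _)) _.
apply: iso_trans (iso_sym (iso_prodA _ _ _)) _.
exact: iso_prod (iso_refl _) (iso_sym h).
Qed.

(** Each of the two sums absorbs the other, so both are isomorphic to their product. *)
Theorem fs_iso P Q : retract P (fs Q) -> retract Q (fs P) -> iso (fs Q) (fs P).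
Proof.
move=> hP hQ; apply: iso_trans (fs_absorb hP) _.
by apply: iso_trans (iso_prodC _ _) _; apply/iso_sym/fs_absorb.
Qed.

End Isomorphism.

(** * Finitely generated torsion-free modules *)

Section PruferModules.
Variables (A : comNzRingType) (F : fieldType) (v : {rmorphism A -> F}).
Hypotheses (v_inj : injective v) (prf : prufer v).
Variable N : lmodType A.
Hypothesis tf : forall (a : A) (x : N), a *: x = 0 -> a = 0 \/ x = 0.
Variable xs : seq N.
Definition comb (zs : seq N) (c : nat -> A) : N := \sum_(i < size zs) c i *: zs`_i.
Hypothesis gen : forall y, exists c, y = comb xs c.

Lemma combD zs c c' : comb zs (fun i => c i + c' i) = comb zs c + comb zs c'.
Proof. by rewrite /comb -big_split; apply: eq_bigr => i _; rewrite scalerDl. Qed.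
Lemma combZ zs a c : comb zs (fun i => a * c i) = a *: comb zs c.
Proof. by rewrite /comb scaler_sumr; apply: eq_bigr => i _; rewrite scalerA. Qed.
Lemma comb_cons z zs c : comb (z :: zs) c = c 0%N *: z + comb zs (fun i => c i.+1).
Proof. by rewrite /comb big_ord_recl. Qed.

Lemma v_neq0 (a : A) : a <> 0 -> v a != 0.
Proof. by move=> a0; apply/eqP => va; apply: a0; apply: v_inj; rewrite rmorph0. Qed.
Lemma dom_mul (a b : A) : a <> 0 -> b <> 0 -> a * b <> 0.
Proof.
move=> /v_neq0 a0 /v_neq0 b0 ab; move: (mulf_neq0 a0 b0).
by rewrite -rmorphM ab rmorph0 eqxx.
Qed.

Definition indep (zs : seq N) := forall c, comb zs c = 0 -> forall i, (i < size zs)%N -> c i = 0.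

(** A maximal independent subfamily of the generators; it becomes an F-basis after extension of
    scalars from A to F. *)
Lemma exists_max_indep : exists zs, indep zs /\
  forall y, exists ac : A * (nat -> A), ac.1 <> 0 /\ ac.1 *: y = comb zs ac.2.
Proof.
have [zs [iz hz]] : exists zs, indep zs /\
    forall x, x \in xs -> exists ac : A * (nat -> A), ac.1 <> 0 /\ ac.1 *: x = comb zs ac.2.
  move: (xs : seq N) => s'; elim: s' => [|x s [zs [iz hz]]]; first by exists [::].
  have [[ac hac]|nx] := pselect (exists ac : A * (nat -> A), ac.1 <> 0 /\ ac.1 *: x = comb zs ac.2).
    by exists zs; split=> // y; rewrite inE => /orP[/eqP ->|/hz //]; exists ac.
  exists (x :: zs); split.
    move=> c; rewrite comb_cons => h0.
    have c0 : c 0%N = 0.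
      apply: contrapT => c0; apply: nx; exists (c 0%N, fun i => - 1 * c i.+1); split=> //.
      by rewrite /= combZ scaleN1r; apply/eqP; rewrite -addr_eq0 h0.
    move: h0; rewrite c0 scale0r add0r => /iz h [|i] //; exact: h.
  move=> y; rewrite inE => /orP[/eqP ->|/hz[[a c] [a0 ha]]].
    exists (1, fun i => (i == 0%N)%:R); split; first exact/eqP/oner_neq0.
    rewrite comb_cons /= !scale1r /comb big1 ?addr0 // => i _; exact: scale0r.
  exists (a, fun i => if i is j.+1 then c j else 0); split=> //=.
  by rewrite comb_cons scale0r add0r.
exists zs; split=> // y; have [c ->] := gen y.
rewrite {1}/comb; apply: (big_ind (fun y => exists ac : A * (nat -> A),
  ac.1 <> 0 /\ ac.1 *: y = comb zs ac.2)) => [|y1 y2 [[a c1] [a0 e1]] [[b c2] [b0 e2]]|i _].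
- exists (1, fun=> 0); split; first exact/eqP/oner_neq0.
  by rewrite scaler0 /comb big1 // => i _; rewrite scale0r.
- exists (a * b, fun i => b * c1 i + a * c2 i); split=> /=; first exact: dom_mul.
  by rewrite combD !combZ -e1 -e2 scalerDr !scalerA [b * a]mulrC.
- have [[a c1] [a0 e1]] := hz _ (mem_nth 0 (ltn_ord i)).
  exists (a, fun j => c i * c1 j); split=> //=.
  by rewrite combZ -e1 /= !scalerA mulrC.
Qed.

Definition flin (l : N -> F) := forall a x y, l (a *: x + y) = v a * l x + l y.

(** These are the coordinates along [zs]: if a y is the sum of the c_i zs_i, then l_i(y) = c_i / a.
    Independence makes the quotient well defined, and torsion-freeness makes the l_i jointly
    injective. *)
Lemma exists_functionals : exists r (l : nat -> N -> F), (forall i, flin (l i)) /\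
  forall y, (forall i, (i < r)%N -> l i y = 0) -> y = 0.
Proof.
have [zs [iz /choice[ac hac]]] := exists_max_indep.
pose l i y : F := if (i < size zs)%N then v ((ac y).2 i) / v (ac y).1 else 0.
have lE i b c y : (i < size zs)%N -> b <> 0 -> b *: y = comb zs c -> l i y = v (c i) / v b.
  move=> hi b0 e; have [a0 e'] := hac y; rewrite /l hi.
  have : comb zs (fun i => (ac y).1 * c i + - 1 * (b * (ac y).2 i)) = 0.
    by rewrite combD !combZ -e -e' scaleN1r !scalerA mulrC subrr.
  move=> /iz/(_ i hi)/(congr1 v); rewrite rmorph0 rmorphD !rmorphM rmorphN rmorph1 mulN1r.
  move=> /subr0_eq h; have va := v_neq0 a0; have vb := v_neq0 b0.
  by apply: (mulfI va); rewrite mulrC divfK // mulrA h; field.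
exists (size zs), l; split.
- move=> i a x y; have [hi|hi] := ltnP i (size zs); last first.
    by rewrite /l ltnNge hi /= mulr0 addr0.
  have [x0 ex] := hac x; have [y0 ey] := hac y.
  pose b := (ac x).1 * (ac y).1.
  rewrite (lE i b (fun i => a * ((ac y).1 * (ac x).2 i) + (ac x).1 * (ac y).2 i)) //.
  + rewrite /l hi /b rmorphD !rmorphM; field.
    by rewrite !v_neq0.
  + exact: dom_mul.
  + rewrite combD !combZ -ex -ey scalerDr !scalerA /b.
    by congr (_ *: _ + _ *: _); ring.
- move=> y hy; have [y0 ey] := hac y.
  suff e0 : comb zs (ac y).2 = 0 by rewrite e0 in ey; case: (tf ey).
  rewrite /comb big1 // => i _; have := hy i (ltn_ord i); rewrite /l ltn_ord => /eqP.
  rewrite mulf_eq0 invr_eq0 (negPf (v_neq0 y0)) orbF => /eqP h.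
  by rewrite (_ : (ac y).2 i = 0) ?scale0r //; apply: v_inj; rewrite rmorph0.
Qed.

Lemma flin0 l : flin l -> l 0 = 0.
Proof. by move=> hl; have := hl 1 0 0; rewrite scaler0 addr0 rmorph1 mul1r => h; apply: (addIr (l 0)); rewrite add0r -h. Qed.
Lemma flinD l x y : flin l -> l (x + y) = l x + l y.
Proof. by move=> hl; have := hl 1 x y; rewrite scale1r rmorph1 mul1r. Qed.
Lemma flinZ l a x : flin l -> l (a *: x) = v a * l x.
Proof. by move=> hl; have := hl a x 0; rewrite flin0 // !addr0. Qed.
Lemma flin_sum l I (r : seq I) (p : pred I) (G : I -> N) : flin l ->
  l (\sum_(i <- r | p i) G i) = \sum_(i <- r | p i) l (G i).
Proof. by move=> hl; apply: (big_morph l) => [x y|]; [exact: flinD | exact: flin0]. Qed.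

Definition alin (g : N -> A) := forall a x y, g (a *: x + y) = a * g x + g y.

(** The image of l after pi is a finitely generated fractional ideal, hence invertible, say by t.
    Multiplying the functional by t_j makes it A-valued, and the relation for t, with the sum of the
    w_j t_j equal to 1, yields both identities. *)
Lemma functional_dual (l : N -> F) (pi : N -> N) : flin l -> lin pi ->
  (exists y, l (pi y) != 0) ->
  exists g : nat -> N -> A, (forall j, alin (g j)) /\
    (forall y, l (pi y) = \sum_(j < size xs) v (g j y) * l (pi xs`_j)) /\
    \sum_(j < size xs) g j xs`_j = 1.
Proof.
move=> hl hpi [y0 ly0]; pose w k := l (pi xs`_k).
have lw y : exists c, l (pi y) = \sum_(k < size xs) v (c k) * w k.
  have [c ->] := gen y; exists c; rewrite (lin_sum _ _ _ hpi) (flin_sum _ _ _ hl).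
  by apply: eq_bigr => k _; rewrite (linZ _ _ hpi) flinZ.
have : exists2 k, (k < size xs)%N & w k != 0.
  apply: contrapT => h; have [c e] := lw y0; move: ly0; rewrite e big1 ?eqxx // => k _.
  have [->|wk] := eqVneq (w k) 0; first by rewrite mulr0.
  by case: h; exists (k : nat).
move=> /(prufer_invertible prf)[t [st ht]].
have hg j y : exists a, (j < size xs)%N -> v a = l (pi y) * t j.
  have [hj|hj] := ltnP j (size xs); last by exists 0.
  have [c ->] := lw y; rewrite mulr_suml.
  suff [a _ <-] : range v (\sum_(k < size xs) v (c k) * w k * t j) by exists a.
  have /choice[b hb] : forall k : 'I_(size xs), exists b, v b = w k * t j.
    by move=> k; have [b _ hb] := ht k j (ltn_ord k) hj; exists b.
  exists (\sum_(k < size xs) c k * b k) => //; rewrite rmorph_sum.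
  by apply: eq_bigr => k _; rewrite rmorphM hb mulrA.
have /choice[g' hg'] : forall jy : nat * N, exists a, (jy.1 < size xs)%N -> v a = l (pi jy.2) * t jy.1.
  by case=> j y; exact: hg.
pose g j y := if (j < size xs)%N then g' (j, y) else 0.
have gE j y : (j < size xs)%N -> v (g j y) = l (pi y) * t j.
  by move=> hj; rewrite /g hj (hg' (j, y) hj).
exists g; split; [|split].
- move=> j a x y; have [hj|hj] := ltnP j (size xs); last first.
    by rewrite /g ltnNge hj /= mulr0 addr0.
  by apply: v_inj; rewrite rmorphD rmorphM !gE // hpi hl mulrDl mulrA.
- move=> y; rewrite -[LHS]mulr1 -st mulr_sumr; apply: eq_bigr => j _.
  by rewrite gE // -mulrA [t j * _]mulrC.
- apply: v_inj; rewrite rmorph1 -st rmorph_sum; apply: eq_bigr => j _.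
  by rewrite gE.
Qed.

(** Factorization through a free module of finite rank; for the identity map this is the dual basis
    criterion for projectivity. *)
Definition factors (e : N -> N) := exists n (g : 'I_n -> N -> A) (ys : 'I_n -> N),
  (forall j, alin (g j)) /\ forall y, e y = \sum_j g j y *: ys j.

Lemma factorsD e e' : factors e -> factors e' -> factors (fun y => e y + e' y).
Proof.
move=> [n [g [ys [hg he]]]] [n' [g' [ys' [hg' he']]]].
exists (n + n')%N, (fun j => match fintype.split j with inl i => g i | inr i => g' i end).
exists (fun j => match fintype.split j with inl i => ys i | inr i => ys' i end); split.
  by move=> j; case: (fintype.split j).
move=> y; rewrite big_split_ord he he'; congr (_ + _); apply: eq_bigr => j _.
  by rewrite (unsplitK (inl j : _ + _)).
by rewrite (unsplitK (inr j : _ + _)).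
Qed.

(* Splitting off, one functional at a time, the invertible fractional ideal that is its image. *)
Lemma dual_basis : factors id.
Proof.
have [r [l [hl l0]]] := exists_functionals.
suff [pi [_ fpi hpi]] : exists pi : N -> N, [/\ lin pi, factors (fun y => y - pi y) &
    forall i, (i < r)%N -> forall y, l i (pi y) = 0].
  have [n [g [ys [hg e]]]] := fpi; exists n, g, ys; split=> // y.
  by rewrite -e (l0 (pi y)) ?subr0 // => i /hpi.
elim: r {l0} => [|r [pi [lpi fpi hpi]]].
  exists id; split=> //; exists 0%N, (fun _ _ => 0), (fun=> 0); split; first by case.
  by move=> y; rewrite subrr big_ord0.
have [nz|z] := pselect (exists y, l r (pi y) != 0); last first.
  exists pi; split=> // i; rewrite ltnS leq_eqVlt => /orP[/eqP ->|/hpi //] y.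
  by apply/eqP; apply: contrapT => /negP h; apply: z; exists y.
have [g [hg [e1 _]]] := functional_dual (hl r) lpi nz.
(* [f] takes values in the span of the pi x_j, on which the earlier functionals vanish, and [e1]
   says that l_r agrees on f y and pi y. So pi - f is killed by one more functional. *)
pose f y := \sum_(j < size xs) g j y *: pi xs`_j.
have lf : lin f.
  move=> a x y; rewrite /f scaler_sumr -big_split; apply: eq_bigr => j _ /=.
  by rewrite hg scalerDl scalerA.
exists (fun y => pi y - f y); split.
- by move=> a x y; rewrite lpi lf scalerBr opprD addrACA.
- have [n [g' [ys' [hg' he']]]] : factors (fun y => (y - pi y) + f y).
    apply: factorsD fpi _; exists (size xs), (fun j : 'I_(size xs) => g j).
    by exists (fun j : 'I_(size xs) => pi xs`_j).
  by exists n, g', ys'; split=> // y; rewrite -he' opprB addrCA addrC.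
- have lB i y : l i (pi y - f y) = l i (pi y) - \sum_(j < size xs) v (g j y) * l i (pi xs`_j).
    rewrite -scaleN1r addrC hl rmorphN rmorph1 mulN1r addrC; congr (_ - _).
    by rewrite /f (flin_sum _ _ _ (hl i)); apply: eq_bigr => j _; rewrite flinZ.
  move=> i; rewrite ltnS leq_eqVlt => /orP[/eqP ->|hi] y; rewrite lB.
    by rewrite -e1 subrr.
  by rewrite hpi // big1 ?subr0 // => j _; rewrite hpi // mulr0.
Qed.

Lemma retract_free : retract N (fs (A^o : lmodType A)).
Proof.
have [n [g [ys [hg e]]]] := dual_basis.
have hi y : exists m, forall i, (m <= i)%N ->
    (if insub i is Some j then g j y else 0) = 0 :> A^o.
  by exists n => i le; rewrite insubN // -leqNgt.
exists (fun y => mkfs (hi y)), (fun c : fs (A^o : lmodType A) => \sum_(j < n) (fsval c j : A) *: ys j); split.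
- move=> a x y; apply: fs_ext => i /=.
  transitivity (a * (if insub i is Some j then g j x else 0)
    + (if insub i is Some j then g j y else 0)); last by [].
  by case: (insub i) => [j|]; [exact: hg | rewrite mulr0 addr0].
- move=> a x y; rewrite scaler_sumr -big_split; apply: eq_bigr => j _ /=.
  transitivity ((a * (fsval x j : A) + fsval y j) *: ys j); first by [].
  by rewrite scalerDl scalerA.
- move=> y; rewrite [RHS]e; apply: eq_bigr => j _ /=.
  by rewrite valK.
Qed.

(** Some coordinate functional is nonzero, and invertibility of its image provides g_j with the sum
    of the g_j(x_j) equal to 1. Hence a -> (a x_j)_j is split by the g_j. *)
Lemma retract_generator : (exists y : N, y <> 0) -> retract (A^o : lmodType A) (fs N).
Proof.
move=> [y0 ny0]; have [r [l [hl l0]]] := exists_functionals.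
have [i [y ly]] : exists i y, l i y != 0.
  apply: contrapT => h; apply: ny0; apply: l0 => i _; apply/eqP; apply: contrapT => /negP nz.
  by apply: h; exists i, y0.
have [g [hg [_ g1]]] := @functional_dual (l i) id (hl i) (fun _ _ _ => erefl) (ex_intro _ y ly).
have hi (a : A^o) : exists m, forall i, (m <= i)%N ->
    (if (i < size xs)%N then (a : A) *: xs`_i else 0) = 0.
  by exists (size xs) => i' le; rewrite ltnNge le.
exists (fun a => mkfs (hi a)), (fun c : fs N => \sum_(j < size xs) g j (fsval c j)); split.
- move=> a x z; apply: fs_ext => j /=.
  transitivity (a *: (if (j < size xs)%N then (x : A) *: xs`_j else 0)
    + (if (j < size xs)%N then (z : A) *: xs`_j else 0)); last by [].
  case: ifP => _; last by rewrite scaler0 addr0.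
  by rewrite scalerA -scalerDl.
- move=> a x z; rewrite -[RHS]/(a * _ + _) mulr_sumr -big_split; apply: eq_bigr => j _ /=.
  exact: hg.
- move=> a; rewrite -[RHS](mulr1 (a : A)) -g1 mulr_sumr; apply: eq_bigr => j _ /=.
  rewrite ltn_ord; have g0 : g j 0 = 0.
    by have := hg j 1 0 0; rewrite scaler0 addr0 mul1r => h; apply: (addIr (g j 0)); rewrite add0r -h.
  by have := hg j a xs`_j 0; rewrite g0 !addr0.
Qed.

End PruferModules.

(** * Twisted polynomials *)

Section TwistedDegree.
Variables (Fq : finFieldType) (K : fieldType) (iK : {rmorphism Fq -> K}).
Local Notation q := #|Fq|.
Local Notation twp := (twisted_poly iK).
Implicit Types P Q : twp.

Lemma card_Fq_gt1 : (1 < q)%N. Proof. exact: finNzRing_gt1. Qed.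
Lemma expq_gt0 n : (0 < q ^ n)%N.
Proof. by rewrite expn_gt0 (ltnW card_Fq_gt1). Qed.
Lemma expq0 (E : fieldType) n : (0 : E) ^+ (q ^ n) = 0.
Proof. by rewrite expr0n gtn_eqF ?expq_gt0. Qed.

Lemma tw_ext P Q : (forall n, tw_coef P n = tw_coef Q n) -> P = Q.
Proof. by move=> h; apply/(@polyP K). Qed.
Lemma tw_coefD P Q n : tw_coef (P + Q) n = tw_coef P n + tw_coef Q n.
Proof. exact: coefD. Qed.
Lemma tw_coefN P n : tw_coef (- P) n = - tw_coef P n.
Proof. exact: coefN. Qed.
Lemma tw_coef0 n : tw_coef (0 : twp) n = 0.
Proof. exact: coef0. Qed.
Lemma tw_coef1 n : tw_coef (1 : twp) n = (n == 0)%:R.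
Proof. exact: coef1. Qed.

Lemma tw_coefM P Q n : tw_coef (P * Q) n =
  \sum_(i < size (P : {poly K})) \sum_(j < size (Q : {poly K}))
     if (i + j)%N == n then tw_coef P i * tw_coef Q j ^+ (q ^ i) else 0.
Proof.
rewrite -[P * Q]/(tw_mul P Q) /tw_mul /tw_coef coef_sum; apply: eq_bigr => i _.
rewrite coef_sum; apply: eq_bigr => j _.
by rewrite coefZ coefXn eq_sym; case: eqP => _; rewrite ?mulr1 ?mulr0.
Qed.

Definition tw_lt n P := forall i, (n <= i)%N -> tw_coef P i = 0.

Lemma tw_ltP n P : tw_lt n P <-> (size (P : {poly K}) <= n)%N.
Proof. by split=> [/leq_sizeP|/leq_sizeP]. Qed.

Lemma tw_ltM m n P Q : tw_lt m.+1 P -> tw_lt n.+1 Q ->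
  tw_lt (m + n).+1 (P * Q) /\ tw_coef (P * Q) (m + n) = tw_coef P m * tw_coef Q n ^+ (q ^ m).
Proof.
move=> hP hQ; split=> [l hl|].
  rewrite tw_coefM big1 // => i _; rewrite big1 // => j _; case: eqP => // e.
  have [im|im] := leqP m.+1 i; first by rewrite hP // mul0r.
  by rewrite hQ ?expq0 ?mulr0 //; lia.
rewrite tw_coefM; set s := size _; set s' := size _.
have zero (i : 'I_s) (j : 'I_s') : (i != m :> nat) || (j != n :> nat) ->
   (if (i + j)%N == (m + n)%N then tw_coef P i * tw_coef Q j ^+ (q ^ i) else 0) = 0.
  move=> ne; case: eqP => // e.
  have [im|im] := leqP m.+1 i; first by rewrite hP // mul0r.
  by rewrite hQ ?expq0 ?mulr0 //; lia.
have [ms|ms] := ltnP m s; last first.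
  rewrite [tw_coef P m]nth_default // mul0r big1 // => i _; rewrite big1 // => j _.
  by apply: zero; have := ltn_ord i; lia.
have [ns|ns] := ltnP n s'; last first.
  rewrite [tw_coef Q n]nth_default // expq0 mulr0 big1 // => i _; rewrite big1 // => j _.
  by apply: zero; have := ltn_ord j; lia.
rewrite (bigD1 (Ordinal ms)) //= (bigD1 (Ordinal ns)) //= eqxx.
rewrite [X in _ + X + _]big1 ?addr0 => [|j]; last first.
  by rewrite -val_eqE /= => jn; apply: (zero (Ordinal ms) j); rewrite jn orbT.
rewrite big1 ?addr0 // => i; rewrite -val_eqE /= => im.
by rewrite big1 // => j _; apply: zero; rewrite im.
Qed.

Definition tw_has_degree n P := tw_lt n.+1 P /\ tw_coef P n != 0.

Lemma tw_degreeM m n P Q : tw_has_degree m P -> tw_has_degree n Q ->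
  tw_has_degree (m + n) (P * Q).
Proof.
move=> [hP lP] [hQ lQ]; have [h1 h2] := tw_ltM hP hQ; split=> //.
by rewrite h2 mulf_neq0 ?expf_neq0.
Qed.

Lemma tw_degreeE P : P != 0 -> tw_has_degree (tw_degree P) P.
Proof.
move=> P0; split; last by rewrite /tw_coef /tw_degree -lead_coefE lead_coef_eq0.
by apply/tw_ltP; rewrite /tw_degree leqSpred.
Qed.

Lemma tw_degree_uniq m n P : tw_has_degree m P -> tw_has_degree n P -> m = n.
Proof.
move=> [h1 h2] [h3 h4]; have [lt|lt|//] := ltngtP m n.
  by rewrite h1 ?eqxx in h4.
by rewrite h3 ?eqxx in h2.
Qed.

Lemma tw_mulf_eq0 P Q : P * Q = 0 -> P = 0 \/ Q = 0.
Proof.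
move=> PQ; have [->|P0] := eqVneq P 0; first by left.
have [->|Q0] := eqVneq Q 0; first by right.
have [_] := tw_degreeM (tw_degreeE P0) (tw_degreeE Q0).
by rewrite PQ tw_coef0 eqxx.
Qed.

Lemma tw_degree1 : tw_has_degree 0 (1 : twp).
Proof.
split=> [i i0|]; last by rewrite tw_coef1 oner_neq0.
by rewrite tw_coef1; case: i i0.
Qed.

Lemma tw_degreeX m P n : tw_has_degree m P -> tw_has_degree (m * n) (P ^+ n).
Proof.
move=> hP; elim: n => [|n IH]; first by rewrite muln0 expr0; exact: tw_degree1.
by rewrite mulnS exprS; exact: tw_degreeM.
Qed.

Lemma tw_unit_degree P Q : P * Q = 1 -> tw_has_degree 0 P.
Proof.
move=> PQ; have P0 : P != 0.
  apply/eqP => P0; have := oner_neq0 twp; rewrite -PQ P0.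
  have -> : (0 : twp) * Q = 0 by rewrite mul0r.
  by rewrite eqxx.
have Q0 : Q != 0.
  apply/eqP => Q0; have := oner_neq0 twp; rewrite -PQ Q0.
  by rewrite mulr0 eqxx.
have h := tw_degreeM (tw_degreeE P0) (tw_degreeE Q0).
rewrite PQ in h; have := tw_degree_uniq h tw_degree1 => /eqP.
rewrite addn_eq0 => /andP[/eqP e _]; rewrite -{1}e; exact: tw_degreeE.
Qed.

End TwistedDegree.

(** * Injectivity of a Drinfeld module *)

Section Injectivity.
Variables (Fq : finFieldType) (F : fieldType) (iF : {rmorphism Fq -> F}).
Hypothesis hF : has_trdeg iF 1.
Variable oo : set F.
Local Notation A := (regular_fun iF oo).
Variables (K : fieldType) (iK : {rmorphism Fq -> K}) (phi : {rmorphism A -> twisted_poly iK}).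

Lemma const_regular c : iF c \in regular_pred iF oo.
Proof. by apply/asboolP => V [_ h _ _] _; apply: h; exists c. Qed.
Definition const_fun c : A := RegularFun (const_regular c).
Lemma const_fun_zmod : zmod_morphism const_fun.
Proof. by move=> c c'; apply: val_inj; rewrite /= rmorphB. Qed.
Lemma const_fun_monoid : monoid_morphism const_fun.
Proof.
by split=> [|c c']; apply: val_inj; rewrite /= ?rmorph1 ?rmorphM.
Qed.
HB.instance Definition _ := GRing.isZmodMorphism.Build Fq A const_fun const_fun_zmod.
HB.instance Definition _ := GRing.isMonoidMorphism.Build Fq A const_fun const_fun_monoid.

Definition regular_incl : A -> F := \val.
HB.instance Definition _ := GRing.RMorphism.copy regular_incl \val.
Lemma regular_incl_inj : injective regular_incl. Proof. exact: val_inj. Qed.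
Lemma regular_inclP (x : F) : regular_away iF oo x -> range regular_incl x.
Proof.
move=> rx; have h : x \in regular_pred iF oo by apply/asboolP.
by exists (RegularFun h).
Qed.
Lemma regular_incl_reg a : regular_away iF oo (regular_incl a).
Proof. by case: a => x h; apply/asboolP. Qed.

(** Nonzero constants are units of A, and units of K{tau} have degree 0. The argument rests on units
    because [phi] is given only as a ring morphism. *)
Lemma const_degree c : c != 0 -> tw_has_degree 0 (phi (const_fun c)).
Proof.
move=> c0; apply: (@tw_unit_degree _ _ _ _ (phi (const_fun c^-1))).
by rewrite -rmorphM -rmorphM /= divff // !rmorph1.
Qed.

Variables (a0 : A) (r : nat).
Hypotheses (r_gt0 : (0 < r)%N) (ha0 : tw_has_degree r (phi a0)).

Definition ev_a0 (p : {poly Fq}) : A := (map_poly const_fun p).[a0].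

(** The nonzero terms of p(a0) have images of distinct degrees r i, so the leading one survives. *)
Lemma phi_ev_neq0 p : p != 0 -> phi (ev_a0 p) != 0.
Proof.
move=> p0; rewrite /ev_a0 horner_coef size_map_poly.
have sp : (0 < size p)%N by rewrite size_poly_gt0.
set n := (size p).-1.
have spE : size p = n.+1 by rewrite /n prednK.
rewrite spE big_ord_recr /= rmorphD /= rmorph_sum /=.
set low := \sum_(i < n) _.
have lowlt : tw_lt (r * n) low.
  move=> l hl; rewrite /low; apply: (big_ind (fun P => tw_coef P l = 0)).
  - exact: tw_coef0.
  - by move=> x y hx hy; rewrite tw_coefD hx hy addr0.
  - move=> i _; rewrite coef_map /= rmorphM rmorphXn /=.
    have [->|pi] := eqVneq p`_i 0; first by rewrite !rmorph0 mul0r tw_coef0.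
    have [h _] := tw_degreeM (const_degree pi) (tw_degreeX i ha0).
    by apply: h; apply: leq_trans _ hl; rewrite add0n ltn_pmul2l.
have pn : p`_n != 0 by rewrite -lead_coefE lead_coef_eq0.
have [_ top] := tw_degreeM (const_degree pn) (tw_degreeX n ha0).
apply/eqP => /(congr1 (fun P => tw_coef P (r * n))).
rewrite tw_coefD tw_coef0 lowlt // add0r coef_map /= rmorphM rmorphXn /= => /eqP.
by apply/negP.
Qed.

Lemma incl_ev p : regular_incl (ev_a0 p) = (map_poly iF p).[regular_incl a0].
Proof.
by rewrite /ev_a0 -horner_map -map_poly_comp.
Qed.

Lemma a0_transcendental : ~ algebraicOver iF (regular_incl a0).
Proof.
case=> p p0 /rootP h; have := phi_ev_neq0 p0.
suff -> : ev_a0 p = 0 by rewrite rmorph0 eqxx.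
by apply: regular_incl_inj; rewrite incl_ev h rmorph0.
Qed.

(** A nonzero [a] satisfies an equation over Fq[a0] which, after division by a power of the
    variable, has a nonzero constant term. This term is a multiple of [a] in Fq[a0], where [phi] has
    no kernel. *)
Lemma phi_injective a : phi a = 0 -> a = 0.
Proof.
move=> pa; apply: contrapT => /eqP a_neq.
have a0' : regular_incl a != 0.
  by apply: contra_neq a_neq => h; apply: regular_incl_inj; rewrite h rmorph0.
have na := a0_transcendental.
have [Q [n [e [Q0 Qa _ _]]]] := alg_relation na (function_field_acl hF na (regular_incl a)).
have [m [Q']] := multiplicity_XsubC Q 0.
rewrite Q0 /= => nQ QE.
have Q'a : (map_poly (map_poly iF) Q').[regular_incl a, regular_incl a0] = 0.
  move: Qa; rewrite QE rmorphM rmorphXn /= map_polyXsubC rmorph0 subr0 hornerM hornerXn hornerM.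
  rewrite -polyC_exp hornerC => /eqP; rewrite mulf_eq0 expf_eq0 (negPf a0') andbF orbF.
  by move/eqP.
have Q'A : \sum_(i < size Q') ev_a0 Q'`_i * a ^+ i = 0.
  apply: regular_incl_inj; rewrite rmorph0 rmorph_sum /= -[RHS]Q'a.
  rewrite (@horner_coef_wide _ (size Q') (map_poly _ Q')) ?size_poly // horner_sum.
  apply: eq_bigr => i _.
  by rewrite rmorphM rmorphXn /= incl_ev coef_map -polyC_exp hornerM hornerC.
have q0 : Q'`_0 != 0 by rewrite -horner_coef0.
have sQ' : (0 < size Q')%N.
  by rewrite size_poly_gt0; apply: contraNneq q0 => ->; rewrite coef0.
have /eqP[] := phi_ev_neq0 q0.
move: Q'A; rewrite -(prednK sQ') big_ord_recl /= expr0 mulr1 => /eqP.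
rewrite addr_eq0 => /eqP ->; rewrite rmorphN rmorph_sum big1 ?oppr0 // => i _.
by rewrite rmorphM rmorphXn /= pa exprS mul0r mulr0.
Qed.

Lemma regular_prufer_incl : prufer regular_incl.
Proof.
move=> x; have [u [w [h1 h2 h3 h4 h5]]] :=
  regular_prufer hF (regular_incl_reg a0) a0_transcendental x.
by exists u, w; split=> //; exact: regular_inclP.
Qed.

End Injectivity.

(** * The A-module k{tau} over a finite field k *)

Section TwistedOverFinite.
Variables (Fq : finFieldType) (A : comNzRingType) (K : fieldType).
Variables (iK : {rmorphism Fq -> K}) (phi : {rmorphism A -> twisted_poly iK}).
Variables (k : set K) (hk : is_subfield k) (hphi : defined_over phi k).
Local Notation q := #|Fq|.
Local Notation twp := (twisted_poly iK).

Definition over_k of is_subfield k : {pred twp} := fun P => `[< forall n, k (tw_coef P n) >].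
Lemma over_k_zmod : zmod_closed (over_k hk).
Proof.
split; first by apply/asboolP => n; rewrite tw_coef0; exact: subfield0.
move=> P Q /asboolP hP /asboolP hQ; apply/asboolP => n.
by rewrite tw_coefD tw_coefN; exact: subfieldB.
Qed.
HB.instance Definition _ := GRing.isZmodClosed.Build twp (over_k hk) over_k_zmod.
(* [twk] is the ring k{tau}, an [A]-module through left multiplication by [phi a]. *)
Record twk (hd : defined_over phi k) := Twk { twval : twp; twvalP : twval \in over_k hk }.
HB.instance Definition _ := [isSub for @twval hphi].
HB.instance Definition _ := [Choice of twk hphi by <:].
HB.instance Definition _ := [SubChoice_isSubZmodule of twk hphi by <:].

Lemma over_kM P Q : P \in over_k hk -> Q \in over_k hk -> P * Q \in over_k hk.
Proof.
move=> /asboolP hP /asboolP hQ; apply/asboolP => n; rewrite tw_coefM.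
apply: (subfield_sum hk) => i _; apply: (subfield_sum hk) => j _; case: eqP => _; last exact: subfield0.
by apply: subfieldM => //; exact: subfieldX.
Qed.
Lemma over_k_phi a : phi a \in over_k hk.
Proof. by apply/asboolP => n; exact: hphi. Qed.

Definition twk_act (a : A) (P : twk hphi) : twk hphi :=
  Twk hphi (over_kM (over_k_phi a) (twvalP P)).
Lemma twk_actA a b P : twk_act a (twk_act b P) = twk_act (a * b) P.
Proof. by apply: val_inj; rewrite /= rmorphM mulrA. Qed.
Lemma twk_act1 : left_id 1 twk_act.
Proof. by move=> P; apply: val_inj; rewrite /= rmorph1 mul1r. Qed.
Lemma twk_actDr : right_distributive twk_act +%R.
Proof. by move=> a P Q; apply: val_inj; rewrite /= mulrDr. Qed.
Lemma twk_actDl P : {morph twk_act^~ P : a b / a + b}.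
Proof. by move=> a b; apply: val_inj; rewrite /= rmorphD mulrDl. Qed.
HB.instance Definition _ := GRing.Zmodule_isLmodule.Build A (twk hphi)
  twk_actA twk_act1 twk_actDr twk_actDl.

Lemma twval_act a (P : twk hphi) : twval (a *: P) = phi a * twval P. Proof. by []. Qed.
Lemma twval_coefB (P Q : twk hphi) n :
  tw_coef (twval (P - Q)) n = tw_coef (twval P) n - tw_coef (twval Q) n.
Proof. by rewrite -tw_coefN -tw_coefD. Qed.
Lemma twval_k (P : twk hphi) n : k (tw_coef (twval P) n).
Proof. by case: P => P /= /asboolP. Qed.

Hypothesis phi_inj : forall a, phi a = 0 -> a = 0.

Lemma twk_torsion_free (a : A) (P : twk hphi) : a *: P = 0 -> a = 0 \/ P = 0.
Proof.
move=> /(congr1 (@twval hphi)); rewrite twval_act => /tw_mulf_eq0[/phi_inj|h]; first by left.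
by right; apply: val_inj.
Qed.

Hypothesis k_fin : finite_set k.

Lemma finite_subfield_perfect c : k c -> exists2 c', k c' & c' ^+ q = c.
Proof.
move=> kc; have [s ks] := (finite_seqP k).1 k_fin.
have inj : injective (fun x : K => x ^+ q).
  have qB : {morph (fun x : K => x ^+ q) : x y / x + y}.
    by have := qpowD iK 1; rewrite expn1.
  move=> x y /= e; apply/eqP; rewrite -subr_eq0.
  have : (x - y) ^+ q = 0.
    have q0 : (0 : K) ^+ q = 0 by have := @expq0 Fq K 1; rewrite expn1.
    apply: (addIr (y ^+ q)); rewrite -(qB (x - y) y) subrK e.
    by rewrite add0r.
  by move/eqP; rewrite expf_eq0 => /andP[].
pose s' := undup s.
have sub : {subset map (fun x => x ^+ q) s' <= s'}.
  move=> _ /mapP[x xs ->]; rewrite mem_undup in xs; rewrite mem_undup.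
  have kx : k x by rewrite ks.
  by have := subfieldX hk q kx; rewrite ks.
have [||_ e] := uniq_min_size _ sub; first by rewrite map_inj_uniq ?undup_uniq.
  by rewrite size_map.
have : c \in map (fun x => x ^+ q) s' by rewrite e mem_undup; move: kc; rewrite ks.
case/mapP=> x xs ->; exists x => //; rewrite mem_undup in xs.
by rewrite ks.
Qed.

Lemma finite_subfield_root n c : k c -> exists2 c', k c' & c' ^+ (q ^ n) = c.
Proof.
elim: n c => [|n IH] c kc; first by exists c; rewrite // expn0 expr1.
have [c1 k1 <-] := finite_subfield_perfect kc; have [c2 k2 <-] := IH _ k1.
by exists c2; rewrite // expnS mulnC exprM.
Qed.

Lemma mono_over (c : K) i : k c -> (c *: 'X^i : {poly K}) \in over_k hk.
Proof.
move=> kc; apply/asboolP => n; rewrite /tw_coef coefZ coefXn.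
by case: eqP => _; rewrite ?mulr1 ?mulr0 //; exact: subfield0.
Qed.

Definition mono (c : K) i : twk hphi :=
  if pselect (k c) is left kc then Twk hphi (mono_over i kc) else 0.
Lemma monoE c i n : k c -> tw_coef (twval (mono c i)) n = if n == i then c else 0.
Proof.
move=> kc; rewrite /mono; case: pselect => // kc'; rewrite /= /tw_coef coefZ coefXn.
by case: eqP => _; rewrite ?mulr1 ?mulr0.
Qed.

Variables (a0 : A) (r : nat).
Hypotheses (r_gt0 : (0 < r)%N) (ha0 : tw_has_degree r (phi a0)).

(* Division with remainder by [phi a0]; its leading coefficient can be cleared because
   the finite field [k] is perfect. *)
Lemma twk_fin_gen : exists xs : seq (twk hphi), forall P, exists c, P = comb xs c.
Proof.
have [s ks] := (finite_seqP k).1 k_fin.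
(* Every element of the finite field [k] is listed as a coefficient, so each monomial of degree
   below r is itself a generator. *)
pose xs := [seq mono c i | c <- s, i <- iota 0 r]; exists xs.
have G0 : exists c : nat -> A, 0 = comb xs c.
  by exists (fun=> 0); rewrite /comb big1 // => i _; exact: scale0r.
have GD P Q : (exists c, P = comb xs c) -> (exists c, Q = comb xs c) ->
    exists c, P + Q = comb xs c.
  by move=> [c ->] [c' ->]; exists (fun i => c i + c' i); rewrite combD.
have GZ a P : (exists c, P = comb xs c) -> exists c, a *: P = comb xs c.
  by move=> [c ->]; exists (fun i => a * c i); rewrite combZ.
have Gx x : x \in xs -> exists c, x = comb xs c.
  move=> xin; exists (fun i => (i == index x xs)%:R); rewrite /comb.
  have hi : (index x xs < size xs)%N by rewrite index_mem.
  rewrite (bigD1 (Ordinal hi)) //= eqxx scale1r nth_index // big1 ?addr0 // => i.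
  by rewrite -val_eqE /= => /negPf ->; exact: scale0r.
have main n P : tw_lt n (twval P) -> exists c, P = comb xs c.
  elim/ltn_ind: n P => -[_ P hP|n IH P hP].
    suff -> : P = 0 by [].
    by apply: val_inj; apply: tw_ext => i; rewrite tw_coef0; exact: hP.
  pose c := tw_coef (twval P) n; have kc : k c by exact: twval_k.
  have [nr|rn] := ltnP n r.
    have -> : P = mono c n + (P - mono c n) by rewrite addrC subrK.
    apply: GD.
      apply: Gx; apply/allpairsP; exists (c, n); rewrite mem_iota add0n nr.
      by split=> //; move: kc; rewrite ks.
    apply: (IH n) => // i; rewrite leq_eqVlt => /orP[/eqP <-|hi].
      by rewrite twval_coefB monoE // eqxx subrr.
    by rewrite twval_coefB monoE // gtn_eqF // hP // subrr.
  have [ha la] := ha0; have kl : k (tw_coef (phi a0) r) by exact: hphi.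
  (* Moving a constant past tau^r raises it to the power q^r. To cancel the leading coefficient c,
     one solves l c'^(q^r) = c, with l the leading coefficient of [phi a0]. *)
  have [c' kc' c'E] := finite_subfield_root r (subfielddiv hk kc kl).
  pose Q := mono c' (n - r).
  have Qlt : tw_lt (n - r).+1 (twval Q).
    by move=> i hi; rewrite monoE // gtn_eqF.
  have -> : P = a0 *: Q + (P - a0 *: Q) by rewrite addrC subrK.
  apply: GD; first by apply: GZ; apply: (IH _ _ _ Qlt); lia.
  have [h1 h2] := tw_ltM ha Qlt; rewrite subnKC // in h1 h2.
  apply: (IH n) => // i; rewrite leq_eqVlt => /orP[/eqP <-|hi].
    rewrite twval_coefB twval_act h2 monoE // eqxx c'E -/c.
    by rewrite mulrC divfK // subrr.
  by rewrite twval_coefB twval_act h1 // hP // subrr.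
move=> P; apply: (main (size (twval P : {poly K}))).
exact/tw_ltP.
Qed.

Lemma twk_nonzero : exists P : twk hphi, P <> 0.
Proof.
exists (mono 1 0) => /(congr1 (fun P => tw_coef (twval P) 0)).
rewrite monoE ?eqxx; last exact: subfield1.
by rewrite tw_coef0 => /eqP; rewrite oner_eq0.
Qed.

End TwistedOverFinite.

(** * Torsion and countability *)

Lemma finite_roots (E : closedFieldType) (P : {poly E}) : P != 0 ->
  finite_set [set x | root P x].
Proof.
move=> P0; have [r rE] := closed_field_poly_normal P; apply/finite_seqP; exists r.
apply/seteqP; split=> x /=; rewrite rE rootZ ?root_prod_XsubC ?lead_coef_eq0 //.
Qed.

Section TermEvaluation.
Variables (E : fieldType) (f : nat -> E).

(** Elements of a generated subfield are values of terms in subtraction and division, and such terms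
    form a countable type. Labels 0 and 1 on binary nodes encode the two operations; every other
    node stands for 1. *)
Fixpoint term_eval (t : GenTree.tree nat) : E :=
  match t with
  | GenTree.Leaf n => f n
  | GenTree.Node 0 [:: a; b] => term_eval a - term_eval b
  | GenTree.Node 1 [:: a; b] => term_eval a / term_eval b
  | _ => 1
  end.

Lemma subfield_gen_terms : subfield_gen (range f) `<=` range term_eval.
Proof.
apply: subfield_gen_min; last by move=> _ [n _ <-]; exists (GenTree.Leaf n).
apply: is_subfieldI; first by exists (GenTree.Node 2 [::]).
- by move=> _ _ [a _ <-] [b _ <-]; exists (GenTree.Node 0 [:: a; b]).
- by move=> _ _ [a _ <-] [b _ <-]; exists (GenTree.Node 1 [:: a; b]).
Qed.
End TermEvaluation.

Lemma countable_range (T : countType) (E : Type) (f : T -> E) : countable (range f).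
Proof. exact: sub_countable (card_image_le f setT) (countableP _). Qed.

Lemma countable_subfield_gen (E : fieldType) (X : set E) :
  countable X -> countable (subfield_gen X).
Proof.
move=> /countable_injP[g gi].
pose f n := xget 0 [set x | X x /\ g x = n].
have Xf : X `<=` range f.
  move=> x Xx; exists (g x) => //; rewrite /f; case: xgetP => [y _ [Xy gy]|/(_ x)[]] //.
  by apply: gi; rewrite ?inE.
apply: sub_countable (countable_range (term_eval f)); apply: subset_card_le.
exact: subset_trans (subfield_genS Xf) (@subfield_gen_terms _ _).
Qed.

Lemma countable_acl (k : countFieldType) (E : closedFieldType) (f : {rmorphism k -> E}) :
  countable (acl (range f)).
Proof.
apply: (@sub_countable _ _ _
  (\bigcup_(p in [set p : {poly k} | p != 0]) [set x | root (map_poly f p) x])).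
  apply: subset_card_le => x /(acl_range f)[p p0 r]; by exists p.
apply: bigcup_countable => [|p /= p0]; first exact: countableP.
by apply/finite_set_countable/finite_roots; rewrite map_poly_eq0.
Qed.

(** Euclid's argument: were the closure finite, a root of 1 + X times the product of all X - a would
    be algebraic and yet different from every a. *)
Lemma acl_infinite (E : closedFieldType) (S : set E) : is_subfield S -> infinite_set (acl S).
Proof.
move=> hS /finite_seqP[s es].
pose P := \prod_(a <- s) ('X - a%:P) * 'X + 1.
have aS := acl_subfield hS.
have cP : P \is a polyOver (sfpred aS).
  rewrite rpredD ?rpred1 // rpredM ?polyOverX // big_seq rpred_prod // => a ain.
  by rewrite polyOverXsubC; apply/asboolP; rewrite es.
have sP : size P = (size s).+2.
  have e : size (\prod_(a <- s) ('X - a%:P) * 'X) = (size s).+2.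
    by rewrite size_mulX ?monic_neq0 ?monic_prod_XsubC // size_prod_XsubC.
  by rewrite size_polyDl e ?size_poly1.
have [z rz] : exists z, root P z by apply/closed_rootP; rewrite sP.
have az : acl S z.
  apply: (acl_idem hS); exists P; last exact: rz.
  split; first by rewrite -size_poly_eq0 sP.
  by move=> j; apply/asboolP; move/polyOverP: cP; apply.
move: az; rewrite es /= => zs; move: rz; rewrite /root /P hornerD hornerC.
by rewrite hornerM horner_prod (big_rem z) //= hornerXsubC subrr !mul0r add0r oner_eq0.
Qed.

Lemma tw_eval_wide (Fq : finFieldType) (K : fieldType) (iK : {rmorphism Fq -> K})
  (E : fieldType) (eta : {rmorphism K -> E}) (P : twisted_poly iK) m x : tw_lt m P ->
  tw_eval eta P x = \sum_(j < m) eta (tw_coef P j) * x ^+ (#|Fq| ^ j).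
Proof.
move=> /tw_ltP lem; rewrite /tw_eval.
rewrite (big_ord_widen m (fun j => eta (tw_coef P j) * x ^+ (#|Fq| ^ j))) // big_mkcond.
apply: eq_bigr => i _; case: ltnP => // hi.
by rewrite /tw_coef (nth_default 0 hi) rmorph0 mul0r.
Qed.

(** The powers of x lie in a finite space over the finite field [range f]. Its elements generate a
    finite k0-space, which then contains the whole A-orbit of x, since phi_a(x) is a k0-combination
    of powers of x. *)
Lemma finite_power_span (k : finFieldType) (E : fieldType) (f : {rmorphism k -> E})
  (k0 : set E) x : is_subfield k0 -> finite_set k0 -> algebraicOver f x ->
  exists2 S, subspace k0 S & finite_set S /\ forall n, S (x ^+ n).
Proof.
move=> hk0 fk0 [m m0 rm].
have hF := range_subfield f.
have fF : finite_set (range f).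
  apply/finite_seqP; exists (map f (enum k)); apply/seteqP; split=> [_ [c _ <-]|y] /=.
    by apply: map_f; rewrite mem_enum.
  by case/mapP => c _ ->; exists c.
have [S1 hS1 [/finite_seqP[s es] sS1]] := finite_kspan hF fF [seq x ^+ i | i <- iota 0 (size m)].
have [S2 hS2 [fS2 sS2]] := finite_kspan hk0 fk0 s.
exists S2 => //; split=> // n; apply: sS2; rewrite -es.
have -> : x ^+ n = (map_poly f ('X^n %% m)).[x].
  rewrite -[LHS]hornerXn -(map_polyXn f) {1}(divp_eq 'X^n m) rmorphD rmorphM.
  by rewrite hornerD hornerM (rootP rm) mulr0 add0r.
rewrite horner_coef; apply: subspace_sum => [|i _]; first exact: hS1. 
have [_ _ SZ] := hS1; apply: SZ; first by rewrite coef_map; exists ('X^n %% m)`_i.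
apply: sS1; apply: map_f; rewrite mem_iota add0n.
by apply: leq_trans (ltn_ord i) _; rewrite size_map_poly ltnW // ltn_modp.
Qed.

(** * From sequences of twisted polynomials to points *)

Section Theta.
Variables (Fq : finFieldType) (A : comNzRingType) (K : fieldType).
Variables (iK : {rmorphism Fq -> K}) (phi : {rmorphism A -> twisted_poly iK}).
Variables (k : set K) (hk : is_subfield k) (hphi : defined_over phi k).
Variables (E : fieldType) (eta : {rmorphism K -> E}) (b : nat -> E).
Local Notation V := (drinfeld_points phi eta).
Local Notation N := (twk hk hphi).

Definition theta_upto (x : fs N) n : V :=
  \sum_(i < n) (tw_eval eta (twval (fsval x i)) (b i) : V).

Lemma tw_eval0 (y : E) : tw_eval eta (0 : twisted_poly iK) y = 0.
Proof. by rewrite (@tw_eval_wide _ _ _ _ _ _ 0) ?big_ord0 // => i _; rewrite tw_coef0. Qed.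

Lemma theta_upto_wide x m n : (m <= n)%N -> (forall i, (m <= i)%N -> fsval x i = 0) ->
  theta_upto x n = theta_upto x m.
Proof.
move=> le hx; rewrite /theta_upto.
rewrite [RHS](big_ord_widen n (fun i => tw_eval eta (twval (fsval x i)) (b i) : V)) //.
rewrite [RHS]big_mkcond; apply: eq_bigr => i _; case: ltnP => // /hx ->.
exact: tw_eval0.
Qed.

Definition fs_size (x : fs N) : nat := projT1 (cid (fs_bound x)).
Lemma fs_sizeP x i : (fs_size x <= i)%N -> fsval x i = 0.
Proof. by rewrite /fs_size; case: cid => n /= h; apply: h. Qed.

(** The map from R^(N) that sends (P_i) to the sum of the P_i(b_i). The truncation is at a chosen
    bound of the support; any other bound gives the same value by [thetaE]. *)
Definition theta (x : fs N) : V := theta_upto x (fs_size x).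

Lemma thetaE x n : (forall i, (n <= i)%N -> fsval x i = 0) -> theta x = theta_upto x n.
Proof.
move=> hx; rewrite /theta -(@theta_upto_wide x n (maxn n (fs_size x))) ?leq_maxl //.
by rewrite (@theta_upto_wide x (fs_size x)) ?leq_maxr //; exact: fs_sizeP.
Qed.

Lemma theta_lin : lin theta.
Proof.
move=> a x y; pose n := maxn (fs_size x) (fs_size y).
have hx i : (n <= i)%N -> fsval x i = 0.
  by move=> h; apply: fs_sizeP; apply: leq_trans h; exact: leq_maxl.
have hy i : (n <= i)%N -> fsval y i = 0.
  by move=> h; apply: fs_sizeP; apply: leq_trans h; exact: leq_maxr.
have hxy i : (n <= i)%N -> fsval (a *: x + y) i = 0.
  move=> h; rewrite -[fsval (a *: x + y) i]/(a *: fsval x i + fsval y i) hx // hy //.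
  by rewrite scaler0 addr0.
rewrite (thetaE hx) (thetaE hy) (thetaE hxy) /theta_upto scaler_sumr -big_split.
apply: eq_bigr => i _.
transitivity (tw_eval eta (phi a * twval (fsval x i) + twval (fsval y i)) (b i)); first by [].
by rewrite tw_evalDl tw_evalM.
Qed.

Lemma theta_expansion x : exists n, (forall i, (n <= i)%N -> fsval x i = 0) /\
  theta x = expansion #|Fq| b n (fun i j => eta (tw_coef (twval (fsval x i)) j)) /\
  forall i j, (n <= j)%N -> tw_coef (twval (fsval x i)) j = 0.
Proof.
pose m := fs_size x.
pose n := maxn m (\max_(i < m) size (twval (fsval x i) : {poly K})).
have hx i : (n <= i)%N -> fsval x i = 0.
  by move=> h; apply: fs_sizeP; apply: leq_trans h; exact: leq_maxl.
have hc i j : (n <= j)%N -> tw_coef (twval (fsval x i)) j = 0.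
  move=> nj; have [mi|im] := leqP m i.
    by rewrite (@fs_sizeP x i mi) tw_coef0.
  have /tw_ltP : (size (twval (fsval x i) : {poly K}) <= n)%N.
    apply: leq_trans (leq_maxr _ _).
    exact: (leq_bigmax (F := fun i : 'I_m => size (twval (fsval x i) : {poly K})) (Ordinal im)).
  exact.
exists n; split=> //; split=> //; rewrite (thetaE hx); apply: eq_bigr => i _.
by apply: tw_eval_wide => j; exact: hc.
Qed.

Lemma expansion_theta n (c : nat -> nat -> K) : (forall i j, k (c i j)) ->
  exists x, theta x = expansion #|Fq| b n (fun i j => eta (c i j)).
Proof.
move=> kc; pose P i : twisted_poly iK := \poly_(j < n) c i j.
have hP i : P i \in over_k (iK := iK) hk.
  apply/asboolP => j; rewrite /tw_coef coef_poly; case: ifP => _ //; exact: subfield0.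
have hs : exists m, forall i, (m <= i)%N ->
    (if (i < n)%N then Twk (hk := hk) hphi (hP i) else 0) = 0.
  by exists n => i le; rewrite ltnNge le.
exists (mkfs hs); rewrite (@thetaE _ n) => [|i le /=]; last by rewrite ltnNge le.
apply: eq_bigr => i _ /=; rewrite ltn_ord /=.
rewrite (@tw_eval_wide _ _ _ _ _ _ n) => [|j hj]; last by rewrite /tw_coef coef_poly ltnNge hj.
by apply: eq_bigr => j _; rewrite /tw_coef coef_poly ltn_ord.
Qed.

End Theta.

(** * Standard basis of the free module of countable rank *)

Lemma delta_bound (A : nzRingType) (n : nat) :
  exists m, forall i, (m <= i)%N -> ((i == n)%:R : (A^o : lmodType A)) = 0.
Proof. by exists n.+1 => i hi; rewrite gtn_eqF. Qed.
Definition delta_fs (A : nzRingType) (n : nat) : fs (A^o : lmodType A) :=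
  mkfs (delta_bound A n).

Lemma fs_delta_sum (A : nzRingType) (z : fs (A^o : lmodType A)) n :
  (forall i, (n <= i)%N -> fsval z i = 0) ->
  z = \sum_(j < n) (fsval z j : A) *: delta_fs A j.
Proof.
move=> hz.
have ev (c : nat -> A) i : fsval (\sum_(j < n) c j *: delta_fs A j) i =
    \sum_(j < n) c j * (i == j)%:R :> A.
  by apply: (big_morph (fun w : fs (A^o : lmodType A) => fsval w i : A)).
apply: fs_ext => i; rewrite (ev (fun j => fsval z j)).
have [le|lt] := leqP n i.
  rewrite hz // big1 // => j _; rewrite gtn_eqF ?mulr0 //.
  exact: leq_trans (ltn_ord j) le.
rewrite (bigD1 (Ordinal lt)) //= eqxx mulr1 big1 ?addr0 // => j.
by rewrite -val_eqE /= eq_sym => /negPf ->; rewrite mulr0.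
Qed.

Lemma fs_delta_eval (A : nzRingType) n (c : 'I_n -> A) (j : 'I_n) :
  fsval (\sum_(i < n) c i *: delta_fs A i) j = c j.
Proof.
have -> : fsval (\sum_(i < n) c i *: delta_fs A i) j = \sum_(i < n) c i * (j == i :> nat)%:R :> A.
  by apply: (big_morph (fun w : fs (A^o : lmodType A) => fsval w j : A)).
rewrite (bigD1 j) //= eqxx mulr1 big1 ?addr0 // => i.
by rewrite -val_eqE /= eq_sym => /negPf ->; rewrite mulr0.
Qed.

Lemma free_of_iso (A : nzRingType) (V : lmodType A) (g : fs (A^o : lmodType A) -> V) :
  lin g -> injective g -> free_of_rank_aleph0 (range g).
Proof.
move=> lg ig; exists (fun n => g (delta_fs A n)).
have gs n (c : 'I_n -> A) :
    \sum_(j < n) c j *: g (delta_fs A j) = g (\sum_(j < n) c j *: delta_fs A j).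
  by rewrite (lin_sum _ _ _ lg); apply: eq_bigr => j _; rewrite (linZ _ _ lg).
split=> [x|n c].
  split=> [[z _ <-]|[n [c ->]]]; last by rewrite gs; eexists.
  have [n hn] := fs_bound z; exists n, (fun j => fsval z j).
  by rewrite gs -fs_delta_sum.
rewrite gs -(lin0 lg) => /ig e j.
by rewrite -(fs_delta_eval c j) e.
Qed.

(** * Transport of generators and transcendence bases to the algebraic closure *)

Lemma image_subfield_gen (K E : fieldType) (eta : {rmorphism K -> E}) (X : set K) :
  eta @` subfield_gen X `<=` subfield_gen (eta @` X).
Proof.
move=> _ [x Xx <-]; pose S := [set y : K | subfield_gen (eta @` X) (eta y)].
have hG := subfield_gen_subfield (eta @` X).
apply: (Xx S) => [|y Xy]; last by apply: sub_subfield_gen; exists y.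
apply: is_subfieldI; first by rewrite /S /= rmorph1; exact: subfield1.
- by move=> y z; rewrite /S /= rmorphB; exact: subfieldB.
- by move=> y z; rewrite /S /= fmorph_div; exact: subfielddiv.
Qed.

Lemma finite_subfield_algebraic (k E : fieldType) (f : {rmorphism k -> E}) (S : set E) :
  is_subfield S -> finite_set S -> S `<=` acl (range f).
Proof.
move=> hS fS c Sc; apply/acl_range.
have [i [j [ij e]]] : exists i j, i != j /\ c ^+ i = c ^+ j.
  apply: contrapT => h; apply: infinite_nat.
  have inj : {in [set: nat] &, injective (fun i => c ^+ i)}.
    move=> i j _ _ e; apply/eqP; apply: contrapT => /negP ij; apply: h.
    by exists i, j.
  rewrite -(eq_finite_set (inj_card_eq inj)); apply: sub_finite_set fS => _ [i _ <-].
  exact: subfieldX.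
exists ('X^i - 'X^j); last by rewrite /root rmorphB /= !map_polyXn !hornerE e subrr.
apply: contra_neq ij => /subr0_eq/(congr1 (fun p : {poly k} => size p)).
by rewrite !size_polyXn => -[].
Qed.

Section TranscendenceTower.
Variables (k K : fieldType) (E : closedFieldType).
Variables (u : {rmorphism k -> K}) (eta : {rmorphism K -> E}).
Variables (d : nat) (t : d.-tuple K).

Lemma image_generators (X : set K) :
  eta @` subfield_gen (range u `|` X) `<=` subfield_gen (range (eta \o u) `|` eta @` X).
Proof.
apply: subset_trans (@image_subfield_gen _ _ _ _) _; apply: subfield_genS.
move=> _ [x [[c _ <-]|Xx] <-]; first by left; exists c.
by right; exists x.
Qed.

Lemma alg_independent_comp : alg_independent u t ->
  alg_independent (eta \o u) (map_tuple eta t).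
Proof.
move=> ind P hP; apply: ind; apply: (fmorph_inj eta); rewrite rmorph0 -[RHS]hP.
rewrite /mpoly.mmap rmorph_sum; apply: eq_bigr => m _ /=.
rewrite rmorphM; congr (_ * _); rewrite /mpoly.mmap1 rmorph_prod.
by apply: eq_bigr => i _; rewrite rmorphXn tnth_map.
Qed.

Lemma transcendence_basis_acl : is_algebraic_closure eta ->
  (forall x, algebraic_over_set (subfield_gen (range u `|` [set` t])) x) ->
  forall x, acl (subfield_gen (range (eta \o u) `|` range (tnth (map_tuple eta t)))) x.
Proof.
move=> hE alg x.
have /acl_range hx := hE x.
have hG := subfield_gen_subfield (range (eta \o u) `|` range (tnth (map_tuple eta t))).
apply: (acl_idem hG); apply: aclS hx => _ [y _ <-].
have [P [P0 hP] r] := alg y; exists (map_poly eta P); last by rewrite /root horner_map (rootP r) rmorph0.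
split; first by rewrite map_poly_eq0.
move=> j; rewrite coef_map.
have : (eta @` subfield_gen (range u `|` [set` t])) (eta P`_j) by exists P`_j.
move=> /image_generators; apply: subfield_genS => z [fz|[w /= wt <-]]; first by left.
by case/tnthP: wt => i ->; right; exists i; rewrite // tnth_map.
Qed.

End TranscendenceTower.

(** * Torsion and free complement in phi(L) *)

Theorem mainTheorem8
  (p e : nat) (p_prime : prime p)
  (Fq : finFieldType) (card_Fq : #|Fq| = (p ^ e)%N)
  (F : fieldType) (iF : {rmorphism Fq -> F}) (hF : is_function_field iF)
  (oo : set F) (hoo : is_closed_point iF oo)
  (K : fieldType) (iK : {rmorphism Fq -> K}) (u : {rmorphism 'F_p -> K})
  (K_fin_gen : fin_gen_field u)
  (d : nat) (K_trdeg : has_trdeg u d) (d_gt0 : (0 < d)%N)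
  (i : {rmorphism regular_fun iF oo -> K})
  (phi : {rmorphism regular_fun iF oo -> twisted_poly iK})
  (hphi : is_drinfeld_module i phi)
  (k : set K) (k_subfield : is_subfield k) (k_finite : finite_set k)
  (phi_over_k : defined_over phi k)
  (Kalg : closedFieldType) (eta : {rmorphism K -> Kalg})
  (hKalg : is_algebraic_closure eta) :
  let V : lmodType (regular_fun iF oo) := drinfeld_points phi eta in
  let L : set V := Fp_alg_compositum u eta in
  let T : set V := Fp_alg u eta in
  [/\ is_submodule L,
      is_submodule T /\ infinite_set T,
      T = torsion_set V
    & exists M : set V,
        [/\ is_submodule M, free_of_rank_aleph0 M & direct_sum L T M]].
Proof.
move=> V L T.
pose f : {rmorphism 'F_p -> Kalg} := eta \o u.
pose Tk : set Kalg := acl (range f).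
have TE : T = Tk :> set Kalg.
  by apply/seteqP; split=> x /acl_range.
have hTk : is_subfield Tk := acl_subfield (range_subfield f).
have hL : is_subfield (L : set Kalg) := subfield_gen_subfield _.
have TL : Tk `<=` L by rewrite -TE => x Tx; apply: sub_subfield_gen; left.
pose q := #|Fq|.
have q_gt1 : (1 < q)%N := card_Fq_gt1 Fq.
have qD : {morph (fun x : Kalg => x ^+ q) : x y / x + y}.
  by have := qpowD (eta \o iK) 1; rewrite expn1.
pose k0 := eta @` k.
have hk0 : is_subfield k0.
  apply: is_subfieldI; first by exists 1; rewrite ?rmorph1 //; exact: subfield1.
  - by move=> _ _ [x kx <-] [y ky <-]; exists (x - y); rewrite ?rmorphB //; exact: subfieldB.
  - by move=> _ _ [x kx <-] [y ky <-]; exists (x / y); rewrite ?fmorph_div //; exact: subfielddiv.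
have k0_fin : finite_set k0 by exact: finite_image.
have k0T : k0 `<=` Tk := finite_subfield_algebraic f hk0 k0_fin.
have k0_perf c : k0 c -> exists2 c', k0 c' & c' ^+ q = c.
  move=> [x kx <-]; have [y ky <-] := finite_subfield_perfect iK k_subfield k_finite kx.
  by exists (eta y); [exists y | rewrite rmorphXn].
have act_closed (S : set Kalg) : is_subfield S -> k0 `<=` S -> is_submodule (S : set V).
  move=> hS kS; split; first by apply: mem_set; exact: (subfield0 hS).
  move=> a x y /set_mem Sx /set_mem Sy; apply: mem_set; apply: (subfieldD hS) => //.
  apply: (subfield_sum hS) => j _; apply: (subfieldM hS); last exact: subfieldX.
  by apply: kS; exists (tw_coef (phi a) j).
have [a0 [r [r_gt0 ha0]]] : exists a0 r, (0 < r)%N /\ tw_has_degree r (phi a0).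
  have [_ /existsNP[a na]] := hphi; exists a, (tw_degree (phi a)).
  split; first by rewrite lt0n; apply/eqP.
  by apply: tw_degreeE; apply: contra_notN na => /eqP ->; rewrite /tw_degree size_poly0.
have hF1 := hF.2.
have phi_inj := phi_injective hF1 r_gt0 ha0.
have torsT : T = torsion_set V.
  rewrite TE; apply/seteqP; split=> x.
    move=> /acl_range ax.
    have [S hS [fS xS]] := finite_power_span hk0 k0_fin ax.
    have actS (a : regular_fun iF oo) : S (a *: (x : V)).
      apply: (subspace_sum _ hS) => j _; have [_ _ SZ] := hS; apply: SZ; last exact: xS.
      by exists (tw_coef (phi a) j).
    (* The orbit of x lies in the finite set S, so two distinct powers of a0 act alike on x. Their
       difference is nonzero, the images under [phi] having degrees r m and r n. *)
    have [m [n [mn e1]]] : exists m n, m != n /\ (a0 ^+ m) *: (x : V) = (a0 ^+ n) *: (x : V).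
      apply: contrapT => h; apply: infinite_nat.
      have inj : {in [set: nat] &, injective (fun m => (a0 ^+ m) *: (x : V))}.
        move=> m n _ _ e1; apply/eqP; apply: contrapT => /negP mn; apply: h.
        by exists m, n.
      rewrite -(eq_finite_set (inj_card_eq inj)); apply: sub_finite_set fS => _ [m _ <-].
      exact: actS.
    exists (a0 ^+ m - a0 ^+ n); last by rewrite scalerBl e1 subrr.
    rewrite subr_eq0; apply: contra_neq mn => /(congr1 phi); rewrite !rmorphXn => e2.
    have := tw_degreeX m ha0; rewrite e2 => h1.
    have /eqP := tw_degree_uniq h1 (tw_degreeX n ha0).
    by rewrite eqn_pmul2l // => /eqP.
  move=> [a a_neq ax].
  have pa : phi a != 0 by apply: contra_neq a_neq => /phi_inj.
  have [_ lpa] := tw_degreeE pa.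
  apply: (acl_idem (range_subfield f)).
  (* This is phi_a as an ordinary polynomial. The exponents q^j are distinct, so its leading
     coefficient survives, and all its coefficients are algebraic over F_p. *)
  pose P := \sum_(j < size (phi a : {poly K})) eta (tw_coef (phi a) j) *: 'X^(q ^ j).
  have PE l : P`_l = \sum_(j < size (phi a : {poly K}))
      eta (tw_coef (phi a) j) * (l == (q ^ j)%N)%:R.
    by rewrite coef_sum; apply: eq_bigr => j _; rewrite coefZ coefXn.
  exists P; last first.
    by rewrite /root -[X in _ == X]ax horner_sum; apply/eqP/eq_bigr => j _; rewrite hornerZ hornerXn.
  have sz : (0 < size (phi a : {poly K}))%N by rewrite size_poly_gt0.
  split.
    apply: contra_neq lpa => P0; apply: (fmorph_inj eta); rewrite rmorph0.
    have lt : (tw_degree (phi a) < size (phi a : {poly K}))%N by rewrite /tw_degree prednK.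
    have := PE (q ^ tw_degree (phi a))%N; rewrite P0 coef0 (bigD1 (Ordinal lt)) //= eqxx mulr1.
    rewrite big1 ?addr0 // => j; rewrite -val_eqE /= => jn.
    by rewrite eqn_exp2l // eq_sym (negPf jn) mulr0.
  move=> l; rewrite PE; apply: (subfield_sum hTk) => j _; apply: (subfieldM hTk).
    by apply: k0T; exists (tw_coef (phi a) j).
  by case: (_ == _); [exact: (subfield1 hTk) | exact: (subfield0 hTk)].
split=> //.
- by apply: act_closed => //; exact: subset_trans TL.
- by split; rewrite TE; [exact: act_closed | exact: acl_infinite (range_subfield f)].
have [t t_ind t_alg] := K_trdeg.
have [s sK] := K_fin_gen.
have f_ind : alg_independent f (map_tuple eta t) := alg_independent_comp (eta := eta) t_ind.
have [h [h0 hD hZ hX]] := exists_total_height (alg_independent_acl f_ind)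
  (transcendence_basis_acl hKalg t_alg) (map eta s).
have etaL y : (L : set Kalg) (eta y) by apply: sub_subfield_gen; right; exists y.
have LZ : (L : set Kalg) `<=` subfield_gen (Tk `|` [set` map eta s]).
  apply: subfield_gen_min; first exact: subfield_gen_subfield.
  move=> x [Tx|[y _ <-]]; first by apply: sub_subfield_gen; left; rewrite -/Tk -TE.
  have : (eta @` subfield_gen (range u `|` [set` s])) (eta y) by exists y; rewrite ?sK.
  move=> /image_generators; apply: subfield_genS => z [fz|[w /= ws <-]].
    by left; apply: (sub_acl (range_subfield f)).
  by right; apply: map_f.
have hX' x : (L : set Kalg) x -> h (x ^+ q) = (q * h x)%N.
  by move=> Lx; apply: hX; [exact: LZ | exact: ltnW].
have L_count : countable (L : set Kalg).
  apply: sub_countable (countable_subfield_gen (X := Tk `|` [set` map eta s]) _).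
    exact: subset_card_le.
  apply: (@sub_countable _ _ _
    (\bigcup_(c in [set: bool]) if c then Tk else [set` map eta s])).
    by apply: subset_card_le => x [Tx|sx]; [exists true | exists false].
  apply: bigcup_countable => [|[] _]; first exact: countableP.
    exact: countable_acl.
  by apply/finite_set_countable/finite_seqP; eexists.
have L_neq : exists2 x, (L : set Kalg) x & ~ Tk x.
  (* Positive transcendence degree enters here and provides a nonconstant element of L. *)
  have i0 : 'I_d := Ordinal d_gt0.
  exists (eta (tnth t i0)); first exact: etaL.
  move=> h1; apply: (alg_independent_acl f_ind (i := i0)); rewrite tnth_map.
  by apply: aclS h1; apply: subset_trans (@sub_subfield_gen _ _); exact: subsetUl.
(* Countability of L yields the ranking along which the greedy basis is chosen. *)
have /countable_injP[rk rk_inj] := L_count.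
have T_inf : infinite_set Tk := acl_infinite (range_subfield f).
have g_inf := greedy_infinite q_gt1 hk0 hTk hL k0_fin T_inf k0T TL h0 hD hZ hX' L_neq (r := rk).
have g_count : countable (greedy q k0 L h rk).
  by apply: sub_countable L_count; apply: subset_card_le => x [].
have [b [b_inj b_range]] := countable_infinite_enum g_count g_inf.
pose N : lmodType (regular_fun iF oo) := twk k_subfield phi_over_k.
pose th := theta (hk := k_subfield) (hphi := phi_over_k) eta b.
have th_lin : lin th := @theta_lin _ _ _ _ _ _ _ _ _ _ _.
(* This one statement gives both the injectivity of [th] and the triviality of the intersection of
   its range with T. *)
have th_T (x : fs N) : Tk (th x) -> x = 0.
  have [n [hx [xE hc]]] := theta_expansion eta b x; rewrite /th xE.
  move=> /(expansion_indep q_gt1 qD hk0 hTk hL k0T TL k0_perf h0 hD hZ hX' rk_inj b_inj b_range) hz.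
  apply: fs_ext => i'; apply: val_inj; apply: tw_ext => j; rewrite tw_coef0.
  have [ni|ni] := leqP n i'; first by rewrite hx // tw_coef0.
  have [nj|nj] := leqP n j; first exact: hc.
  apply: (fmorph_inj eta); rewrite rmorph0; apply: hz ni nj => i1 j1.
  by exists (tw_coef (twval (fsval x i1)) j1); first exact: twval_k.
have b_L n : (L : set Kalg) (b n).
  have : greedy q k0 L h rk (b n) by rewrite -b_range; exists n.
  by case.
have [xs xs_gen] := twk_fin_gen k_subfield phi_over_k k_finite r_gt0 ha0.
have prf := regular_prufer_incl hF1 r_gt0 ha0.
have tf := @twk_torsion_free _ _ _ _ _ _ k_subfield phi_over_k phi_inj.
have inc_inj := @regular_incl_inj _ _ iF oo.
have r1 := retract_free inc_inj prf tf xs_gen.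
have r2 := retract_generator inc_inj prf tf xs_gen (twk_nonzero k_subfield phi_over_k).
have [g [g' [g_lin gK g'K]]] := fs_iso r1 r2.
have th_inj : injective th.
  move=> x y exy; apply/eqP; rewrite -subr_eq0; apply/eqP/th_T.
  by rewrite (linB _ _ th_lin) exy subrr; exact: (subfield0 hTk).
have rangeE : range (th \o g) = range th.
  apply/seteqP; split=> _ [x _ <-]; first by exists (g x).
  by exists (g' x); rewrite //= g'K.
(* The complement is the image of R^(N); its A-basis is carried over from A^(N) by the isomorphism
   [g]. *)
exists (range th); split.
- split; first by apply: mem_set; exists 0; rewrite // (lin0 th_lin).
  move=> a _ _ /set_mem[x _ <-] /set_mem[y _ <-]; apply: mem_set.
  by exists (a *: x + y); rewrite // th_lin.
- rewrite -rangeE; apply: free_of_iso; first by move=> a x y /=; rewrite g_lin th_lin.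
  by apply: inj_comp th_inj _; exact: can_inj gK.
split=> [x|x Tx [y _ yx]]; last by rewrite -yx (th_T y) ?(lin0 th_lin) // yx -TE.
split=> [Lx|[t1 Tt1 [_ [y _ <-] ->]]]; last first.
  apply: (subfieldD hL); first by apply: TL; rewrite -TE.
  have [n [_ [yE _]]] := theta_expansion eta b y; rewrite /th yE.
  apply: (subfield_sum hL) => j _; apply: (subfield_sum hL) => l _; apply: (subfieldM hL) => //.
  exact: (subfieldX hL).
have [t1 [n [c [Tt1 kc _ ->]]]] := expansion_span q_gt1 qD hk0 hTk hL k0T h0 hD hZ hX' b_range Lx.
exists t1; first by rewrite TE.
have /choice[c' hc'] : forall ij : nat * nat, exists c', k c' /\ eta c' = c ij.1 ij.2.
  by move=> ij; have [c' kc' ec'] := kc ij.1 ij.2; exists c'.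
have [y hy] := expansion_theta k_subfield phi_over_k eta b n
  (c := fun i j => c' (i, j)) (fun i j => (hc' (i, j)).1).
exists (th y); first by exists y.
congr (_ + _); rewrite /th hy; apply: eq_bigr => i1 _; apply: eq_bigr => j1 _.
by rewrite (hc' (nat_of_ord i1, nat_of_ord j1)).2.
Qed.
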